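(* Let $\Bbbk$ be a field of characteristic zero. For every pre-Lie algebra $L$ over $\Bbbk$ and every $L$-module $E$, there is an isomorphism $$H_{\mathrm{PreLie}}^\bullet(L,E)\cong\mathrm{Ext}^\bullet_{U_{\mathrm{PreLie}}(L)}(\Omega^1_{\mathrm{PreLie}}(L),E),$$ where $H^\bullet_{\mathrm{PreLie}}(L,E)$ is the (operadic) cohomology of the pre-Lie algebra $L$ with coefficients in $E$, $U_{\mathrm{PreLie}}(L)$ is the universal multiplicative enveloping algebra of $L$, $\Omega^1_{\mathrm{PreLie}}(L)$ is the module of Kähler differentials of $L$, and $\mathrm{Ext}$ is taken in the category of left $U_{\mathrm{PreLie}}(L)$-modules.
   Context: A pre-Lie (right-symmetric) algebra is a vector space $L$ with a bilinear operation $\triangleleft$ satisfying $(a_1\triangleleft a_2)\triangleleft a_3 - a_1\triangleleft (a_2\triangleleft a_3)=(a_1\triangleleft a_3)\triangleleft a_2 - a_1\triangleleft (a_3\triangleleft a_2)$. An $L$-module is a vector space $E$ with bilinear maps $(a,e)\mapsto a\triangleleft e\in E$ and $(e,a)\mapsto e\triangleleft a\in E$ ($a\in L$, $e\in E$) such that the square-zero extension $L\oplus E$, with product extending that of $L$ by these maps and by $E\triangleleft E=0$, is a pre-Lie algebra. The universal multiplicative enveloping algebra $U_{\mathrm{PreLie}}(L)$ is the unital associative algebra whose left modules are the same as $L$-modules; it is generated by symbols $l_a,r_a$ linear in $a\in L$ (acting by $l_a(e)=a\triangleleft e$, $r_a(e)=e\triangleleft a$) subject to $r_br_a-r_{a\triangleleft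 b}=r_ar_b-r_{b\triangleleft a}$ and $r_bl_a-l_ar_b=l_{a\triangleleft b}-l_al_b$. The module of Kähler differentials $\Omega^1_{\mathrm{PreLie}}(L)$ is the $L$-module representing the functor $E\mapsto\mathrm{Der}(L,E)$, where a derivation is a linear map $D\colon L\to E$ with $D(a\triangleleft b)=D(a)\triangleleft b+a\triangleleft D(b)$. The cohomology $H^\bullet_{\mathrm{PreLie}}(L,E)$ is that of the cochain complex $C^\bullet_{\mathrm{PreLie}}(L,E)=(\mathrm{Hom}(\mathrm{PreLie}^{\text{¡}}(L),E),d)$. Here $\mathrm{PreLie}^{\text{¡}}$ is the Koszul dual cooperad of the operad of pre-Lie algebras (its arity $n$ component is in homological degree $n-1$) and $\mathrm{PreLie}^{\text{¡}}(L)=\bigoplus_{n\ge1}\mathrm{PreLie}^{\text{¡}}(n)\otimes_{\Bbbk S_n}L^{\otimes n}$ is its evaluation on the vector space $L$; thus the component of cohomological degree $n\ge 0$ is $C^n\cong\mathrm{Hom}(L\otimes\Lambda^{n}(L),E)$. The differential is obtained by regarding this as a subcomplex of the operadic deformation complex of the pre-Lie algebra $L\oplus E$: the latter is the complex of coderivations of the cofree $\mathrm{PreLie}^{\text{¡}}$-coalgebra $\mathrm{PreLie}^{\text{¡}}(L\oplus E)$ with differential the graded commutator with the square-zero coderivation encoding the pre-Lie product of $L\oplus E$, and the subcomplex consists of the coderivations whose corestriction to $L\oplus E$ is a map that factors through the projection $\mathrm{PreLie}^{\text{¡}}(L\oplus E)\to\mathrm{PreLie}^{\text{¡}}(L)$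 and takes values in $E$. *)

(* Defs.v *)
From HB Require Import structures.
From mathcomp Require Import all_boot all_algebra.
From mathcomp Require Import boolp classical_sets functions.

Set Implicit Arguments.
Unset Strict Implicit.
Unset Printing Implicit Defensive.

Import GRing.Theory.
Local Open Scope ring_scope.
Local Open Scope quotient_scope.

Section PresentedModule.
Variables (R : pzRingType) (X : Type).

Inductive mterm : Type :=
| MGen of X
| MZero
| MAdd of mterm & mterm
| MScale of R & mterm.

HB.instance Definition _ := gen_eqMixin mterm.
HB.instance Definition _ := gen_choiceMixin mterm.

Variable rel : mterm -> mterm -> Prop.

Inductive mcong : mterm -> mterm -> Prop :=
| mc_rel s t of rel s t : mcong s t
| mc_refl t : mcong t t
| mc_sym s t of mcong s t : mcong t s
| mc_trans t s u of mcong s t & mcong t u : mcong s u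
| mc_add s s' t t' of mcong s s' & mcong t t' : mcong (MAdd s t) (MAdd s' t')
| mc_scale c t t' of mcong t t' : mcong (MScale c t) (MScale c t')
| mc_addA s t u : mcong (MAdd s (MAdd t u)) (MAdd (MAdd s t) u)
| mc_addC s t : mcong (MAdd s t) (MAdd t s)
| mc_add0 t : mcong (MAdd MZero t) t
| mc_addN t : mcong (MAdd (MScale (-1) t) t) MZero
| mc_scaleA a b t : mcong (MScale a (MScale b t)) (MScale (a * b) t)
| mc_scale1 t : mcong (MScale 1 t) t
| mc_scaleDr a s t : mcong (MScale a (MAdd s t)) (MAdd (MScale a s) (MScale a t))
| mc_scaleDl t a b : mcong (MScale (a + b) t) (MAdd (MScale a t) (MScale b t)).

Definition mcongb s t := `[< mcong s t >].
Lemma mcongb_refl : reflexive mcongb.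
Proof. by move=> t; apply/asboolP/mc_refl. Qed.
Lemma mcongb_sym : symmetric mcongb.
Proof. by move=> s t; apply/asboolP/asboolP; apply: mc_sym. Qed.
Lemma mcongb_trans : transitive mcongb.
Proof. by move=> t s u /asboolP st /asboolP tu; apply/asboolP/(mc_trans st). Qed.
Canonical mcongb_equiv := EquivRel mcongb mcongb_refl mcongb_sym mcongb_trans.

Definition presmod := {eq_quot mcongb}.
HB.instance Definition _ := Choice.on presmod.

Definition pmpi (t : mterm) : presmod := \pi_presmod t.
Definition pmrepr (x : presmod) : mterm := repr x.
Lemma pmreprK x : pmpi (pmrepr x) = x. Proof. exact: reprK. Qed.
Lemma pmpiP s t : pmpi s = pmpi t <-> mcong s t.
Proof.
split=> [/eqP|st].
  by rewrite /pmpi eqmodE => /asboolP.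
by apply/eqP; rewrite /pmpi eqmodE; apply/asboolP.
Qed.
Lemma pmreprP t : mcong (pmrepr (pmpi t)) t.
Proof. by apply/pmpiP; rewrite pmreprK. Qed.

Definition pmgen x := pmpi (MGen x).
Definition pmadd x y := pmpi (MAdd (pmrepr x) (pmrepr y)).
Definition pmscale c x := pmpi (MScale c (pmrepr x)).

Lemma pmpi_add s t : pmpi (MAdd s t) = pmadd (pmpi s) (pmpi t).
Proof. by apply/pmpiP; apply: mc_add; apply/mc_sym/pmreprP. Qed.
Lemma pmpi_scale c t : pmpi (MScale c t) = pmscale c (pmpi t).
Proof. by apply/pmpiP; apply: mc_scale; apply/mc_sym/pmreprP. Qed.

Lemma pm_ind (P : presmod -> Prop) : (forall t, P (pmpi t)) -> forall x, P x.
Proof. by move=> Pt x; rewrite -(pmreprK x). Qed.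

Fact pmaddA : associative pmadd.
Proof.
by elim/pm_ind=> s; elim/pm_ind=> t; elim/pm_ind=> u; rewrite -!pmpi_add;
   apply/pmpiP/mc_addA.
Qed.
Fact pmaddC : commutative pmadd.
Proof.
by elim/pm_ind=> s; elim/pm_ind=> t; rewrite -!pmpi_add; apply/pmpiP/mc_addC.
Qed.
Fact pmadd0 : left_id (pmpi MZero) pmadd.
Proof. by elim/pm_ind=> s; rewrite -!pmpi_add; apply/pmpiP/mc_add0. Qed.
Fact pmaddN : left_inverse (pmpi MZero) (pmscale (-1)) pmadd.
Proof.
by elim/pm_ind=> s; rewrite -pmpi_scale -!pmpi_add; apply/pmpiP/mc_addN.
Qed.
HB.instance Definition _ :=
  GRing.isZmodule.Build presmod pmaddA pmaddC pmadd0 pmaddN.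

Fact pmscaleA a b x : pmscale a (pmscale b x) = pmscale (a * b) x.
Proof. by elim/pm_ind: x => s; rewrite -!pmpi_scale; apply/pmpiP/mc_scaleA. Qed.
Fact pmscale1 : left_id 1 pmscale.
Proof. by elim/pm_ind=> s; rewrite -!pmpi_scale; apply/pmpiP/mc_scale1. Qed.
Fact pmscaleDr : right_distributive pmscale +%R.
Proof.
move=> c; elim/pm_ind=> s; elim/pm_ind=> t.
by rewrite -[pmpi s + _]pmpi_add -!pmpi_scale -[RHS]pmpi_add; apply/pmpiP/mc_scaleDr.
Qed.
Fact pmscaleDl x : {morph pmscale^~ x : a b / a + b}.
Proof.
elim/pm_ind: x => s a b.
by rewrite -!pmpi_scale -[RHS]pmpi_add; apply/pmpiP/mc_scaleDl.
Qed.
HB.instance Definition _ := GRing.Zmodule_isLmodule.Build R presmod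
  pmscaleA pmscale1 pmscaleDr pmscaleDl.

Lemma pmpiD s t : pmpi (MAdd s t) = pmpi s + pmpi t.
Proof. exact: pmpi_add. Qed.
Lemma pmpiZ c t : pmpi (MScale c t) = c *: pmpi t.
Proof. exact: pmpi_scale. Qed.
Lemma pmpi0 : pmpi MZero = 0. Proof. by []. Qed.

Lemma presmod_rel s t : rel s t -> pmpi s = pmpi t.
Proof. by move=> st; apply/pmpiP/mc_rel. Qed.

Lemma presmod_ind (P : presmod -> Prop) :
  (forall x, P (pmgen x)) -> P 0 -> (forall x y, P x -> P y -> P (x + y)) ->
  (forall c x, P x -> P (c *: x)) -> forall x, P x.
Proof.
move=> Pg P0 PD PZ; elim/pm_ind; elim=> [x||s Ps t Pt|c t Pt].
- exact: Pg.
- exact: P0.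
- by rewrite pmpiD; apply: PD.
- by rewrite pmpiZ; apply: PZ.
Qed.

Section Lift.
Variables (V : lmodType R) (f : X -> V).

Fixpoint meval (t : mterm) : V := match t with
  | MGen x => f x
  | MZero => 0
  | MAdd s t => meval s + meval t
  | MScale c t => c *: meval t
  end.

Definition mrespect := forall s t, rel s t -> meval s = meval t.
Hypothesis frel : mrespect.

Lemma meval_cong s t : mcong s t -> meval s = meval t.
Proof.
elim=> //=; rewrite ?scaler0 //.
- by move=> ? ? ? _ -> _ ->.
- by move=> ? ? ? ? _ -> _ ->.
- by move=> ? ? ? _ ->.
- by move=> ? ? ?; rewrite addrA.
- by move=> ? ?; rewrite addrC.
- by move=> ?; rewrite add0r.
- by move=> ?; rewrite scaleN1r addNr.
- by move=> ? ? ?; rewrite scalerA.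
- by move=> ?; rewrite scale1r.
- by move=> ? ? ?; rewrite scalerDr.
- by move=> ? ? ?; rewrite scalerDl.
Qed.

Definition mlift of mrespect := fun x : presmod => meval (pmrepr x).
Local Notation ml := (mlift frel).

Lemma mlift_pi t : ml (pmpi t) = meval t.
Proof. exact/meval_cong/pmreprP. Qed.
Fact mlift_linear : linear ml.
Proof.
by move=> c; elim/pm_ind=> s; elim/pm_ind=> t; rewrite -pmpiZ -pmpiD !mlift_pi.
Qed.
HB.instance Definition _ :=
  GRing.isLinear.Build R presmod V *:%R ml mlift_linear.
Lemma mliftE x : ml (pmgen x) = f x. Proof. exact: mlift_pi. Qed.
End Lift.

Lemma presmod_linP (V : lmodType R) (f g : {linear presmod -> V}) :
  (forall x, f (pmgen x) = g (pmgen x)) -> f =1 g.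
Proof.
move=> fg; elim/presmod_ind => [x||x y fx fy|c x fx]; rewrite ?linear0 //.
  by rewrite !linearD fx fy.
by rewrite !linearZ fx.
Qed.
End PresentedModule.

Section Submodule.
Variables (R : pzRingType) (V : lmodType R).

Record submod := Submod {
  in_submod :> V -> Prop;
  submod0 : in_submod 0;
  submodP : forall c x y, in_submod x -> in_submod y -> in_submod (c *: x + y) }.

Variable W : submod.

Definition submod_pred : {pred V} := fun x => `[< W x >].
Fact submod_pred_closed : GRing.submod_closed submod_pred.
Proof.
split=> [|c x y /asboolP Wx /asboolP Wy]; apply/asboolP.
  exact: submod0.
exact: submodP.
Qed.
HB.instance Definition _ :=
  GRing.isSubmodClosed.Build R V submod_pred submod_pred_closed.

Record submod_type := SubmodElt { smval :> V; smvalP : smval \in submod_pred }.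
HB.instance Definition _ := [isSub for smval].
HB.instance Definition _ := [Choice of submod_type by <:].
HB.instance Definition _ := [SubChoice_isSubLmodule of submod_type by <:].

Definition qmrel (x y : V) := `[< W (x - y) >].
Lemma qmrel_refl : reflexive qmrel.
Proof. by move=> x; apply/asboolP; rewrite subrr; apply: submod0. Qed.
Lemma submodN x : W x -> W (- x).
Proof. by move=> Wx; rewrite -scaleN1r -[_ *: _]addr0; apply/submodP/submod0. Qed.
Lemma submodD x y : W x -> W y -> W (x + y).
Proof. by move=> Wx Wy; rewrite -[x]scale1r; apply/submodP. Qed.
Lemma submodZ c x : W x -> W (c *: x).
Proof. by move=> Wx; rewrite -[_ *: _]addr0; apply/submodP/submod0. Qed.
Lemma qmrel_sym : symmetric qmrel.
Proof. by move=> x y; apply/asboolP/asboolP => /submodN; rewrite opprB. Qed.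
Lemma qmrel_trans : transitive qmrel.
Proof.
move=> y x z /asboolP xy /asboolP yz; apply/asboolP.
by have := submodD xy yz; rewrite subrKA.
Qed.
Canonical qmrel_equiv := EquivRel qmrel qmrel_refl qmrel_sym qmrel_trans.

Definition quomod := {eq_quot qmrel}.
HB.instance Definition _ := Choice.on quomod.
Definition qmpi (x : V) : quomod := \pi_quomod x.
Definition qmrepr (x : quomod) : V := repr x.
Lemma qmreprK x : qmpi (qmrepr x) = x. Proof. exact: reprK. Qed.
Lemma qmpiP x y : qmpi x = qmpi y <-> W (x - y).
Proof.
split=> [/eqP|st].
  by rewrite /qmpi eqmodE => /asboolP.
by apply/eqP; rewrite /qmpi eqmodE; apply/asboolP.
Qed.
Lemma qmreprP x : W (qmrepr (qmpi x) - x).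
Proof. by apply/qmpiP; rewrite qmreprK. Qed.
Lemma qm_ind (P : quomod -> Prop) : (forall x, P (qmpi x)) -> forall x, P x.
Proof. by move=> Pt x; rewrite -(qmreprK x). Qed.

Definition qmadd x y := qmpi (qmrepr x + qmrepr y).
Definition qmopp x := qmpi (- qmrepr x).
Definition qmscale c x := qmpi (c *: qmrepr x).
Lemma qmpi_add x y : qmpi (x + y) = qmadd (qmpi x) (qmpi y).
Proof.
apply/esym/qmpiP; rewrite opprD addrACA.
by apply: submodD; apply: qmreprP.
Qed.
Lemma qmpi_opp x : qmpi (- x) = qmopp (qmpi x).
Proof. by apply/esym/qmpiP; rewrite -opprD; apply/submodN/qmreprP. Qed.
Lemma qmpi_scale c x : qmpi (c *: x) = qmscale c (qmpi x).
Proof. by apply/esym/qmpiP; rewrite -scalerBr; apply/submodZ/qmreprP. Qed.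

Fact qmaddA : associative qmadd.
Proof. by elim/qm_ind=> s; elim/qm_ind=> t; elim/qm_ind=> u; rewrite -!qmpi_add addrA. Qed.
Fact qmaddC : commutative qmadd.
Proof. by elim/qm_ind=> s; elim/qm_ind=> t; rewrite -!qmpi_add addrC. Qed.
Fact qmadd0 : left_id (qmpi 0) qmadd.
Proof. by elim/qm_ind=> s; rewrite -!qmpi_add add0r. Qed.
Fact qmaddN : left_inverse (qmpi 0) qmopp qmadd.
Proof. by elim/qm_ind=> s; rewrite -qmpi_opp -!qmpi_add addNr. Qed.
HB.instance Definition _ :=
  GRing.isZmodule.Build quomod qmaddA qmaddC qmadd0 qmaddN.
Fact qmscaleA a b x : qmscale a (qmscale b x) = qmscale (a * b) x.
Proof. by elim/qm_ind: x => s; rewrite -!qmpi_scale scalerA. Qed.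
Fact qmscale1 : left_id 1 qmscale.
Proof. by elim/qm_ind=> s; rewrite -!qmpi_scale scale1r. Qed.
Fact qmscaleDr : right_distributive qmscale +%R.
Proof.
move=> c; elim/qm_ind=> s; elim/qm_ind=> t.
by rewrite -[qmpi s + _]qmpi_add -!qmpi_scale -[RHS]qmpi_add scalerDr.
Qed.
Fact qmscaleDl x : {morph qmscale^~ x : a b / a + b}.
Proof.
by elim/qm_ind: x => s a b; rewrite -!qmpi_scale -[RHS]qmpi_add scalerDl.
Qed.
HB.instance Definition _ := GRing.Zmodule_isLmodule.Build R quomod
  qmscaleA qmscale1 qmscaleDr qmscaleDl.
Fact qmpi_linear : linear qmpi.
Proof. by move=> c x y; rewrite qmpi_add qmpi_scale. Qed.
HB.instance Definition _ := GRing.isLinear.Build R V quomod *:%R qmpi qmpi_linear.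

End Submodule.

Section Subquotient.
Variables (R : pzRingType) (V : lmodType R) (Z B : submod V).

Let P (z : submod_type Z) := B (smval z).
Fact subquot_submod0 : P 0. Proof. exact: submod0. Qed.
Fact subquot_submodP c x y : P x -> P y -> P (c *: x + y).
Proof. exact: submodP. Qed.
Definition subquot_submod : submod (submod_type Z) :=
  Submod subquot_submod0 subquot_submodP.

(* Z / (B :&: Z) *)
Definition subquot : lmodType R := quomod subquot_submod.
End Subquotient.

Definition res_scalars (k : pzRingType) (A : lalgType k) (N : lmodType A) : Type := N.

Section ResScalars.
Variables (k : pzRingType) (A : lalgType k) (N : lmodType A).
HB.instance Definition _ := GRing.Zmodule.on (res_scalars N).
Definition res_scale (c : k) (x : res_scalars N) : res_scalars N :=
  c%:A *: (x : N).
Fact res_scaleA a b x : res_scale a (res_scale b x) = res_scale (a * b) x.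
Proof. by rewrite /res_scale scalerA -scalerAl mul1r scalerA. Qed.
Fact res_scale1 : left_id 1 res_scale.
Proof. by move=> x; rewrite /res_scale !scale1r. Qed.
Fact res_scaleDr : right_distributive res_scale +%R.
Proof. by move=> c x y; rewrite /res_scale scalerDr. Qed.
Fact res_scaleDl x : {morph res_scale^~ x : a b / a + b}.
Proof. by move=> a b; rewrite /res_scale !scalerDl. Qed.
HB.instance Definition _ := GRing.Zmodule_isLmodule.Build k (res_scalars N)
  res_scaleA res_scale1 res_scaleDr res_scaleDl.
End ResScalars.

Section Resolution.
Variable A : pzRingType.

Definition freemod (X : Type) : lmodType A := @presmod A X (fun _ _ => False).

Fact freemod_respect (M : lmodType A) : @mrespect A M (fun _ _ => False) M id.
Proof. by []. Qed.
Definition freemod_eps (M : lmodType A) : {linear freemod M -> M} :=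
  mlift (@freemod_respect M).

Section Kernel.
Variables (M N : lmodType A) (f : {linear M -> N}).
Let P x := f x = 0.
Fact kermod0 : P 0. Proof. exact: linear0. Qed.
Fact kermodP c x y : P x -> P y -> P (c *: x + y).
Proof. by rewrite /P linearP => -> ->; rewrite scaler0 addr0. Qed.
Definition kermod : submod M := Submod kermod0 kermodP.
End Kernel.

Fixpoint syzygy (M : lmodType A) (n : nat) : lmodType A :=
  if n is n'.+1 then submod_type (kermod (freemod_eps (syzygy M n'))) else M.

(* The standard free resolution ... -> P_1 -> P_0 -> M, in which P_n is free
   on the underlying set of the n-th syzygy *)
Definition resP (M : lmodType A) (n : nat) : lmodType A := freemod (syzygy M n).
Definition resd (M : lmodType A) (n : nat) : resP M n.+1 -> resP M n :=
  fun x => smval (freemod_eps (syzygy M n.+1) x).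
Fact resd_linear M n : linear (@resd M n).
Proof. by move=> c x y; rewrite /resd linearP. Qed.
HB.instance Definition _ M n :=
  GRing.isLinear.Build A (resP M n.+1) (resP M n) *:%R (@resd M n) (@resd_linear M n).

Lemma freemod_epsE (M : lmodType A) (x : M) :
  freemod_eps M (pmgen _ x) = x.
Proof. exact: mliftE. Qed.

Lemma res_exact0 (M : lmodType A) (x : resP M 0) :
  freemod_eps M x = 0 <-> exists y, x = resd y.
Proof.
split=> [x0|[y ->]]; last by have /asboolP := smvalP (freemod_eps (syzygy M 1) y).
have xk : x \in submod_pred (kermod (freemod_eps (syzygy M 0))) by apply/asboolP.
by exists (pmgen _ (SubmodElt xk)); rewrite /resd freemod_epsE.
Qed.

Lemma res_exact (M : lmodType A) n (x : resP M n.+1) :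
  resd x = 0 <-> exists y, x = resd y.
Proof.
split=> [x0|[y ->]]; last first.
  have /asboolP := smvalP (freemod_eps (syzygy M n.+2) y).
  by rewrite /resd => /= ->.
have xk : x \in submod_pred (kermod (freemod_eps (syzygy M n.+1))).
  by apply/asboolP/val_inj.
by exists (pmgen _ (SubmodElt xk)); rewrite /resd freemod_epsE.
Qed.
End Resolution.

Section Ext.
Variables (k : fieldType) (A : algType k) (M N : lmodType A).

Definition ext_cochain n (f : resP M n -> res_scalars N) :=
  linear (f : resP M n -> N).

Definition ext_cocycle n (f : resP M n -> res_scalars N) :=
  ext_cochain f /\ forall x, f (resd x) = 0.

Definition ext_coboundary n : (resP M n -> res_scalars N) -> Prop :=
  match n with
  | 0 => fun f => f = 0
  | m.+1 => fun f =>
      exists2 g : resP M m -> res_scalars N, ext_cochain g & f = g \o @resd A M m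
  end.

Lemma ext_cochain0 n : ext_cochain (0 : resP M n -> res_scalars N).
Proof. by move=> c x y; rewrite scaler0 addr0. Qed.
Lemma ext_cochainP n c (f g : resP M n -> res_scalars N) :
  ext_cochain f -> ext_cochain g -> ext_cochain (c *: f + g).
Proof.
move=> fl gl a x y.
rewrite [LHS]/(c%:A *: f (a *: x + y) + g (a *: x + y) : N) fl gl.
rewrite [(c *: f + g) x]/(c%:A *: f x + g x : N).
rewrite [(c *: f + g) y]/(c%:A *: f y + g y : N).
rewrite !scalerDr !scalerA -scalerAr mulr1 -scalerAl mul1r.
exact: addrACA.
Qed.

Fact ext_cocycle0 n : ext_cocycle (0 : resP M n -> res_scalars N).
Proof. by split=> //; apply: ext_cochain0. Qed.
Fact ext_cocycleP n c (f g : resP M n -> res_scalars N) :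
  ext_cocycle f -> ext_cocycle g -> ext_cocycle (c *: f + g).
Proof.
move=> [fl f0] [gl g0]; split=> [|x]; first exact: ext_cochainP.
rewrite [LHS]/(c%:A *: (f (resd x) : N) + g (resd x) : N) f0 g0 scaler0.
exact: addr0.
Qed.
Fact ext_coboundary0 n : ext_coboundary (0 : resP M n -> res_scalars N).
Proof. by case: n => //= n; exists 0 => //; apply: ext_cochain0. Qed.
Fact ext_coboundaryP n c (f g : resP M n -> res_scalars N) :
  ext_coboundary f -> ext_coboundary g -> ext_coboundary (c *: f + g).
Proof.
case: n f g => [|n] f g /=; first by move=> -> ->; rewrite scaler0 addr0.
move=> [f' f'l ->] [g' g'l ->]; exists (c *: f' + g') => //.
exact: ext_cochainP.
Qed.

Definition Ext n : lmodType k :=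
  subquot (Submod (@ext_cocycle0 n) (@ext_cocycleP n))
          (Submod (@ext_coboundary0 n) (@ext_coboundaryP n)).
End Ext.

Definition bilinear_map (k : pzRingType) (U V W : lmodType k) (m : U -> V -> W) :=
  (forall x, linear (m x)) /\ (forall y, linear (m^~ y)).

Definition right_symmetric (V : zmodType) (m : V -> V -> V) :=
  forall a1 a2 a3,
    m (m a1 a2) a3 - m a1 (m a2 a3) = m (m a1 a3) a2 - m a1 (m a3 a2).

Record preLieAlg (k : fieldType) := PreLieAlg {
  plcar :> lmodType k;
  plmul : plcar -> plcar -> plcar;
  plmul_bilinear : bilinear_map plmul;
  plmul_rsym : right_symmetric plmul }.

Definition sqzero_mul (k : fieldType) (L : preLieAlg k) (E : lmodType k)
    (la : L -> E -> E) (ra : E -> L -> E) (p q : L * E) : L * E :=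
  (plmul p.1 q.1, la p.1 q.2 + ra p.2 q.1).

Record preLieMod (k : fieldType) (L : preLieAlg k) := PreLieMod {
  pmcar :> lmodType k;
  lact : L -> pmcar -> pmcar;
  ract : pmcar -> L -> pmcar;
  lact_bilinear : bilinear_map lact;
  ract_bilinear : bilinear_map ract;
  sqzero_rsym : right_symmetric (sqzero_mul lact ract) }.

Arguments plmul {k L} : rename.
Arguments lact {k L p} : rename.
Arguments ract {k L p} : rename.

Section PreLieTheory.
Variables (k : fieldType) (L : preLieAlg k) (E : preLieMod L).

Lemma plmulP (x : L) : linear (plmul x). Proof. exact: (plmul_bilinear L).1. Qed.
Lemma plmulPl (y : L) : linear (plmul^~ y). Proof. exact: (plmul_bilinear L).2. Qed.
Lemma lactP (x : L) : linear (lact x : E -> E). Proof. exact: (lact_bilinear E).1. Qed.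
Lemma lactPl (e : E) : linear (lact^~ e : L -> E). Proof. exact: (lact_bilinear E).2. Qed.
Lemma ractP (e : E) : linear (ract e : L -> E). Proof. exact: (ract_bilinear E).1. Qed.
Lemma ractPl (x : L) : linear (ract^~ x : E -> E). Proof. exact: (ract_bilinear E).2. Qed.

Fact sqzero_bilinear : bilinear_map (sqzero_mul (@lact _ L E) ract).
Proof.
split=> [[x e] c [y f] [z g]|[x e] c [y f] [z g]]; rewrite /sqzero_mul /=.
  congr pair; first exact: plmulP.
  rewrite [lact _ _]lactP [ract _ _]ractP -[RHS]/(_ *: (_ + _) + (_ + _)).
  by rewrite scalerDr addrACA.
congr pair; first exact: plmulPl.
rewrite [lact _ _]lactPl [ract _ _]ractPl -[RHS]/(_ *: (_ + _) + (_ + _)).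
by rewrite scalerDr addrACA.
Qed.

Definition sqzero : preLieAlg k :=
  @PreLieAlg k (L * E)%type (sqzero_mul lact ract) sqzero_bilinear (@sqzero_rsym k L E).

Lemma act0 (f : E -> E) : linear f -> f 0 = 0.
Proof. by move=> fl; have := fl (-1) 0 0; rewrite scaler0 addr0 scaleN1r addNr. Qed.
Lemma lact0 (x : L) : lact x 0 = 0 :> E. Proof. exact/act0/lactP. Qed.
Lemma ract0 (x : L) : ract 0 x = 0 :> E. Proof. exact: (act0 (ractPl x)). Qed.
Lemma lact0l (e : E) : lact 0 e = 0.
Proof. by have := lactPl e (-1) 0 0; rewrite scaler0 addr0 scaleN1r addNr. Qed.
Lemma ract0l (e : E) : ract e 0 = 0.
Proof. by have := ractP e (-1) 0 0; rewrite scaler0 addr0 scaleN1r addNr. Qed.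

Lemma ract_ract (e : E) (a b : L) :
  ract (ract e a) b - ract e (plmul a b) = ract (ract e b) a - ract e (plmul b a).
Proof.
have := @sqzero_rsym k L E (0, e) (a, 0) (b, 0) => /(congr1 snd).
by rewrite /= !lact0l !add0r !lact0 !add0r.
Qed.
Lemma ract_lact (e : E) (a b : L) :
  ract (lact a e) b - lact a (ract e b) = lact (plmul a b) e - lact a (lact b e).
Proof.
have := @sqzero_rsym k L E (a, 0) (0, e) (b, 0) => /(congr1 snd).
by rewrite /= !lact0 ?(lact0, ract0, lact0l, ract0l, add0r, addr0).
Qed.
End PreLieTheory.

Section Envelope.
Variables (k : fieldType) (L : preLieAlg k).

Inductive uterm : Type :=
| UL of L
| UR of L
| UCst of k
| UAdd of uterm & uterm
| UMul of uterm & uterm.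

HB.instance Definition _ := gen_eqMixin uterm.
HB.instance Definition _ := gen_choiceMixin uterm.

Local Notation "s '+u' t" := (UAdd s t) (at level 50, left associativity).
Local Notation "s '*u' t" := (UMul s t) (at level 40, left associativity).

(* UCst is the structure map of the k-algebra; in the last two relations the
   negative terms of r_b r_a - r_(a <| b) = r_a r_b - r_(b <| a) and
   r_b l_a - l_a r_b = l_(a <| b) - l_a l_b are moved across, see ur_ur, ur_ul. *)
Inductive ucong : uterm -> uterm -> Prop :=
| uc_refl t : ucong t t
| uc_sym s t of ucong s t : ucong t s
| uc_trans t s u of ucong s t & ucong t u : ucong s u
| uc_add s s' t t' of ucong s s' & ucong t t' : ucong (s +u t) (s' +u t')
| uc_mul s s' t t' of ucong s s' & ucong t t' : ucong (s *u t) (s' *u t')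
| uc_cstD c d : ucong (UCst (c + d)) (UCst c +u UCst d)
| uc_cstM c d : ucong (UCst (c * d)) (UCst c *u UCst d)
| uc_cstC c t : ucong (UCst c *u t) (t *u UCst c)
| uc_addA s t u : ucong (s +u (t +u u)) (s +u t +u u)
| uc_addC s t : ucong (s +u t) (t +u s)
| uc_add0 t : ucong (UCst 0 +u t) t
| uc_addN t : ucong (UCst (-1) *u t +u t) (UCst 0)
| uc_mulA s t u : ucong (s *u (t *u u)) (s *u t *u u)
| uc_mul1 t : ucong (UCst 1 *u t) t
| uc_mul1r t : ucong (t *u UCst 1) t
| uc_mulDl s t u : ucong ((s +u t) *u u) (s *u u +u t *u u)
| uc_mulDr s t u : ucong (s *u (t +u u)) (s *u t +u s *u u)
| uc_L c a b : ucong (UL (c *: a + b)) (UCst c *u UL a +u UL b)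
| uc_R c a b : ucong (UR (c *: a + b)) (UCst c *u UR a +u UR b)
| uc_RR a b : ucong (UR b *u UR a +u UR (plmul b a)) (UR a *u UR b +u UR (plmul a b))
| uc_RL a b : ucong (UR b *u UL a +u UL a *u UL b) (UL (plmul a b) +u UL a *u UR b).

Definition ucongb s t := `[< ucong s t >].
Lemma ucongb_refl : reflexive ucongb.
Proof. by move=> t; apply/asboolP/uc_refl. Qed.
Lemma ucongb_sym : symmetric ucongb.
Proof. by move=> s t; apply/asboolP/asboolP; apply: uc_sym. Qed.
Lemma ucongb_trans : transitive ucongb.
Proof. by move=> t s u /asboolP st /asboolP tu; apply/asboolP/(uc_trans st). Qed.
Canonical ucongb_equiv := EquivRel ucongb ucongb_refl ucongb_sym ucongb_trans.

Definition UPreLie := {eq_quot ucongb}.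
HB.instance Definition _ := Choice.on UPreLie.
Definition upi (t : uterm) : UPreLie := \pi_UPreLie t.
Definition urepr (x : UPreLie) : uterm := repr x.
Lemma ureprK x : upi (urepr x) = x. Proof. exact: reprK. Qed.
Lemma upiP s t : upi s = upi t <-> ucong s t.
Proof.
split=> [/eqP|st].
  by rewrite /upi eqmodE => /asboolP.
by apply/eqP; rewrite /upi eqmodE; apply/asboolP.
Qed.
Lemma ureprP t : ucong (urepr (upi t)) t.
Proof. by apply/upiP; rewrite ureprK. Qed.
Lemma upi_ind (P : UPreLie -> Prop) : (forall t, P (upi t)) -> forall x, P x.
Proof. by move=> Pt x; rewrite -(ureprK x). Qed.

Definition uadd x y := upi (urepr x +u urepr y).
Definition umul x y := upi (urepr x *u urepr y).
Definition uopp x := umul (upi (UCst (-1))) x.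
Definition uscale c x := umul (upi (UCst c)) x.
Lemma upi_add s t : upi (s +u t) = uadd (upi s) (upi t).
Proof. by apply/upiP; apply: uc_add; apply/uc_sym/ureprP. Qed.
Lemma upi_mul s t : upi (s *u t) = umul (upi s) (upi t).
Proof. by apply/upiP; apply: uc_mul; apply/uc_sym/ureprP. Qed.

Fact uaddA : associative uadd.
Proof.
by elim/upi_ind=> s; elim/upi_ind=> t; elim/upi_ind=> u; rewrite -!upi_add;
   apply/upiP/uc_addA.
Qed.
Fact uaddC : commutative uadd.
Proof. by elim/upi_ind=> s; elim/upi_ind=> t; rewrite -!upi_add; apply/upiP/uc_addC. Qed.
Fact uadd0 : left_id (upi (UCst 0)) uadd.
Proof. by elim/upi_ind=> s; rewrite -!upi_add; apply/upiP/uc_add0. Qed.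
Fact uaddN : left_inverse (upi (UCst 0)) uopp uadd.
Proof. by elim/upi_ind=> s; rewrite /uopp -upi_mul -upi_add; apply/upiP/uc_addN. Qed.
HB.instance Definition _ := GRing.isZmodule.Build UPreLie uaddA uaddC uadd0 uaddN.
Lemma upiD s t : upi (s +u t) = upi s + upi t. Proof. exact: upi_add. Qed.

Fact umulA : associative umul.
Proof.
by elim/upi_ind=> s; elim/upi_ind=> t; elim/upi_ind=> u; rewrite -!upi_mul;
   apply/upiP/uc_mulA.
Qed.
Fact umul1 : left_id (upi (UCst 1)) umul.
Proof. by elim/upi_ind=> s; rewrite -!upi_mul; apply/upiP/uc_mul1. Qed.
Fact umul1r : right_id (upi (UCst 1)) umul.
Proof. by elim/upi_ind=> s; rewrite -!upi_mul; apply/upiP/uc_mul1r. Qed.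
Fact umulDl : left_distributive umul +%R.
Proof.
elim/upi_ind=> s; elim/upi_ind=> t; elim/upi_ind=> u.
by rewrite -upiD -!upi_mul -upiD; apply/upiP/uc_mulDl.
Qed.
Fact umulDr : right_distributive umul +%R.
Proof.
elim/upi_ind=> s; elim/upi_ind=> t; elim/upi_ind=> u.
by rewrite -upiD -!upi_mul -upiD; apply/upiP/uc_mulDr.
Qed.

Fixpoint uaug (t : uterm) : k := match t with
  | UL _ | UR _ => 0
  | UCst c => c
  | UAdd s t => uaug s + uaug t
  | UMul s t => uaug s * uaug t
  end.
Lemma uaug_cong s t : ucong s t -> uaug s = uaug t.
Proof.
elim=> //=.
- by move=> ? ? ? _ -> _ ->.
- by move=> ? ? ? ? _ -> _ ->.
- by move=> ? ? ? ? _ -> _ ->.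
- by move=> *; rewrite mulrC.
- by move=> *; rewrite addrA.
- by move=> *; rewrite addrC.
- by move=> *; rewrite add0r.
- by move=> *; rewrite mulN1r addNr.
- by move=> *; rewrite mulrA.
- by move=> *; rewrite mul1r.
- by move=> *; rewrite mulr1.
- by move=> *; rewrite mulrDl.
- by move=> *; rewrite mulrDr.
- by move=> *; rewrite mulr0 addr0.
- by move=> *; rewrite mulr0 addr0.
- by move=> *; rewrite !mulr0.
Qed.
Fact u1_neq0 : upi (UCst 1) != 0.
Proof. by apply/eqP => /upiP/uaug_cong /eqP; rewrite /= oner_eq0. Qed.
HB.instance Definition _ := GRing.Zmodule_isNzRing.Build UPreLie
  umulA umul1 umul1r umulDl umulDr u1_neq0.
Lemma upiM s t : upi (s *u t) = upi s * upi t. Proof. exact: upi_mul. Qed.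

Fact uscaleA a b x : uscale a (uscale b x) = uscale (a * b) x.
Proof. by rewrite /uscale umulA -upi_mul; congr umul; apply/upiP/uc_sym/uc_cstM. Qed.
Fact uscale1 : left_id 1 uscale. Proof. exact: umul1. Qed.
Fact uscaleDr : right_distributive uscale +%R. Proof. by move=> c; apply: umulDr. Qed.
Fact uscaleDl x : {morph uscale^~ x : a b / a + b}.
Proof. by move=> a b; rewrite -umulDl -upiD; congr umul; apply/upiP/uc_cstD. Qed.
HB.instance Definition _ := GRing.Zmodule_isLmodule.Build k UPreLie
  uscaleA uscale1 uscaleDr uscaleDl.
Fact uscaleAl (c : k) (x y : UPreLie) : c *: (x * y) = (c *: x) * y.
Proof. exact: umulA. Qed.
HB.instance Definition _ := GRing.Lmodule_isLalgebra.Build k UPreLie uscaleAl.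
Fact uscaleAr (c : k) (x y : UPreLie) : c *: (x * y) = x * (c *: y).
Proof.
rewrite -[LHS]/(umul (upi (UCst c)) (umul x y)).
rewrite -[RHS]/(umul x (umul (upi (UCst c)) y)) !umulA; congr umul.
by elim/upi_ind: x => s; rewrite -!upi_mul; apply/upiP/uc_cstC.
Qed.
HB.instance Definition _ := GRing.Lalgebra_isAlgebra.Build k UPreLie uscaleAr.

Definition ul (a : L) : UPreLie := upi (UL a).
Definition ur (a : L) : UPreLie := upi (UR a).

Lemma upi_cst c : upi (UCst c) = c%:A.
Proof. by rewrite -[RHS]/(umul _ _) umul1r. Qed.
Lemma ul_linear : linear ul.
Proof. by move=> c a b; rewrite -[RHS]/(upi (UCst c) * _ + _) -upiM -upiD; apply/upiP/uc_L. Qed.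
Lemma ur_linear : linear ur.
Proof. by move=> c a b; rewrite -[RHS]/(upi (UCst c) * _ + _) -upiM -upiD; apply/upiP/uc_R. Qed.
Lemma ur_ur a b : ur b * ur a - ur (plmul a b) = ur a * ur b - ur (plmul b a).
Proof.
apply/eqP; rewrite subr_eq addrAC eq_sym subr_eq eq_sym -!upiM -!upiD.
by apply/eqP/upiP/uc_RR.
Qed.
Lemma ur_ul a b : ur b * ul a - ul a * ur b = ul (plmul a b) - ul a * ul b.
Proof.
apply/eqP; rewrite subr_eq addrAC eq_sym subr_eq eq_sym -!upiM -!upiD.
by apply/eqP/upiP/uc_RL.
Qed.

Section UModule.
Variable E : preLieMod L.

Fixpoint uteval (t : uterm) (e : E) : E := match t with
  | UL a => lact a e
  | UR a => ract e a
  | UCst c => c *: e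
  | UAdd s t => uteval s e + uteval t e
  | UMul s t => uteval s (uteval t e)
  end.

Lemma uteval_linear t : linear (uteval t).
Proof.
elim: t => [a|a|c|s IHs t IHt|s IHs t IHt] d x y /=.
- exact: lactP.
- exact: ractPl.
- by rewrite scalerDr !scalerA mulrC.
- by rewrite IHs IHt scalerDr addrACA.
- by rewrite IHt IHs.
Qed.
Lemma utevalD t x y : uteval t (x + y) = uteval t x + uteval t y.
Proof. by have := uteval_linear t 1 x y; rewrite !scale1r. Qed.
Lemma utevalZ t c x : uteval t (c *: x) = c *: uteval t x.
Proof. by have := uteval_linear t c x 0; rewrite !addr0 (act0 (uteval_linear t)) addr0. Qed.

Lemma uteval_cong s t : ucong s t -> uteval s =1 uteval t.
Proof.
elim=> //=.
- by move=> ? ? _ IH e; rewrite IH.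
- by move=> ? ? ? _ IH1 _ IH2 e; rewrite IH1 IH2.
- by move=> ? ? ? ? _ IH1 _ IH2 e; rewrite IH1 IH2.
- by move=> ? ? ? ? _ IH1 _ IH2 e; rewrite IH2 IH1.
- by move=> * e /=; rewrite scalerDl.
- by move=> * e /=; rewrite scalerA.
- by move=> * e /=; rewrite utevalZ.
- by move=> * e /=; rewrite addrA.
- by move=> * e /=; rewrite addrC.
- by move=> * e /=; rewrite scale0r add0r.
- by move=> * e /=; rewrite scaleN1r addNr scale0r.
- by move=> * e /=; rewrite scale1r.
- by move=> * e /=; rewrite scale1r.
- by move=> * e /=; rewrite utevalD.
- by move=> c a b e; rewrite lactPl.
- by move=> c a b e; rewrite ractP.
- move=> a b e; apply/eqP.
  by rewrite -subr_eq -addrAC eq_sym -subr_eq eq_sym ract_ract.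
- move=> a b e; apply/eqP.
  by rewrite -subr_eq -addrAC eq_sym -subr_eq eq_sym ract_lact.
Qed.

Definition umod : Type := E.
HB.instance Definition _ := GRing.Zmodule.on umod.
Definition uact (u : UPreLie) (e : umod) : umod := uteval (urepr u) e.
Lemma uact_pi t e : uact (upi t) e = uteval t e.
Proof. exact/uteval_cong/ureprP. Qed.
Fact uactA u v e : uact u (uact v e) = uact (u * v) e.
Proof. by elim/upi_ind: u => s; elim/upi_ind: v => t; rewrite -upiM !uact_pi. Qed.
Fact uact1 : left_id 1 uact.
Proof. by move=> e; rewrite uact_pi /= scale1r. Qed.
Fact uactDr : right_distributive uact +%R.
Proof. by elim/upi_ind=> s x y; rewrite !uact_pi; apply: utevalD. Qed.
Fact uactDl e : {morph uact^~ e : u v / u + v}.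
Proof. by elim/upi_ind=> s; elim/upi_ind=> t; rewrite -upiD !uact_pi. Qed.
HB.instance Definition _ := GRing.Zmodule_isLmodule.Build UPreLie umod
  uactA uact1 uactDr uactDl.

Lemma ul_act a (e : umod) : ul a *: e = lact a (e : E).
Proof. exact: uact_pi. Qed.
Lemma ur_act a (e : umod) : ur a *: e = ract (e : E) a.
Proof. exact: uact_pi. Qed.
Lemma ucst_act c (e : umod) : c%:A *: e = c *: (e : E).
Proof. by rewrite -upi_cst; apply: uact_pi. Qed.

Definition derivation (D : L -> E) :=
  linear D /\ forall a b, D (plmul a b) = ract (D a) b + lact a (D b).
End UModule.

Local Notation mterm := (mterm UPreLie L).

Inductive omega_rel : mterm -> mterm -> Prop :=
| om_lin c a b : omega_rel (MGen _ (c *: a + b))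
    (MAdd (MScale c%:A (MGen _ a)) (MGen _ b))
| om_leibniz a b : omega_rel (MGen _ (plmul a b))
    (MAdd (MScale (ur b) (MGen _ a)) (MScale (ul a) (MGen _ b))).

Definition Omega : lmodType UPreLie := presmod omega_rel.
Definition omega_d (a : L) : Omega := pmgen omega_rel a.

Lemma omega_d_linear c a b : omega_d (c *: a + b) = c%:A *: omega_d a + omega_d b.
Proof. by rewrite -pmpiZ -pmpiD; apply/presmod_rel/om_lin. Qed.
Lemma omega_d_leibniz a b :
  omega_d (plmul a b) = ur b *: omega_d a + ul a *: omega_d b.
Proof. by rewrite -!pmpiZ -pmpiD; apply/presmod_rel/om_leibniz. Qed.

Lemma omega_universal (E : preLieMod L) (D : L -> E) : derivation D ->
  exists2 phi : {linear Omega -> umod E},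
    (forall a, phi (omega_d a) = D a) &
    forall psi : {linear Omega -> umod E},
      (forall a, psi (omega_d a) = D a) -> psi =1 phi.
Proof.
move=> [Dlin Dder].
have Dr : @mrespect _ _ omega_rel (umod E) D.
  move=> s t [c a b|a b] /=.
    by rewrite Dlin ucst_act.
  by rewrite Dder ur_act ul_act.
exists (mlift Dr) => [a|psi psiD]; first exact: mliftE.
apply: presmod_linP => a; rewrite [LHS]psiD; exact/esym/(mliftE Dr).
Qed.
Lemma omega_derivation (E : preLieMod L) (phi : {linear Omega -> umod E}) :
  derivation (fun a => phi (omega_d a) : E).
Proof.
split=> [c a b|a b].
  by rewrite omega_d_linear linearP ucst_act.
by rewrite omega_d_leibniz linearD !linearZ_LR /= ur_act ul_act.
Qed.
End Envelope.

Section Tensor.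
Variables (k : fieldType) (A B : lmodType k).

Inductive tens_rel : mterm k (A * B) -> mterm k (A * B) -> Prop :=
| tr_l c a a' b : tens_rel (MGen _ (c *: a + a', b))
    (MAdd (MScale c (MGen _ (a, b))) (MGen _ (a', b)))
| tr_r c a b b' : tens_rel (MGen _ (a, c *: b + b'))
    (MAdd (MScale c (MGen _ (a, b))) (MGen _ (a, b'))).

Definition tens : lmodType k := presmod tens_rel.
Definition tpure (a : A) (b : B) : tens := pmgen tens_rel (a, b).

Lemma tpurePl c a a' b : tpure (c *: a + a') b = c *: tpure a b + tpure a' b.
Proof. by rewrite -pmpiZ -pmpiD; apply/presmod_rel/tr_l. Qed.
Lemma tpureP c a b b' : tpure a (c *: b + b') = c *: tpure a b + tpure a b'.
Proof. by rewrite -pmpiZ -pmpiD; apply/presmod_rel/tr_r. Qed.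
Fact tpure_linearl b : linear (tpure^~ b). Proof. by move=> c a a'; apply: tpurePl. Qed.
Fact tpure_linear a : linear (tpure a). Proof. by move=> c b b'; apply: tpureP. Qed.
Lemma tpure0l b : tpure 0 b = 0.
Proof. by have := tpurePl (-1) 0 0 b; rewrite scaler0 addr0 scaleN1r addNr. Qed.
Lemma tpureDl a a' b : tpure (a + a') b = tpure a b + tpure a' b.
Proof. by have := tpurePl 1 a a' b; rewrite !scale1r. Qed.
Lemma tpureZl c a b : tpure (c *: a) b = c *: tpure a b.
Proof. by have := tpurePl c a 0 b; rewrite tpure0l !addr0. Qed.
HB.instance Definition _ a :=
  GRing.isLinear.Build k B tens *:%R (tpure a) (tpure_linear a).
End Tensor.

Section TensorMap.
Variables (k : fieldType) (A B A' B' : lmodType k).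
Variables (f : {linear A -> A'}) (g : {linear B -> B'}).
Fact tmap_respect :
  mrespect (@tens_rel k A B) (fun p => tpure (f p.1) (g p.2)).
Proof.
by move=> s t [c a a' b|c a b b'] /=; rewrite linearP ?tpurePl ?tpureP.
Qed.
Definition tmap : tens A B -> tens A' B' := mlift tmap_respect.
HB.instance Definition _ := GRing.Linear.copy tmap (mlift tmap_respect).
Lemma tmapE a b : tmap (tpure a b) = tpure (f a) (g b).
Proof. exact: mliftE. Qed.
End TensorMap.

Section TensorMapLinear.
Variables (k : fieldType) (A B A' B' : lmodType k).
Implicit Types (f : {linear A -> A'}) (g : {linear B -> B'}).
Lemma tens_ind (P : tens A B -> Prop) : (forall a b, P (tpure a b)) -> P 0 ->
  (forall x y, P x -> P y -> P (x + y)) -> (forall c x, P x -> P (c *: x)) ->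
  forall x, P x.
Proof. by move=> Pg; apply: presmod_ind => -[a b]; apply: Pg. Qed.
Lemma tmap0l f g x : (forall a, f a = 0) -> tmap f g x = 0.
Proof.
move=> f0; elim/tens_ind: x => [a b||x y IHx IHy|c x IHx].
- by rewrite tmapE f0 tpure0l.
- exact: linear0.
- by rewrite linearD /= IHx IHy addr0.
- by rewrite linearZ /= IHx scaler0.
Qed.
Lemma tmap0r f g x : (forall b, g b = 0) -> tmap f g x = 0.
Proof.
move=> g0; elim/tens_ind: x => [a b||x y IHx IHy|c x IHx].
- by rewrite tmapE g0 linear0.
- exact: linear0.
- by rewrite linearD /= IHx IHy addr0.
- by rewrite linearZ /= IHx scaler0.
Qed.
Lemma tmapPl c f f' f'' g x : (forall a, f'' a = c *: f a + f' a) ->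
  tmap f'' g x = c *: tmap f g x + tmap f' g x.
Proof.
move=> ff; elim/tens_ind: x => [a b||x y IHx IHy|d x IHx].
- by rewrite !tmapE ff tpurePl.
- by rewrite !linear0 addr0.
- by rewrite !linearD /= IHx IHy addrACA.
- by rewrite !linearZ /= IHx scalerDr !scalerA mulrC.
Qed.
Lemma tmapPr c f g g' g'' x : (forall b, g'' b = c *: g b + g' b) ->
  tmap f g'' x = c *: tmap f g x + tmap f g' x.
Proof.
move=> gg; elim/tens_ind: x => [a b||x y IHx IHy|d x IHx].
- by rewrite !tmapE gg tpureP.
- by rewrite !linear0 addr0.
- by rewrite !linearD /= IHx IHy addrACA.
- by rewrite !linearZ /= IHx scalerDr !scalerA mulrC.
Qed.
End TensorMapLinear.

Section SignedSums.
Variables (k : fieldType) (V W : lmodType k).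
Implicit Types (s t x y r z : seq V).

Local Notation sg x := ((-1) ^+ size x : k).

(* The sum of F x y over all ways of splitting s into two complementary
   subsequences x and y, each with the sign of the permutation s -> x ++ y. *)
Fixpoint usum s (F : seq V -> seq V -> W) : W :=
  if s is w :: s' then
    usum s' (fun x y => F (w :: x) y + (-1) ^+ size x *: F x (w :: y))
  else F [::] [::].

(* The sum of F b r over all ways of extracting an entry b from s, leaving r,
   each with the sign of the permutation s -> b :: r. *)
Fixpoint psum s (F : V -> seq V -> W) : W :=
  if s is w :: s' then F w s' - psum s' (fun b r => F b (w :: r)) else 0.

Lemma usum_ext s F G :
  (forall x y, (size x + size y)%N = size s -> F x y = G x y) -> usum s F = usum s G.
Proof.
elim: s F G => [|w s IH] F G FG /=; first exact: FG.
by apply: IH => x y xy; rewrite !FG //= -xy ?addnS.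
Qed.
Lemma psum_ext s F G :
  (forall b r, size s = (size r).+1 -> F b r = G b r) -> psum s F = psum s G.
Proof.
elim: s F G => [|w s IH] F G FG //=; rewrite FG //; congr (_ - _).
by apply: IH => b r e; apply: FG; rewrite /= e.
Qed.
Lemma usumP s c F G :
  usum s (fun x y => c *: F x y + G x y) = c *: usum s F + usum s G.
Proof.
elim: s F G => [|w s IH] F G //=; rewrite -IH; apply: usum_ext => x y _.
by rewrite !scalerDr !scalerA mulrC addrACA.
Qed.
Lemma psumP s c F G :
  psum s (fun b r => c *: F b r + G b r) = c *: psum s F + psum s G.
Proof.
elim: s F G => [|w s IH] F G /=; first by rewrite scaler0 addr0.
by rewrite IH scalerBr opprD addrACA.
Qed.
Lemma usum0 s : usum s (fun _ _ => 0) = 0.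
Proof.
by elim: s => //= w s IH; rewrite -[RHS]IH; apply: usum_ext => *; rewrite scaler0 addr0.
Qed.
Lemma psum0 s : psum s (fun _ _ => 0) = 0.
Proof. by elim: s => //= w s ->; rewrite subr0. Qed.
Lemma usumD s F G : usum s (fun x y => F x y + G x y) = usum s F + usum s G.
Proof. by rewrite -[usum s F]scale1r -usumP; apply: usum_ext => *; rewrite scale1r. Qed.
Lemma psumD s F G : psum s (fun b r => F b r + G b r) = psum s F + psum s G.
Proof. by rewrite -[psum s F]scale1r -psumP; apply: psum_ext => *; rewrite scale1r. Qed.
Lemma usumZ s c F : usum s (fun x y => c *: F x y) = c *: usum s F.
Proof.
by rewrite -[RHS]addr0 -(usum0 s) -usumP; apply: usum_ext => *; rewrite addr0.
Qed.
Lemma psumZ s c F : psum s (fun b r => c *: F b r) = c *: psum s F.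
Proof.
by rewrite -[RHS]addr0 -(psum0 s) -psumP; apply: psum_ext => *; rewrite addr0.
Qed.

Lemma usum_nilr s (G : seq V -> W) :
  usum s (fun x y => if y is [::] then G x else 0) = G s.
Proof.
elim: s G => //= w s IH G; rewrite -[RHS](IH (fun x => G (w :: x))).
by apply: usum_ext => x y _; rewrite scaler0 addr0.
Qed.

Definition multilinear (G : seq V -> W) := forall s c u v t,
  G (s ++ (c *: u + v) :: t) = c *: G (s ++ u :: t) + G (s ++ v :: t).
Definition alternating (G : seq V -> W) := forall s u t, G (s ++ [:: u, u & t]) = 0.
Definition malt G := multilinear G /\ alternating G.

Lemma malt_cons w G : malt G -> malt (fun x => G (w :: x)).
Proof.
by move=> [Gl Ga]; split=> [s c u v t|s u t]; rewrite -!cat_cons ?Gl ?Ga.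
Qed.
Lemma maltD G H : malt G -> malt H -> malt (fun x => G x + H x).
Proof.
move=> [Gl Ga] [Hl Ha]; split=> [s c u v t|s u t].
  by rewrite Gl Hl scalerDr addrACA.
by rewrite Ga Ha addr0.
Qed.
Lemma malt_size (h : nat -> k) G : malt G -> malt (fun x => h (size x) *: G x).
Proof.
move=> [Gl Ga]; split=> [s c u v t|s u t]; last by rewrite Ga scaler0.
by rewrite Gl !size_cat /= scalerDr !scalerA mulrC.
Qed.
Lemma maltZ c G : malt G -> malt (fun x => c *: G x).
Proof. exact: (malt_size (fun=> c)). Qed.

Lemma malt_usum F : (forall y, malt (F^~ y)) -> (forall x, malt (F x)) ->
  malt (usum^~ F).
Proof.
move=> F1 F2; split.
  move=> s; elim: s F F1 F2 => [|w s IH] F F1 F2 c u v t /=.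
    rewrite -usumP; apply: usum_ext => x y _.
    rewrite ((F1 y).1 [::]) ((F2 x).1 [::]) /= scalerDr !scalerA.
    by rewrite scalerDr scalerA addrACA mulrC.
  apply: IH => [y|x].
    by apply: maltD; [exact: (malt_cons w (F1 y))|exact: malt_size (F1 _)].
  by apply: maltD => //; apply: maltZ; apply: malt_cons.
move=> s; elim: s F F1 F2 => [|w s IH] F F1 F2 u t /=.
  rewrite -[RHS](usum0 t); apply: usum_ext => x y _.
  rewrite ((F1 y).2 [::]) ((F2 x).2 [::]) /= exprS mulN1r add0r scaler0 addr0.
  by rewrite scaleNr addNr.
apply: IH => [y|x].
  by apply: maltD; [exact: (malt_cons w (F1 y))|exact: malt_size (F1 _)].
by apply: maltD => //; apply: maltZ; apply: malt_cons.
Qed.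

Lemma malt_psum F : (forall r, linear (F^~ r)) -> (forall b, malt (F b)) ->
  malt (psum^~ F).
Proof.
move=> F1 F2; split.
  move=> s; elim: s F F1 F2 => [|w s IH] F F1 F2 c u v t /=.
    rewrite (F1 t).
    under psum_ext do rewrite ((F2 _).1 [::]).
    by rewrite psumP opprD scalerBr addrACA.
  rewrite (F2 w).1 IH; last by move=> b; apply: malt_cons.
    by rewrite opprD scalerBr addrACA.
  by move=> r; apply: F1.
move=> s; elim: s F F1 F2 => [|w s IH] F F1 F2 u t /=.
  under psum_ext do rewrite ((F2 _).2 [::]).
  by rewrite psum0 subr0 subrr.
rewrite (F2 w).2 IH ?subr0 // => b; exact: malt_cons.
Qed.
End SignedSums.

Lemma malt_comp (k : fieldType) (V W W' : lmodType k) (h : {linear W -> W'})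
  (G : seq V -> W) : malt G -> malt (h \o G).
Proof.
by move=> [Gl Ga]; split=> [s c u v t|s u t] /=; rewrite ?Gl ?Ga ?linearP ?linear0.
Qed.
Lemma usum_lin (k : fieldType) (V W W' : lmodType k) (h : {linear W -> W'}) s
  (F : seq V -> seq V -> W) : h (usum s F) = usum s (fun x y => h (F x y)).
Proof.
elim: s F => //= w s IH F; rewrite IH; apply: usum_ext => x y _.
by rewrite linearD linearZ.
Qed.
Lemma psum_lin (k : fieldType) (V W W' : lmodType k) (h : {linear W -> W'}) s
  (F : V -> seq V -> W) : h (psum s F) = psum s (fun b r => h (F b r)).
Proof. by elim: s F => [|w s IH] F /=; rewrite ?linear0 // linearB IH. Qed.

Section Coassoc.
Variables (k : fieldType) (V W : lmodType k).
Implicit Types (s t x y r z : seq V).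
Local Notation sg x := ((-1) ^+ size x : k).
Local Notation usum := (@usum k V W).
Local Notation psum := (@psum k V W).

Lemma sgn_sq (n : nat) : ((-1) ^+ n : k) * (-1) ^+ n = 1.
Proof. by rewrite -exprD addnn -signr_odd odd_double. Qed.

Lemma usumA s (G : seq V -> seq V -> seq V -> W) :
  usum s (fun x y => usum y (G x)) =
  usum s (fun z y2 => usum z (fun x y1 => G x y1 y2)).
Proof.
elim: s G => //= w s IH G.
pose H x y1 y2 := G (w :: x) y1 y2 + sg x *: G x (w :: y1) y2
  + (sg x * sg y1) *: G x y1 (w :: y2).
transitivity (usum s (fun x y => usum y (H x))); last first.
  rewrite IH; apply: usum_ext => z y2 _; rewrite /= -usumZ -usumD.
  by apply: usum_ext => x y <-; rewrite exprD.
apply: usum_ext => x y _; rewrite -usumZ -usumD.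
by apply: usum_ext => y1 y2 _; rewrite scalerDr scalerA addrA.
Qed.

Lemma usumC s (G : seq V -> seq V -> W) :
  usum s G = usum s (fun x y => (-1) ^+ (size x * size y) *: G y x).
Proof.
elim: s G => [|w s IH] G /=; first by rewrite scale1r.
rewrite IH; apply: usum_ext => x y _.
rewrite scalerDr addrC !scalerA mulSn mulnS !exprD; congr (_ *: _ + _ *: _).
  by rewrite mulrC.
by rewrite mulrA sgn_sq mul1r.
Qed.

Lemma psum_usumA s (G : V -> seq V -> seq V -> W) :
  psum s (fun b r => usum r (G b)) =
  usum s (fun z r2 => psum z (fun b r1 => G b r1 r2)).
Proof.
elim: s G => //= w s IH G; rewrite IH -scaleN1r -usumZ -usumD.
apply: usum_ext => z r2 _; rewrite scaleN1r psumD opprD addrA; congr (_ + _).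
rewrite -psumZ -scaleN1r -psumZ; apply: psum_ext => b r1 ->.
by rewrite exprS scalerA.
Qed.

Lemma psum_usumC s (G : V -> seq V -> seq V -> W) :
  psum s (fun b r => usum r (G b)) =
  usum s (fun z y2 => sg z *: psum y2 (fun b r2 => G b z r2)).
Proof.
elim: s G => [|w s IH] G /=; first by rewrite scaler0.
rewrite IH -scaleN1r -usumZ -usumD; apply: usum_ext => z y2 _.
rewrite psumD psumZ /=.
set A := psum _ _; set B := psum _ _.
rewrite scaleN1r scalerDr !scalerA sgn_sq scale1r exprS mulN1r.
by rewrite !scale1r opprD scaleNr addrCA.
Qed.
End Coassoc.

(* The Koszul dual operad of PreLie is Perm, whose component Perm(n) has a
   basis e_1, ..., e_n permuted by S_n. Hence, up to the operadic suspension, a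
   coalgebra over the Koszul dual cooperad of PreLie is a graded Perm-coalgebra,
   with a single generating cooperation, and the cofree one on V is
   W (x) S^c(W) where W is V placed in degree 1. The generator [cg a s], for
   s = [:: v_1; ...; v_n], stands for a (x) v_1 ... v_n, which has arity n + 1,
   homological degree n, and degree n + 1 after suspension; since the v_i are
   odd, it is alternating in s. All Koszul signs are those of the suspended
   degree. *)
Section Cofree.
Variables (k : fieldType) (V : lmodType k).
Implicit Types (a b u v : V) (s t r : seq V).

Local Notation gen a s := (MGen k (a, s)).
Inductive PLco_rel : mterm k (V * seq V) -> mterm k (V * seq V) -> Prop :=
| plco_lin0 c a b s :
    PLco_rel (gen (c *: a + b) s) (MAdd (MScale c (gen a s)) (gen b s))
| plco_lin a s c u v t :
    PLco_rel (gen a (s ++ (c *: u + v) :: t))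
             (MAdd (MScale c (gen a (s ++ u :: t))) (gen a (s ++ v :: t)))
| plco_alt a s u t : PLco_rel (gen a (s ++ [:: u, u & t])) (MZero _ _).

Definition PLco : lmodType k := presmod PLco_rel.
Definition cg a s : PLco := pmgen PLco_rel (a, s).

Definition malt2 (W : lmodType k) (F : V -> seq V -> W) :=
  (forall s, linear (F^~ s)) /\ (forall a, malt (F a)).

Lemma cg_malt2 : malt2 cg.
Proof.
split=> [s c a b|a]; first by rewrite -pmpiZ -pmpiD; apply/presmod_rel/plco_lin0.
split=> [s c u v t|s u t]; last exact/presmod_rel/plco_alt.
by rewrite -pmpiZ -pmpiD; apply/presmod_rel/plco_lin.
Qed.
Definition cg_malt a := cg_malt2.2 a.
Definition cg_linear s := cg_malt2.1 s.

Section Clift.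
Variables (W : lmodType k) (F : V -> seq V -> W) (FP : malt2 F).
Fact clift_respect : mrespect PLco_rel (fun p => F p.1 p.2).
Proof.
move=> _ _ [c a b s|a s c u v t|a s u t] /=.
- exact: FP.1.
- exact: (FP.2 a).1.
- exact: (FP.2 a).2.
Qed.
Definition clift : PLco -> W := mlift clift_respect.
HB.instance Definition _ := GRing.Linear.copy clift (mlift clift_respect).
Lemma cliftE a s : clift (cg a s) = F a s. Proof. exact: mliftE. Qed.
End Clift.

(* Delta (a (x) v_1 ... v_n) = sum +- (a (x) v_I) (x) (v_j (x) v_J) over all
   decompositions of {1, ..., n} into I, {j} and J *)
Fact cdelta_malt2 : malt2 (fun a s =>
  usum s (fun x y => psum y (fun b r => tpure (cg a x) (cg b r)))).
Proof.
split=> [s c a b|a].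
  rewrite -usumP; apply: usum_ext => x y _; rewrite -psumP.
  by apply: psum_ext => d r _; rewrite cg_linear tpurePl.
apply: malt_usum => [y|x].
  split=> [s c u v t|s u t].
    rewrite -psumP; apply: psum_ext => d r _.
    by rewrite (cg_malt a).1 tpurePl.
  rewrite -[RHS](psum0 _ y); apply: psum_ext => d r _; rewrite (cg_malt a).2.
  exact: tpure0l.
apply: malt_psum => [r c b d|b]; first by rewrite cg_linear tpureP.
exact/(malt_comp (tpure (cg a x)))/cg_malt.
Qed.
Definition cdelta : PLco -> tens PLco PLco := clift cdelta_malt2.
HB.instance Definition _ := GRing.Linear.copy cdelta (clift cdelta_malt2).

(* projection onto the component of arity m + 1 *)
Fact cproj_malt2 (m : nat) : malt2 (fun a s => ((size s == m)%:R : k) *: cg a s).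
Proof.
split=> [s c a b|a].
  by rewrite cg_linear scalerDr !scalerA mulrC.
exact/(malt_size (fun n => (n == m)%:R))/cg_malt.
Qed.
Definition cproj m : PLco -> PLco := clift (cproj_malt2 m).
HB.instance Definition _ m := GRing.Linear.copy (cproj m) (clift (cproj_malt2 m)).

(* x |-> (-1)^(n |x|) x *)
Fact ckoszul_malt2 n : malt2 (fun a s => ((-1) ^+ (n * (size s).+1) : k) *: cg a s).
Proof.
split=> [s c a b|a].
  by rewrite cg_linear scalerDr !scalerA mulrC.
exact/(malt_size (fun m => (-1) ^+ (n * m.+1)))/cg_malt.
Qed.
Definition ckoszul n : PLco -> PLco := clift (ckoszul_malt2 n).
HB.instance Definition _ n := GRing.Linear.copy (ckoszul n) (clift (ckoszul_malt2 n)).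

(* projection onto the cogenerators *)
Fact ccog_malt2 : malt2 (fun a s => if s is [::] then a else 0).
Proof.
split=> [[|w s] c a b|a] //; first by rewrite scaler0 addr0.
split=> [[|w s] c u v t|[|w s] u t] //=; by rewrite scaler0 addr0.
Qed.
Definition ccog : PLco -> V := clift ccog_malt2.
HB.instance Definition _ := GRing.Linear.copy ccog (clift ccog_malt2).

(* Coderivations of degree - n; the Koszul sign of 1 (x) D is carried by
   [ckoszul n]. *)
Definition coderivation (n : nat) (D : {linear PLco -> PLco}) :=
  (forall m x, cproj m (D x) = D (cproj (m + n) x)) /\
  (forall x, cdelta (D x) = tmap D idfun (cdelta x)
                            + tmap (ckoszul n) D (cdelta x)).

(* the coderivation of degree - n with corestriction f *)
Fact colift_malt2 n (f : {linear PLco -> V}) : malt2 (fun a s =>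
  usum s (fun x y => cg (f (cg a x)) y
    + (-1) ^+ n *: psum x (fun b r => cg a (f (cg b r) :: y)))).
Proof.
split=> [s c a b|a].
  rewrite -usumP; apply: usum_ext => x y _.
  rewrite cg_linear linearP cg_linear.
  under psum_ext do rewrite cg_linear.
  by rewrite psumP !scalerDr !scalerA addrACA (mulrC c).
apply: malt_usum => [y|x].
  apply: maltD.
    split=> [s c u v t|s u t].
      by rewrite (cg_malt a).1 linearP cg_linear.
    rewrite (cg_malt a).2 linear0.
    by have := cg_linear y (-1) 0 0; rewrite scaler0 addr0 scaleN1r addNr.
  apply: maltZ; apply: malt_psum => [r c b d|b].
    by rewrite cg_linear linearP ((cg_malt a).1 [::]).
  split=> [s c u v t|s u t].
    by rewrite (cg_malt b).1 linearP ((cg_malt a).1 [::]).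
  rewrite (cg_malt b).2 linear0.
  have := (cg_malt a).1 [::] (-1) 0 0 y.
  by rewrite scaler0 addr0 scaleN1r addNr.
apply: maltD; first exact: cg_malt.
apply: maltZ; split=> [s c u v t|s u t].
  by rewrite -psumP; apply: psum_ext => b r _; rewrite -!cat_cons (cg_malt a).1.
rewrite -[RHS](psum0 _ x); apply: psum_ext => b r _.
by rewrite -!cat_cons (cg_malt a).2.
Qed.
Definition colift n (f : {linear PLco -> V}) : PLco -> PLco :=
  clift (colift_malt2 n f).
HB.instance Definition _ n (f : {linear PLco -> V}) :=
  GRing.Linear.copy (colift n f) (clift (colift_malt2 n f)).


Lemma cdeltaE a s : cdelta (cg a s) =
  usum s (fun x y => psum y (fun b r => tpure (cg a x) (cg b r))).
Proof. exact: cliftE. Qed.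
Lemma cprojE m a s : cproj m (cg a s) = ((size s == m)%:R : k) *: cg a s.
Proof. exact: cliftE. Qed.
Lemma ckoszulE n a s : ckoszul n (cg a s) = (-1) ^+ (n * (size s).+1) *: cg a s.
Proof. exact: cliftE. Qed.
Lemma ccogE a s : ccog (cg a s) = if s is [::] then a else 0.
Proof. exact: cliftE. Qed.
Lemma coliftE n (f : {linear PLco -> V}) a s : colift n f (cg a s) =
  usum s (fun x y => cg (f (cg a x)) y
    + (-1) ^+ n *: psum x (fun b r => cg a (f (cg b r) :: y))).
Proof. exact: cliftE. Qed.

Definition cohomog n (f : {linear PLco -> V}) :=
  forall a s, size s != n -> f (cg a s) = 0.

Lemma cg0 s : cg 0 s = 0.
Proof. by have := cg_linear s (-1) 0 0; rewrite scaler0 addr0 scaleN1r addNr. Qed.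
Lemma cg0s a s : cg a (0 :: s) = 0.
Proof.
have := (cg_malt a).1 [::] (-1) 0 0 s.
by rewrite scaler0 addr0 scaleN1r addNr.
Qed.

Lemma PLco_ind (P : PLco -> Prop) :
  (forall a s, P (cg a s)) -> P 0 -> (forall x y, P x -> P y -> P (x + y)) ->
  (forall c x, P x -> P (c *: x)) -> forall x, P x.
Proof. by move=> Pg; apply: presmod_ind => -[a s]; apply: Pg. Qed.
Lemma PLco_linP (W : lmodType k) (f g : {linear PLco -> W}) :
  (forall a s, f (cg a s) = g (cg a s)) -> f =1 g.
Proof. by move=> fg; apply: presmod_linP => -[a s]; apply: fg. Qed.

Lemma ccog_colift n f x : ccog (colift n f x) = f x.
Proof.
apply: (PLco_linP (f := ccog \o colift n f)) => a s /=.
rewrite coliftE usum_lin.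
under usum_ext do rewrite linearD linearZ /= ccogE psum_lin.
transitivity (usum s (fun x y => if y is [::] then f (cg a x) else 0)).
  apply: usum_ext => x' y _; under psum_ext do rewrite /= ccogE.
  by rewrite psum0 scaler0 addr0.
exact: (usum_nilr s (fun s => f (cg a s))).
Qed.
End Cofree.

Arguments cdelta {k V}.
Arguments cproj {k V} m.
Arguments ckoszul {k V} n.
Arguments ccog {k V}.

Section Exchange.
Variables (k : fieldType) (V W : lmodType k).
Implicit Types (s t x y r : seq V).
Lemma psum_usum_xch x y (G : V -> seq V -> seq V -> seq V -> W) :
  psum x (fun b r => usum y (G b r)) =
  usum y (fun y1 y2 => psum x (fun b r => G b r y1 y2)).
Proof.
elim: x G => [|w x IH] G /=; first by rewrite usum0.
by rewrite IH -scaleN1r -usumZ -usumD; apply: usum_ext => *; rewrite scaleN1r.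
Qed.
Lemma psum_psum_xch x y (G : V -> seq V -> V -> seq V -> W) :
  psum x (fun b r => psum y (G b r)) =
  psum y (fun b' r' => psum x (fun b r => G b r b' r')).
Proof.
elim: x G => [|w x IH] G /=; first by rewrite psum0.
by rewrite IH -scaleN1r -psumZ -psumD; apply: psum_ext => *; rewrite scaleN1r.
Qed.
End Exchange.

Section ColiftCoderivation.
Variables (k : fieldType) (V : lmodType k) (n : nat) (f : {linear PLco V -> V}).
Hypothesis fn : cohomog n f.
Implicit Types (a b u v : V) (s t r : seq V).

Lemma colift_degree m x : cproj m (colift n f x) = colift n f (cproj (m + n) x).
Proof.
apply: (PLco_linP (f := cproj m \o colift n f) (g := colift n f \o cproj (m + n))).
move=> a s /=; rewrite cprojE linearZ /= coliftE usum_lin -usumZ /=.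
apply: usum_ext => z y zy; rewrite linearD linearZ /= scalerDr cprojE psum_lin /=.
congr (_ + _).
  have [zn|/fn->] := eqVneq (size z) n; last by rewrite cg0 !scaler0.
  by rewrite -zy zn [(n + _)%N]addnC eqn_add2r.
rewrite scalerA mulrC -scalerA; congr (_ *: _); rewrite -psumZ.
apply: psum_ext => b r zr; rewrite cprojE.
have [rn|/fn->] := eqVneq (size r) n; last by rewrite cg0s !scaler0.
by rewrite -zy zr rn /= addSnnS [(n + _)%N]addnC eqn_add2r.
Qed.

Lemma tpure_psuml s (F : V -> seq V -> PLco V) (c : PLco V) :
  tpure (psum s F) c = psum s (fun b r => tpure (F b r) c).
Proof.
elim: s F => [|w s IH] F /=; first exact: tpure0l.
by rewrite tpureDl -scaleN1r tpureZl IH scaleN1r.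
Qed.
Lemma tpure_usuml s (F : seq V -> seq V -> PLco V) (c : PLco V) :
  tpure (usum s F) c = usum s (fun x y => tpure (F x y) c).
Proof.
elim: s F => //= w s IH F; rewrite IH; apply: usum_ext => x y _.
by rewrite tpureDl tpureZl.
Qed.

Lemma colift_codelta x : cdelta (colift n f x) =
  tmap (colift n f) idfun (cdelta x) + tmap (ckoszul n) (colift n f) (cdelta x).
Proof.
apply: (PLco_linP (f := cdelta \o colift n f)
  (g := (tmap (colift n f) idfun \o cdelta) \+
        (tmap (ckoszul n) (colift n f) \o cdelta))) => a s /=.
pose P1 z y1 y2 := psum y2 (fun b r => tpure (cg (f (cg a z)) y1) (cg b r)).
pose P2 z y1 y2 := psum z (fun c t => psum y2 (fun b r =>
  tpure (cg a (f (cg c t) :: y1)) (cg b r))).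
pose P3 z y1 y2 := psum z (fun c t => tpure (cg a y1) (cg (f (cg c t)) y2)).
pose P4 z y1 y2 := psum z (fun c t => psum y2 (fun b r =>
  tpure (cg a y1) (cg b (f (cg c t) :: r)))).
have -> : cdelta (colift n f (cg a s)) =
  usum s (fun z y => usum y (fun y1 y2 => P1 z y1 y2 + (-1) ^+ n *: P2 z y1 y2))
  + usum s (fun z y => usum y (fun y1 y2 =>
      ((-1) ^+ n * (-1) ^+ size y1) *: (P3 z y1 y2 - P4 z y1 y2))).
  rewrite coliftE usum_lin -usumD; apply: usum_ext => z y _.
  rewrite linearD linearZ /= cdeltaE psum_lin /=.
  under psum_ext do rewrite cdeltaE /=.
  rewrite psum_usum_xch -usumZ -!usumD; apply: usum_ext => y1 y2 _.
  rewrite psumD psumZ scalerDr addrA scalerA; congr (_ + _ *: _).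
  by rewrite /P3 /P4 -[- psum z _]scaleN1r -psumZ -psumD; apply: psum_ext => *; rewrite scaleN1r.
congr (_ + _); rewrite cdeltaE usum_lin.
  rewrite usumA; apply: usum_ext => z y2 _; rewrite psum_lin.
  under [RHS]psum_ext do rewrite /= tmapE /= coliftE tpure_usuml.
  rewrite psum_usum_xch; apply: usum_ext => x' y1 _.
  under psum_ext do rewrite tpureDl tpureZl tpure_psuml.
  by rewrite psumD psumZ psum_psum_xch.
transitivity (usum s (fun y1 y => usum y (fun z y2 =>
  (-1) ^+ (n * (size y1).+1) *: (P3 z y1 y2 + ((-1) ^+ n * (-1) ^+ size z) *: P4 z y1 y2)))).
  rewrite !usumA; apply: usum_ext => w y2 _; rewrite [RHS]usumC.
  apply: usum_ext => z y1 _; rewrite scalerA.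
  have [zn|zn] := eqVneq (size z) n.+1.
    rewrite zn exprS mulN1r mulrN sgn_sq scaleN1r; congr (_ *: _).
    rewrite -!exprD -signr_odd -[RHS]signr_odd; congr ((-1) ^+ nat_of_bool _).
    by rewrite mulSn mulnS !oddD; case: (odd n); case: (odd _); case: (odd _).
  have -> : P3 z y1 y2 = 0.
    rewrite /P3 -[RHS](psum0 _ z); apply: psum_ext => c t zt.
    by rewrite fn ?cg0 ?linear0 //; rewrite zt eqSS in zn.
  have -> : P4 z y1 y2 = 0.
    rewrite /P4 -[RHS](psum0 _ z); apply: psum_ext => c t zt.
    rewrite -[RHS](psum0 _ y2); apply: psum_ext => b r _.
    by rewrite fn ?cg0s ?linear0 //; rewrite zt eqSS in zn.
  by rewrite !scaler0 subr0 addr0 !scaler0.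
apply: usum_ext => y1 y _; rewrite psum_lin usumZ.
under psum_ext do rewrite /= tmapE /= ckoszulE tpureZl.
rewrite psumZ; congr (_ *: _).
apply/esym; transitivity (psum y (fun b r =>
  usum r (fun z y2 => tpure (cg a y1) (cg (f (cg b z)) y2))
  + (-1) ^+ n *: usum r (fun z y2 =>
      psum z (fun c t => tpure (cg a y1) (cg b (f (cg c t) :: y2)))))).
  apply: psum_ext => b r _; rewrite coliftE usum_lin -usumZ -usumD.
  by apply: usum_ext => z y2 _; rewrite linearD linearZ /= psum_lin.
rewrite psumD psumZ psum_usumA psum_usumC -usumZ -usumD.
by apply: usum_ext => z y2 _; rewrite scalerA psum_psum_xch.
Qed.

Lemma colift_coderivation : coderivation n (colift n f).
Proof. by split=> [m x|x]; [exact: colift_degree|exact: colift_codelta]. Qed.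
End ColiftCoderivation.

Section Functoriality.
Variables (k : fieldType) (V V' : lmodType k) (h : {linear V -> V'}).
Fact cmap_malt2 : malt2 (fun a s => cg (h a) (map h s)).
Proof.
split=> [s c a b|a]; first by rewrite linearP cg_linear.
split=> [s c u v t|s u t]; rewrite !map_cat /=.
  by rewrite linearP (cg_malt _).1.
exact: (cg_malt _).2.
Qed.
Definition cmap : PLco V -> PLco V' := clift cmap_malt2.
HB.instance Definition _ := GRing.Linear.copy cmap (clift cmap_malt2).
Lemma cmapE a s : cmap (cg a s) = cg (h a) (map h s). Proof. exact: cliftE. Qed.
End Functoriality.

Section StructureCoderivation.
Variables (k : fieldType) (L : preLieAlg k).

Fact plcor_malt2 : malt2 (fun (a : L) s => if s is [:: b] then plmul a b else 0).
Proof.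
split=> [[|b [|w s]] c a a'|a]; rewrite ?scaler0 ?addr0 //; first exact: plmulPl.
split=> [[|w [|w' s]] c u v [|w'' t]|[|w [|w' s]] u t] //=; rewrite ?scaler0 ?addr0 //.
exact: plmulP.
Qed.
Definition plcor : PLco L -> L := clift plcor_malt2.
HB.instance Definition _ := GRing.Linear.copy plcor (clift plcor_malt2).

Definition plcoder : PLco L -> PLco L := colift 1 plcor.
HB.instance Definition _ := GRing.Linear.copy plcoder (colift 1 plcor).

Lemma plcoder_coderivation : coderivation 1 plcoder.
Proof.
apply: (@colift_coderivation k L 1 plcor) => a [|b [|c s]] //= _; exact: cliftE.
Qed.
Lemma ccog_plcoder x : ccog (plcoder x) = plcor x.
Proof. exact: ccog_colift. Qed.
End StructureCoderivation.

Section Cohomology.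
Variables (k : fieldType) (L : preLieAlg k) (E : preLieMod L).

Local Notation C := (PLco (sqzero E)).

Definition plcochain (n : nat) (D : C -> C) :=
  exists2 D' : {linear C -> C}, D = D' &
    coderivation n D' /\
    exists g : {linear PLco L -> E}, forall x,
      ccog (D' x) = (0, g (cmap (fst : {linear (L * E)%type -> L}) x)).

(* [plcoder, D] for D of degree - n *)
Definition pldiff (n : nat) (D : C -> C) : C -> C :=
  fun x => plcoder (D x) - (-1) ^+ n *: D (plcoder x).

Definition plcocycle n (D : C -> C) := plcochain n D /\ pldiff n D = 0.

Definition plcoboundary n (D : C -> C) :=
  if n is m.+1 then exists2 D', plcochain m D' & D = pldiff m D' else D = 0.

Lemma plcochain0 n : plcochain n 0.
Proof.
exists \0 => //; split; first split=> [m x|x].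
- by rewrite linear0.
- by rewrite linear0 tmap0l ?tmap0r ?addr0.
- by exists \0 => x; rewrite linear0.
Qed.
Lemma plcochainP n c D1 D2 :
  plcochain n D1 -> plcochain n D2 -> plcochain n (c *: D1 + D2).
Proof.
move=> [F1 -> [[F1d F1c] [g1 F1g]]] [F2 -> [[F2d F2c] [g2 F2g]]].
exists (c \*: F1 \+ F2) => //; split; first split=> [m x|x].
- by rewrite /= linearP /= F1d F2d.
- rewrite /= linearP /= F1c F2c scalerDr addrACA; congr (_ + _); apply/esym.
    exact: tmapPl.
  exact: tmapPr.
- exists (c \*: g1 \+ g2) => x; rewrite /= linearP /= F1g F2g /=.
  by congr pair; rewrite /= scaler0 addr0.
Qed.
Lemma pldiffP n c D1 D2 :
  pldiff n (c *: D1 + D2) = c *: pldiff n D1 + pldiff n D2.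
Proof.
apply/funext => x; rewrite /pldiff.
rewrite -[(c *: D1 + D2) x]/(c *: D1 x + D2 x) linearP.
rewrite -[(c *: D1 + D2) _]/(c *: D1 (plcoder x) + D2 (plcoder x)).
rewrite -[RHS]/(c *: (plcoder (D1 x) - (-1) ^+ n *: D1 (plcoder x))
                + (plcoder (D2 x) - (-1) ^+ n *: D2 (plcoder x))).
by rewrite scalerDr opprD addrACA scalerBr !scalerA mulrC.
Qed.
Lemma pldiff0 n : pldiff n 0 = 0.
Proof.
apply/funext => x; rewrite /pldiff -[0 x]/(0 : C) linear0.
by rewrite -[0 (plcoder x)]/(0 : C) scaler0 subr0.
Qed.

Fact plcocycle0 n : plcocycle n 0.
Proof. by split; [exact: plcochain0|exact: pldiff0]. Qed.
Fact plcocycleP n c D1 D2 :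
  plcocycle n D1 -> plcocycle n D2 -> plcocycle n (c *: D1 + D2).
Proof.
move=> [C1 d1] [C2 d2]; split; first exact: plcochainP.
by rewrite pldiffP d1 d2 scaler0 addr0.
Qed.
Fact plcoboundary0 n : plcoboundary n 0.
Proof.
by case: n => //= n; exists 0; rewrite ?pldiff0 //; apply: plcochain0.
Qed.
Fact plcoboundaryP n c D1 D2 :
  plcoboundary n D1 -> plcoboundary n D2 -> plcoboundary n (c *: D1 + D2).
Proof.
case: n => [|n] /=; first by move=> -> ->; rewrite scaler0 addr0.
move=> [D1' C1 ->] [D2' C2 ->]; exists (c *: D1' + D2'); last by rewrite pldiffP.
exact: plcochainP.
Qed.

Definition HPreLie n : lmodType k :=
  subquot (Submod (@plcocycle0 n) (@plcocycleP n))
          (Submod (@plcoboundary0 n) (@plcoboundaryP n)).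
End Cohomology.

(* Main.v *)
(** Coderivations of the cofree coalgebra are determined by their corestriction
    (this uses characteristic zero), so the complex computing [HPreLie E] is
    Hom (L (x) Lambda^n L, E) with the differential [dcochain]. It is also
    Hom_U (Q_n, E), where Q_n is the free U-module on L (x) Lambda^n L, and
    ... -> Q_1 -> Q_0 -> Omega is a complex of projective U-modules; once this
    complex is known to be exact, the comparison of projective resolutions
    gives the theorem.

    Exactness at Q_n, for n > 0, is obtained without a PBW theorem. Every
    L-module E embeds into the module J of formal power series functions on L
    with values in E, where right multiplication by b acts through the vector
    field v |-> - (b + v <| b). The leading part of the differential with
    coefficients in J is the formal de Rham differential, so the Poincare lemma
    (characteristic zero again) and a convergent iteration show that every
    cocycle of positive degree with values in E becomes a coboundary in J.
    Applied to the tautological cocycle with values in E := Q_n / d Q_{n+1},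
    this says that the projection Q_n -> E, followed by the embedding E -> J,
    factors through d : Q_n -> Q_{n-1}, that is, cycles are boundaries. *)

Require Import Defs.
From HB Require Import structures.
From mathcomp Require Import all_boot all_algebra.
From mathcomp Require Import boolp classical_sets functions.

Set Implicit Arguments.
Unset Strict Implicit.
Unset Printing Implicit Defensive.

Import GRing.Theory.
Local Open Scope ring_scope.

(** * Alternating maps and signed extraction sums *)

Section AlternatingMaps.
Variables (k : fieldType) (V W : lmodType k).
Implicit Types (G : seq V -> W) (s t : seq V).

Lemma malt_swap G s u v t : malt G ->
  G (s ++ [:: u, v & t]) = - G (s ++ [:: v, u & t]).
Proof.
move=> [Gl Ga].
have GD w x y : G (s ++ [:: w, x + y & t]) = G (s ++ [:: w, x & t]) + G (s ++ [:: w, y & t]).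
  by have := Gl (s ++ [:: w]) 1 x y t; rewrite -!catA /= !scale1r.
have := Ga s (u + v) t.
have := Gl s 1 u v [:: u + v & t]; rewrite !scale1r => ->.
by rewrite !GD !Ga add0r addr0 => /eqP; rewrite addr_eq0 => /eqP.
Qed.

(** Moving an extracted letter back to its place costs exactly the sign carried by [psum], so every
    letter contributes [G s]. *)
Lemma psum_malt G s : malt G ->
  psum s (fun b r => G (b :: r)) = (size s)%:R *: G s.
Proof.
elim: s G => [|w s IH] G Gm /=; first by rewrite scale0r.
under psum_ext do rewrite (malt_swap [::]) //=.
have -> : psum s (fun b r => - G [:: w, b & r]) = - psum s (fun b r => G [:: w, b & r]).
  by rewrite -scaleN1r -psumZ; apply: psum_ext => *; rewrite scaleN1r.
rewrite (IH (fun x => G (w :: x))) ?opprK; last exact: malt_cons.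
by rewrite -[(size s).+1%:R]/(1 *+ _) mulrS scalerDl scale1r.
Qed.
End AlternatingMaps.

(** * Linear maps out of tensor products *)

Section TensorLift.
Variables (k : fieldType) (A B W : lmodType k) (m : A -> B -> W).
Hypothesis mbil : bilinear_map m.

Fact tlift_respect : mrespect (@tens_rel k A B) (fun p => m p.1 p.2).
Proof. by move=> s t [c a a' b|c a b b'] /=; [exact: mbil.2|exact: mbil.1]. Qed.
Definition tlift : tens A B -> W := mlift tlift_respect.
HB.instance Definition _ := GRing.Linear.copy tlift (mlift tlift_respect).
Lemma tliftE a b : tlift (tpure a b) = m a b. Proof. exact: mliftE. Qed.
End TensorLift.

Section TensorMapTheory.
Variable k : fieldType.

Lemma tens_linP (A B W : lmodType k) (f g : {linear tens A B -> W}) :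
  (forall a b, f (tpure a b) = g (tpure a b)) -> f =1 g.
Proof. by move=> fg; apply: presmod_linP => -[a b]; apply: fg. Qed.

Lemma tmap_comp (A A' A'' B B' B'' : lmodType k)
    (f : {linear A' -> A''}) (f' : {linear A -> A'}) (h : {linear A -> A''})
    (g : {linear B' -> B''}) (g' : {linear B -> B'}) (i : {linear B -> B''}) :
  (forall a, f (f' a) = h a) -> (forall b, g (g' b) = i b) ->
  forall x, tmap f g (tmap f' g' x) = tmap h i x.
Proof.
move=> fh gi; apply: (tens_linP (f := tmap f g \o tmap f' g')) => a b.
by rewrite /= !tmapE fh gi.
Qed.

End TensorMapTheory.

(** * Coderivations of the cofree coalgebra *)

Section CofreeTheory.
Variables (k : fieldType) (V : lmodType k).
Implicit Types (a b u v : V) (s t r : seq V) (x y : PLco V).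

Lemma cproj_sum y : exists N, forall M, (N <= M)%N -> y = \sum_(m < M) cproj m y.
Proof.
elim/PLco_ind: y => [a s||x y [N xN] [M yM]|c x [N xN]].
- exists (size s).+1 => M sM; rewrite (bigD1 (Ordinal sM)) //= cprojE eqxx scale1r.
  rewrite big1 ?addr0 // => m mM; rewrite cprojE; case: eqP => [sm|_]; last by rewrite scale0r.
  by case/eqP: mM; apply: val_inj.
- by exists 0 => M _; rewrite big1 // => m _; rewrite linear0.
- exists (maxn N M) => K; rewrite geq_max => /andP[NK MK].
  by rewrite {1}(xN K NK) {1}(yM K MK) -big_split; apply: eq_bigr => m _; rewrite linearD.
- exists N => M NM; rewrite {1}(xN M NM) scaler_sumr; apply: eq_bigr => m _.
  by rewrite linearZ.
Qed.

Lemma cproj_inj x y : (forall m, cproj m x = cproj m y) -> x = y.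
Proof.
move=> xy; have [N xN] := cproj_sum (x - y); apply: subr0_eq; rewrite (xN N) // big1 // => m _.
by rewrite linearB /= xy subrr.
Qed.

Lemma cproj_eq0 y : (forall m, cproj m y = 0) -> y = 0.
Proof. by move=> y0; apply: cproj_inj => m; rewrite y0 linear0. Qed.

Lemma cproj_proj m n x : cproj m (cproj n x) = (m == n)%:R *: cproj n x.
Proof.
apply: (PLco_linP (f := cproj m \o cproj n) (g := (m == n)%:R \*: cproj n)) => a s.
rewrite /= !cprojE linearZ /= cprojE !scalerA; have [->|_] := eqVneq (size s) n.
  by rewrite mulrC eq_sym.
by rewrite mulr0 mul0r.
Qed.

Lemma cprojK n x : cproj n (cproj n x) = cproj n x.
Proof. by rewrite cproj_proj eqxx scale1r. Qed.

Lemma cproj_ccog x : cproj 0 x = cg (ccog x) [::].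
Proof.
elim/PLco_ind: x => [a s||x y IHx IHy|c x IHx].
- by rewrite cprojE ccogE; case: s => [|b s] /=; rewrite ?scale1r ?scale0r ?cg0.
- by rewrite !linear0 cg0.
- rewrite !linearD /= IHx IHy.
  by rewrite -[ccog x](scale1r (ccog x)) cg_linear !scale1r.
- by rewrite !linearZ /= IHx -[_ *: ccog x]addr0 cg_linear cg0 addr0.
Qed.

Lemma ccog_proj x : ccog (cproj 0 x) = ccog x.
Proof.
apply: (PLco_linP (f := ccog \o cproj 0)) => a [|b s] /=.
  by rewrite cprojE eqxx scale1r.
by rewrite cprojE /= scale0r linear0 ccogE.
Qed.

Lemma cproj_koszul n m x : cproj m (ckoszul n x) = (-1) ^+ (n * m.+1) *: cproj m x.
Proof.
apply: (PLco_linP (f := cproj m \o ckoszul n) (g := (-1) ^+ (n * m.+1) \*: cproj m)) => a s.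
rewrite /= ckoszulE linearZ /= cprojE !scalerA; case: eqP => [->|] //.
by rewrite !mulr0.
Qed.

Fact cg_cons_malt2 a : malt2 (fun b r => cg a (b :: r)).
Proof.
split=> [s c b b'|b]; first exact: ((cg_malt a).1 [::]).
by apply: malt_cons; apply: cg_malt.
Qed.

(** This product sends the tensor of [cg a [::]] and [cg b r] to [cg a (b :: r)] and kills left
    factors of positive weight, the weight being the number of letters of the sequence. *)
Fact cmu_bilinear : bilinear_map (fun x y => clift (cg_cons_malt2 (ccog x)) y).
Proof.
split=> [x|y] c u v; first by rewrite linearP.
apply: (PLco_linP (f := clift (cg_cons_malt2 (ccog (c *: u + v))))
  (g := (c \*: clift (cg_cons_malt2 (ccog u))) \+ clift (cg_cons_malt2 (ccog v)))) => b r.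
by rewrite /= !cliftE linearP cg_linear.
Qed.

(** Only the terms of the coproduct with left factor [cg a [::]] survive, and reinserting the
    extracted letter undoes its sign. In characteristic zero this recovers an element of positive
    weight from its coproduct. *)
Lemma cmu_delta a s : tlift cmu_bilinear (cdelta (cg a s)) = (size s)%:R *: cg a s.
Proof.
rewrite cdeltaE usum_lin usumC /=.
transitivity (usum s (fun z w => if w is [::] then psum z (fun b r => cg a (b :: r)) else 0)).
  apply: usum_ext => z w _; rewrite psum_lin.
  under psum_ext do rewrite /= tliftE ccogE cliftE.
  case: w => [|c w]; first by rewrite muln0 scale1r.
  by under psum_ext do rewrite cg0; rewrite psum0 scaler0.
rewrite (usum_nilr s (fun z => psum z (fun b r => cg a (b :: r)))).
exact/psum_malt/cg_malt.
Qed.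

Section CharZero.
Hypothesis pchar0 : [pchar k] =i pred0.

(* The only primitive elements of the cofree coalgebra are its cogenerators. *)
Lemma cdelta_ccog_inj x : cdelta x = 0 -> ccog x = 0 -> x = 0.
Proof.
move=> dx cx; apply: cproj_eq0 => -[|m]; first by rewrite cproj_ccog cx cg0.
have : cproj m.+1 (tlift cmu_bilinear (cdelta x)) = m.+1%:R *: cproj m.+1 x.
  apply: (PLco_linP (f := cproj m.+1 \o (tlift cmu_bilinear \o cdelta))
    (g := m.+1%:R \*: cproj m.+1)) => a s.
  by rewrite /= cmu_delta linearZ /= cprojE !scalerA; case: eqP => [->|]; rewrite ?mulr0.
rewrite dx !linear0 => /esym/eqP; rewrite scaler_eq0 => /orP[|/eqP//].
by have /pcharf0P-> := pchar0.
Qed.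

(** Induction on the weight: both factors of the coproduct of [cg a s] are shorter than [s], so the
    co-Leibniz rule makes [D (cg a s)] primitive, with zero corestriction. *)
Lemma coderivation_eq0 n (D : {linear PLco V -> PLco V}) :
  coderivation n D -> (forall x, ccog (D x) = 0) -> forall x, D x = 0.
Proof.
move=> [_ DD] D0; apply: (PLco_linP (g := \0)) => a s /=.
have [N] := ubnP (size s); elim: N a s => // N IH a s; rewrite ltnS => sN.
apply: cdelta_ccog_inj => //; rewrite DD cdeltaE !usum_lin.
rewrite -[RHS]addr0; congr (_ + _); rewrite -[RHS](usum0 _ s).
  apply: usum_ext => x y xy; rewrite psum_lin -[RHS](psum0 _ y).
  apply: psum_ext => b r yr; rewrite /= tmapE IH ?tpure0l //.
  by apply: leq_trans sN; rewrite -xy yr addnS ltnS leq_addr.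
apply: usum_ext => x y xy; rewrite psum_lin -[RHS](psum0 _ y).
apply: psum_ext => b r yr; rewrite /= tmapE IH ?linear0 //.
by apply: leq_trans sN; rewrite -xy yr addnS ltnS leq_addl.
Qed.

Lemma coderivation_eq n (D D' : {linear PLco V -> PLco V}) :
  coderivation n D -> coderivation n D' ->
  (forall x, ccog (D x) = ccog (D' x)) -> forall x, D x = D' x.
Proof.
move=> [Dp Dd] [Dp' Dd'] DD x; apply: subr0_eq.
apply: (@coderivation_eq0 n (D \+ -1 \*: D')) => [|{}x]; last first.
  by rewrite /= linearD linearZ /= DD scaleN1r subrr.
split=> [m {}x|{}x] /=.
  by rewrite linearD linearZ /= Dp Dp'.
rewrite linearD linearZ /= Dd Dd'.
have e1 : tmap (D \+ -1 \*: D') idfun (cdelta x) =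
    -1 *: tmap D' idfun (cdelta x) + tmap D idfun (cdelta x).
  by apply: tmapPl => a /=; rewrite addrC.
have e2 : tmap (ckoszul n) (D \+ -1 \*: D') (cdelta x) =
    -1 *: tmap (ckoszul n) D' (cdelta x) + tmap (ckoszul n) D (cdelta x).
  by apply: tmapPr => a /=; rewrite addrC.
by rewrite e1 e2 scalerDr addrC addrACA.
Qed.
End CharZero.

Lemma koszul_coder p n (D : {linear PLco V -> PLco V}) x :
  (forall m x, cproj m (D x) = D (cproj (m + n) x)) ->
  ckoszul p (D x) = (-1) ^+ (p * n) *: D (ckoszul p x).
Proof.
move=> Dn; apply: cproj_inj => m; rewrite cproj_koszul linearZ /= !Dn cproj_koszul linearZ /=.
rewrite scalerA -exprD; congr (_ *: _).
rewrite -signr_odd -[RHS]signr_odd; congr ((-1) ^+ nat_of_bool _).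
by rewrite oddD !oddM /= !oddD; case: (odd p); case: (odd n); case: (odd m).
Qed.

Lemma ckoszulD p q x : ckoszul p (ckoszul q x) = ckoszul (p + q) x.
Proof.
apply: cproj_inj => m; rewrite !cproj_koszul scalerA -exprD.
by rewrite mulnDl.
Qed.

(** Applying the co-Leibniz rule twice gives terms with both maps in one factor, which form the
    commutator, and cross terms, which cancel by the Koszul sign rule. *)
Lemma coder_commutator p q (D1 D2 : {linear PLco V -> PLco V}) :
  coderivation p D1 -> coderivation q D2 ->
  coderivation (p + q) ((D1 \o D2) \- ((-1) ^+ (p * q) \*: (D2 \o D1))).
Proof.
move=> [p1 d1] [p2 d2]; split=> [m x|x] /=.
  by rewrite linearB linearZ /= !(p1, p2) -!addnA [(q + p)%N]addnC.
set y := cdelta x.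
set c := (-1) ^+ (p * q).
have cc : c * c = 1 by apply: sgn_sq.
have X2 : tmap (ckoszul p) D1 (tmap D2 idfun y) = c *: tmap D2 idfun (tmap (ckoszul p) D1 y).
  rewrite (tmap_comp (h := c \*: (D2 \o ckoszul p)) (i := D1)) // => [|z].
    rewrite (tmap_comp (h := D2 \o ckoszul p) (i := D1)) //.
    by rewrite -[RHS]addr0 -(@tmap0l _ _ _ _ _ \0 D1 y) //; apply: tmapPl => z /=; rewrite addr0.
  by rewrite /= (koszul_coder _ _ p2).
have X4 : tmap (ckoszul q) D2 (tmap D1 idfun y) = c *: tmap D1 idfun (tmap (ckoszul q) D2 y).
  rewrite (tmap_comp (h := c \*: (D1 \o ckoszul q)) (i := D2)) // => [|z].
    rewrite (tmap_comp (h := D1 \o ckoszul q) (i := D2)) //.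
    by rewrite -[RHS]addr0 -(@tmap0l _ _ _ _ _ \0 D2 y) //; apply: tmapPl => z /=; rewrite addr0.
  by rewrite /= (koszul_coder _ _ p1) mulnC.
rewrite linearB linearZ /= !(d1, d2) -/y !linearD /= X2 X4 !scalerA cc scale1r.
have -> : tmap ((D1 \o D2) \- (c \*: (D2 \o D1))) idfun y =
    - c *: tmap D2 idfun (tmap D1 idfun y) + tmap D1 idfun (tmap D2 idfun y).
  rewrite (tmap_comp (h := D2 \o D1) (i := idfun)) //.
  rewrite (tmap_comp (h := D1 \o D2) (i := idfun)) //.
  by apply: tmapPl => z /=; rewrite addrC scaleNr.
have -> : tmap (ckoszul (p + q)) ((D1 \o D2) \- (c \*: (D2 \o D1))) y =
    - c *: tmap (ckoszul q) D2 (tmap (ckoszul p) D1 y) +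
    tmap (ckoszul p) D1 (tmap (ckoszul q) D2 y).
  rewrite (tmap_comp (h := ckoszul (p + q)) (i := D2 \o D1)) // => [|z]; last first.
    by rewrite /= ckoszulD addnC.
  rewrite (tmap_comp (h := ckoszul (p + q)) (i := D1 \o D2)) // => [|z]; last exact: ckoszulD.
  by apply: tmapPr => z /=; rewrite addrC scaleNr.
rewrite !scaleNr.
(* The cross terms are terms 2, 7 and 3, 6; they cancel in pairs. *)
rewrite [LHS](AC ((2*2)*(2*2)) (((5*1)*(8*4))*((2*7)*(3*6)))) /=.
by rewrite !subrr !addr0.
Qed.
End CofreeTheory.

(** * The square of the structure coderivation *)

Section StructureSquare.
Variables (k : fieldType) (L : preLieAlg k).

Lemma plcorE (a : L) s : plcor (cg a s) = if s is [:: b] then plmul a b else 0.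
Proof. exact: cliftE. Qed.

Lemma plcoderE (a : L) s : plcoder (cg a s) =
  usum s (fun x y => cg (plcor (cg a x)) y
    - psum x (fun b r => cg a (plcor (cg b r) :: y))).
Proof. by rewrite [LHS]coliftE; apply: usum_ext => x y _; rewrite expr1 scaleN1r. Qed.

Lemma plcoder_proj m (x : PLco L) : cproj m (plcoder x) = plcoder (cproj m.+1 x).
Proof. by rewrite (plcoder_coderivation L).1 addn1. Qed.

Lemma plcoder_nil (a : L) : plcoder (cg a [::]) = 0.
Proof. by rewrite plcoderE /= plcorE cg0 subr0. Qed.

Lemma plcoder_single (a b : L) : plcoder (cg a [:: b]) = cg (plmul a b) [::].
Proof. by rewrite plcoderE /= !plcorE !subr0 !cg0 cg0s scaler0 subr0 addr0. Qed.

Lemma plcor_proj (x : PLco L) : plcor (cproj 1 x) = plcor x.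
Proof.
apply: (PLco_linP (f := @plcor k L \o cproj 1) (g := @plcor k L)) => a s.
rewrite /= cprojE linearZ /= plcorE.
by case: s => [|b [|c s]] /=; rewrite ?scaler0 ?scale1r.
Qed.

(** Since [plcoder] lowers the weight by one, only weight 2 matters. On [cg a [:: b; c]] the
    composite is a difference of two associators, which is zero by right symmetry. *)
Lemma plcor_plcoder (x : PLco L) : plcor (plcoder x) = 0.
Proof.
rewrite -plcor_proj plcoder_proj.
apply: (PLco_linP (f := @plcor k L \o (@plcoder k L \o cproj 2)) (g := \0)) => a s.
rewrite /= cprojE !linearZ /=; case: s => [|b [|c [|d s]]]; rewrite ?scale0r // scale1r.
rewrite plcoderE usum_lin.
transitivity (usum [:: b; c] (fun x y => 
   plcor (cg (plcor (cg a x)) y) - psum x (fun b r => plcor (cg a (plcor (cg b r) :: y))))).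
  by apply: usum_ext => z y _; rewrite linearB psum_lin.
rewrite /= !plcorE !subr0.
rewrite expr0 expr1 !scale1r scaleN1r addr0 sub0r opprB.
have /eqP := plmul_rsym a b c; rewrite -subr_eq0 opprB => /eqP<-.
by rewrite [LHS](ACl (4*2*(1*3))).
Qed.

Hypothesis pchar0 : [pchar k] =i pred0.

(** The graded commutator of the odd coderivation [plcoder] with itself is twice its square, and its
    corestriction vanishes by [plcor_plcoder]. Dividing by 2 uses characteristic zero. *)
Lemma plcoder_square (x : PLco L) : plcoder (plcoder x) = 0.
Proof.
have dL := plcoder_coderivation L.
have /eqP : 2%:R *: plcoder (plcoder x) = 0.
  have := coderivation_eq0 pchar0 (coder_commutator dL dL) _ x.
  rewrite /= muln1 expr1 scaleN1r opprK scaler_nat mulr2n; apply => y.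
  by rewrite scaleN1r opprK linearD /= ccog_plcoder plcor_plcoder addr0.
rewrite scaler_eq0 => /orP[|/eqP//].
by have /pcharf0P-> := pchar0.
Qed.
End StructureSquare.

(** * Signed sums under maps and reindexing *)

Section SumMap.
Variables (k : fieldType) (V V' W : lmodType k).

Lemma usum_map (h : V -> V') s (F : seq V' -> seq V' -> W) :
  usum (map h s) F = usum s (fun x y => F (map h x) (map h y)).
Proof.
elim: s F => //= w s IH F; rewrite IH; apply: usum_ext => x y _.
by rewrite size_map.
Qed.

Lemma psum_map (h : V -> V') s (F : V' -> seq V' -> W) :
  psum (map h s) F = psum s (fun b r => F (h b) (map h r)).
Proof. by elim: s F => //= w s IH F; rewrite IH. Qed.

(** The sign moves [b] from behind [r] to the front, turning the sign of a splitting into that of an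
    extraction. *)
Lemma usum_singler s (G : V -> seq V -> W) :
  usum s (fun x y => if y is [:: b] then G b x else 0) =
  psum s (fun b r => (-1) ^+ size r *: G b r).
Proof.
elim: s G => //= w s IH G; rewrite usumD IH addrC; congr (_ + _).
  rewrite -[RHS](usum_nilr s (fun x => (-1) ^+ size x *: G w x)).
  by apply: usum_ext => x [|b y] _ //; rewrite scaler0.
rewrite -scaleN1r -psumZ; apply: psum_ext => b r _.
by rewrite scalerA exprS mulrA mulrNN mul1r mul1r.
Qed.
End SumMap.

(** * Brackets with the structure coderivation *)

Section StructureColift.
Variables (k : fieldType) (M : preLieAlg k) (n : nat) (f : {linear PLco M -> M}).

Lemma plcor_colift (a : M) s : cohomog n f -> plcor (colift n f (cg a s)) =
  (-1) ^+ n *: psum s (fun b r => plmul (f (cg a r)) b + plmul a (f (cg b r))).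
Proof.
move=> fn; rewrite coliftE usum_lin.
transitivity (usum s (fun x y => if y is [:: b] then plmul (f (cg a x)) b else 0) +
  (-1) ^+ n *: usum s (fun x y =>
     if y is [::] then psum x (fun b r => plmul a (f (cg b r))) else 0)).
  rewrite -usumZ -usumD; apply: usum_ext => x y _.
  rewrite linearD linearZ /= psum_lin plcorE; congr (_ + _ *: _).
  by case: y => [|c y]; under psum_ext do rewrite /= plcorE; rewrite ?psum0.
rewrite (usum_nilr s (fun x => psum x (fun b r => plmul a (f (cg b r))))).
rewrite (usum_singler s (fun b x => plmul (f (cg a x)) b)) psumD scalerDr.
congr (_ + _); rewrite -psumZ; apply: psum_ext => b r _.
have [->//|/fn->] := eqVneq (size r) n.
have -> : plmul 0 b = 0 :> M.
  by have := plmulPl b (-1) 0 0; rewrite scaler0 addr0 scaleN1r addNr.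
by rewrite !scaler0.
Qed.

Lemma ccog_bracket_colift (a : M) s : cohomog n f ->
  ccog (plcoder (colift n f (cg a s)) - (-1) ^+ n *: colift n f (plcoder (cg a s))) =
  (-1) ^+ n *: (psum s (fun b r => plmul (f (cg a r)) b + plmul a (f (cg b r)))
                - f (plcoder (cg a s))).
Proof.
move=> fn; rewrite linearB linearZ /= ccog_plcoder ccog_colift plcor_colift //.
by rewrite scalerBr.
Qed.

(** The two terms with [plcoder] on both sides of [D] cancel, and the others contain the square of
    [plcoder]. *)
Lemma plcoder_bracket_square (D : {linear PLco M -> PLco M}) x : [pchar k] =i pred0 ->
  plcoder (plcoder (D x) - (-1) ^+ n *: D (plcoder x)) -
  (-1) ^+ n.+1 *: (plcoder (D (plcoder x)) - (-1) ^+ n *: D (plcoder (plcoder x))) = 0.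
Proof.
move=> pchar0; rewrite linearB linearZ /= !plcoder_square // linear0 scaler0 subr0 sub0r.
by rewrite exprS mulN1r scaleNr opprK addNr.
Qed.
End StructureColift.

(** * Functoriality in the pre-Lie algebra *)

Section StructureMap.
Variables (k : fieldType) (M M' : preLieAlg k) (h : {linear M -> M'}).
Hypothesis hM : forall a b, h (plmul a b) = plmul (h a) (h b).

Lemma plcor_map (x : PLco M) : plcor (cmap h x) = h (plcor x).
Proof.
apply: (PLco_linP (f := @plcor k M' \o cmap h) (g := h \o @plcor k M)) => a s.
rewrite /= cmapE !plcorE.
by case: s => [|b [|c s]] /=; rewrite ?linear0 ?hM.
Qed.

Lemma plcoder_map (x : PLco M) : plcoder (cmap h x) = cmap h (plcoder x).
Proof.
apply: (PLco_linP (f := @plcoder k M' \o cmap h) (g := cmap h \o @plcoder k M)) => a s.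
rewrite /= cmapE !plcoderE usum_lin usum_map; apply: usum_ext => x' y _.
rewrite linearB /= (psum_lin (cmap h)) psum_map /= cmapE -plcor_map cmapE; congr (_ - _).
by apply: psum_ext => b r _; rewrite /= cmapE /= -plcor_map cmapE.
Qed.
End StructureMap.

Lemma cproj_map (k : fieldType) (V V' : lmodType k) (h : {linear V -> V'}) n x :
  cproj n (cmap h x) = cmap h (cproj n x).
Proof.
apply: (PLco_linP (f := cproj n \o cmap h) (g := cmap h \o cproj n)) => a s.
by rewrite /= cmapE !cprojE linearZ /= cmapE size_map.
Qed.

(** * The cochain differential *)

Section CochainDifferential.
Variables (k : fieldType) (L : preLieAlg k) (E : preLieMod L).
Implicit Types f g h : {linear PLco L -> E}.

Fact cact_malt2 g : malt2 (fun a s =>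
  psum s (fun b r => ract (g (cg a r)) b + lact a (g (cg b r)))).
Proof.
split=> [s c a a'|a].
  rewrite -psumP; apply: psum_ext => b r _.
  by rewrite cg_linear linearP ractPl lactPl scalerDr addrACA.
apply: malt_psum => [r c b b'|b].
  by rewrite cg_linear linearP ractP lactP scalerDr addrACA.
apply: maltD; split=> [s c u v t|s u t].
- by rewrite (cg_malt a).1 linearP ractPl.
- by rewrite (cg_malt a).2 linear0 ract0.
- by rewrite (cg_malt b).1 linearP lactP.
- by rewrite (cg_malt b).2 linear0 lact0.
Qed.

(** The bracket with the structure coderivation, read on corestrictions and stripped of its factor
    [(-1) ^+ n]. Without the sign the formula does not mention the degree and applies to cochains of
    mixed weight. *)
Definition dcochain g (x : PLco L) : E := clift (cact_malt2 g) x - g (plcoder x).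
Fact dcochain_linear g : linear (dcochain g).
Proof.
move=> c x y; rewrite /dcochain (linearP (clift _)) (linearP (@plcoder k L)) (linearP g).
by rewrite opprD scalerBr addrACA.
Qed.
HB.instance Definition _ g :=
  GRing.isLinear.Build k (PLco L) E *:%R (dcochain g) (dcochain_linear g).

Lemma dcochainE g a s : dcochain g (cg a s) =
  psum s (fun b r => ract (g (cg a r)) b + lact a (g (cg b r))) - g (plcoder (cg a s)).
Proof. by rewrite /dcochain cliftE. Qed.

Lemma dcochainP c g h f : (forall x, f x = c *: g x + h x) ->
  forall x, dcochain f x = c *: dcochain g x + dcochain h x.
Proof.
move=> fE; apply: (PLco_linP (g := (c \*: dcochain g) \+ dcochain h)) => a s.
rewrite /= !dcochainE fE scalerBr opprD addrACA -psumP; congr (_ + _).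
by apply: psum_ext => b r _; rewrite !fE ractPl lactP scalerDr addrACA.
Qed.

Lemma dcochain_nil g a : dcochain g (cg a [::]) = 0.
Proof. by rewrite dcochainE plcoder_nil linear0 subr0. Qed.

Lemma dcochain_proj n g h : (forall x, h x = g (cproj n x)) ->
  forall x, dcochain h x = dcochain g (cproj n.+1 x).
Proof.
move=> hg; apply: (PLco_linP (g := dcochain g \o cproj n.+1)) => a s.
rewrite /= cprojE linearZ /= !dcochainE hg scalerBr plcoder_proj cprojE linearZ /= linearZ.
congr (_ - _); rewrite -psumZ; apply: psum_ext => b r sr.
rewrite !hg !cprojE sr eqSS; case: eqP => _; rewrite ?scale1r // !scale0r linear0.
by rewrite ract0 lact0 addr0.
Qed.

Definition homog_cochain n g := forall x, g (cproj n x) = g x.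

Lemma homog_dcochain n g : homog_cochain n g -> homog_cochain n.+1 (dcochain g).
Proof. by move=> gn x /=; rewrite -(@dcochain_proj n g g). Qed.

(** The form of corestriction that defines the subcomplex: it factors through [L] and takes values
    in [E]. *)
Definition sqcor g (x : PLco (sqzero E)) : sqzero E :=
  (0, g (cmap (fst : {linear (L * E)%type -> L}) x)).
Fact sqcor_linear g : linear (sqcor g).
Proof. by move=> c x y; rewrite /sqcor !linearP /=; congr pair; rewrite /= scaler0 addr0. Qed.
HB.instance Definition _ g :=
  GRing.isLinear.Build k (PLco (sqzero E)) (sqzero E) *:%R (sqcor g) (sqcor_linear g).

Definition sqinr (e : E) : sqzero E := (0, e).
Fact sqinr_linear : linear sqinr.
Proof. by move=> c a b; congr pair; rewrite /= scaler0 addr0. Qed.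
HB.instance Definition _ := GRing.isLinear.Build k E (sqzero E) *:%R sqinr sqinr_linear.

Lemma sqinr_mul (a b : sqzero E) (e f : E) :
  plmul (sqinr e) b + plmul a (sqinr f) = sqinr (ract e b.1 + lact a.1 f).
Proof.
case: a b => [a u] [b v]; congr pair; rewrite /= ?lact0l ?ract0l.
  have := plmulPl b (-1) 0 0; rewrite scaler0 addr0 scaleN1r addNr /= => ->.
  by have := plmulP a (-1) 0 0; rewrite scaler0 addr0 scaleN1r addNr /= => ->; rewrite addr0.
by rewrite add0r addr0.
Qed.

Definition sqinl (a : L) : sqzero E := (a, 0).
Fact sqinl_linear : linear sqinl.
Proof. by move=> c a b; congr pair; rewrite /= scaler0 addr0. Qed.
HB.instance Definition _ := GRing.isLinear.Build k L (sqzero E) *:%R sqinl sqinl_linear.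

Lemma cmap_fst_inl x : cmap (fst : {linear (L * E)%type -> L}) (cmap sqinl x) = x.
Proof.
apply: (PLco_linP (f := cmap (fst : {linear (L * E)%type -> L}) \o cmap sqinl) (g := idfun)).
move=> a s; rewrite /= !cmapE /= -map_comp; congr cg.
by rewrite -[RHS]map_id; apply: eq_map.
Qed.

Lemma cohomog_sqcor n g : homog_cochain n g -> cohomog n (sqcor g).
Proof.
move=> gn a s /negPf sn; rewrite /= /sqcor -gn cmapE cprojE size_map sn scale0r linear0.
by [].
Qed.

Lemma plcochain_sqcor n g : homog_cochain n g -> plcochain n (colift n (sqcor g)).
Proof.
move=> gn; exists (colift n (sqcor g)) => //; split.
  exact/colift_coderivation/cohomog_sqcor.
by exists g => x; rewrite ccog_colift.
Qed.

Hypothesis pchar0 : [pchar k] =i pred0.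

(** A coderivation is determined by its corestriction, which factors through [L] and so is recovered
    along the inclusion of [L]. Homogeneity of [g] comes from the degree condition on the
    coderivation. *)
Lemma plcochainP_sqcor n D : plcochain n D -> exists g : {linear PLco L -> E},
  [/\ homog_cochain n g, D = colift n (sqcor g) &
      forall x, g x = (ccog (D (cmap sqinl x))).2].
Proof.
move=> [F -> [Fc [g Fg]]]; exists g.
have gE x : g x = (ccog (F (cmap sqinl x))).2 by rewrite Fg cmap_fst_inl.
have gn : homog_cochain n g.
  by move=> x; rewrite !gE -cproj_map -{1}[n]add0n -Fc.1 ccog_proj.
split=> //; apply/funext => x.
apply: (coderivation_eq pchar0 Fc) => [|{}x]; last by rewrite Fg ccog_colift.
exact/colift_coderivation/cohomog_sqcor.
Qed.

Lemma ccog_pldiff n g x : homog_cochain n g ->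
  ccog (pldiff n (colift n (sqcor g)) x) =
  sqcor ((-1) ^+ n \*: dcochain g) x :> sqzero E.
Proof.
move=> gn; move: x; pose c : k := (-1) ^+ n.
pose H := @ccog k (sqzero E) \o ((@plcoder k (sqzero E) \o colift n (sqcor g))
  \- (c \*: (colift n (sqcor g) \o @plcoder k (sqzero E)))).
apply: (PLco_linP (f := H) (g := sqcor (c \*: dcochain g))) => a s.
rewrite -[LHS]/(ccog (plcoder (colift n (sqcor g) (cg a s))
  - (-1) ^+ n *: colift n (sqcor g) (plcoder (cg a s)))).
rewrite ccog_bracket_colift; last exact: cohomog_sqcor.
rewrite -[RHS]/(sqinr (c *: dcochain g (cmap (fst : {linear (L * E)%type -> L}) (cg a s)))).
rewrite cmapE dcochainE psum_map -/c linearZ; congr (_ *: _).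
rewrite (linearB sqinr) (psum_lin sqinr); congr (_ - _); last first.
  rewrite -(@cmapE _ _ _ (fst : {linear (L * E)%type -> L})).
  by rewrite (plcoder_map (h := fst : {linear sqzero E -> L})).
apply: psum_ext => b r _.
rewrite -!(@cmapE _ _ _ (fst : {linear (L * E)%type -> L})).
exact: sqinr_mul.
Qed.

(** Both sides are coderivations of the same degree, the left one by [coder_commutator], so
    comparing corestrictions suffices. *)
Lemma pldiff_sqcor n g : homog_cochain n g ->
  pldiff n (colift n (sqcor g)) = colift n.+1 (sqcor ((-1) ^+ n \*: dcochain g)).
Proof.
move=> gn; apply/funext.
have Dc : coderivation n (colift n (sqcor g)) by apply/colift_coderivation/cohomog_sqcor.
have := coder_commutator (plcoder_coderivation (sqzero E)) Dc.
rewrite mul1n add1n => Bc.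
apply: (coderivation_eq pchar0 Bc) => [|x]; last first.
  by rewrite ccog_colift; apply: (ccog_pldiff x gn).
apply/colift_coderivation/cohomog_sqcor => x /=.
by rewrite (homog_dcochain gn).
Qed.

Lemma colift_sqcor_inj n g h :
  colift n (sqcor g) = colift n (sqcor h) <-> forall x, g x = h x.
Proof.
split=> [gh x|gh].
  have /(congr1 snd) : sqcor g (cmap sqinl x) = sqcor h (cmap sqinl x).
    by rewrite -[LHS](ccog_colift n (sqcor g)) -[RHS](ccog_colift n (sqcor h)) gh.
  by rewrite /sqcor /= cmap_fst_inl.
apply/funext; apply: (PLco_linP (f := colift n (sqcor g)) (g := colift n (sqcor h))) => a s.
rewrite [LHS]coliftE [RHS]coliftE; apply: usum_ext => x y _.
have s0 z : (sqcor g : {linear PLco (sqzero E) -> sqzero E}) z =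
  (sqcor h : {linear PLco (sqzero E) -> sqzero E}) z by rewrite /= /sqcor gh.
rewrite !s0; congr (_ + _ *: _).
by apply: psum_ext => b r _; rewrite s0.
Qed.

Lemma colift_sqcor_eq0 n g : homog_cochain n g ->
  colift n (sqcor g) = 0 <-> forall x, g x = 0.
Proof.
move=> gn; split=> [g0 x|g0].
  have /(congr1 snd) : sqcor g (cmap sqinl x) = 0.
    by rewrite -[LHS](ccog_colift n (sqcor g)) g0; apply: linear0.
  by rewrite /sqcor /= cmap_fst_inl.
apply/funext => x; apply: (coderivation_eq0 pchar0) => [|y].
  exact/colift_coderivation/cohomog_sqcor.
by rewrite ccog_colift /= /sqcor g0.
Qed.

Lemma dcochain_eq0 g : (forall x, g x = 0) -> forall x, dcochain g x = 0.
Proof.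
move=> g0 x; rewrite (@dcochainP (-1) g g g) => [|y]; first by rewrite scaleN1r addNr.
by rewrite g0 scaler0 addr0.
Qed.

Lemma dcochainZ c g f : (forall x, f x = c *: g x) ->
  forall x, dcochain f x = c *: dcochain g x.
Proof.
move=> fg x; rewrite (@dcochainP c g \0) => [|y] /=; last by rewrite addr0.
by rewrite (@dcochain_eq0 \0) ?addr0.
Qed.

(** Transported from the vanishing of the iterated bracket; the signs in between are units. *)
Lemma dcochain_square_homog n g : homog_cochain n g -> forall x, dcochain (dcochain g) x = 0.
Proof.
move=> gn x.
have gn1 : homog_cochain n.+1 ((-1) ^+ n \*: dcochain g).
  by move=> y /=; rewrite (homog_dcochain gn).
have : pldiff n.+1 (pldiff n (colift n (sqcor g))) = 0.
  by apply/funext => y; apply: plcoder_bracket_square.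
have gn2 : homog_cochain n.+2 ((-1) ^+ n.+1 \*: dcochain ((-1) ^+ n \*: dcochain g)).
  by move=> y /=; rewrite (homog_dcochain gn1).
rewrite pldiff_sqcor // pldiff_sqcor // => /(colift_sqcor_eq0 gn2)/(_ x)/eqP.
rewrite /= (dcochainZ (g := dcochain g) (c := (-1) ^+ n)) // scalerA.
by rewrite scaler_eq0 mulf_eq0 !expf_eq0 oppr_eq0 oner_eq0 !andbF => /eqP.
Qed.

(** Reduction to homogeneous cochains: in weight n + 2 only the weight n part of [g] enters, and in
    weights 0 and 1 the square vanishes because [dcochain] is zero on weight 0. *)
Lemma dcochain_square g x : dcochain (dcochain g) x = 0.
Proof.
move: x; apply: (PLco_linP (f := dcochain (dcochain g)) (g := \0)) => a s /=.
have <- : cproj (size s) (cg a s) = cg a s by rewrite cprojE eqxx scale1r.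
case: (size s) => [|[|n]].
- by rewrite cproj_ccog dcochain_nil.
- rewrite -(dcochain_proj (n := 0) (h := \0)) => [|x] /=; last first.
    by rewrite cproj_ccog dcochain_nil.
  exact: dcochain_eq0.
rewrite -(dcochain_proj (n := n.+1) (h := dcochain (g \o cproj n))) => [|x] /=.
  by rewrite (@dcochain_square_homog n) // => x /=; rewrite cprojK.
by rewrite (@dcochain_proj n g).
Qed.
End CochainDifferential.

(** * Modules built from two actions *)

Section ModuleBuilder.
Variables (k : fieldType) (L : preLieAlg k) (E : lmodType k).
Variables (la : L -> E -> E) (ra : E -> L -> E).
Hypotheses (laP : bilinear_map la) (raP : bilinear_map ra).
Hypothesis raA : forall e a b,
  ra (ra e a) b - ra e (plmul a b) = ra (ra e b) a - ra e (plmul b a).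
Hypothesis laA : forall e a b,
  ra (la a e) b - la a (ra e b) = la (plmul a b) e - la a (la b e).

(** The [E] component splits according to which argument lies in [E]: [raA] treats the first, and
    [laA] the other two, which right symmetry exchanges. *)
Lemma sqzero_rsym_of_actions : right_symmetric (sqzero_mul la ra).
Proof.
have laD a e f : la a (e + f) = la a e + la a f.
  by have := laP.1 a 1 e f; rewrite !scale1r.
have raD a e f : ra (e + f) a = ra e a + ra f a.
  by have := raP.2 a 1 e f; rewrite !scale1r.
move=> [a e] [b f] [c g]; congr pair; first exact: plmul_rsym.
rewrite /sqzero_mul /= !laD !raD.
rewrite -[LHS]/(_ + (_ + _) - (_ + _ + _)) -[RHS]/(_ + (_ + _) - (_ + _ + _)).
have -> : la (plmul a b) g + (ra (la a f) c + ra (ra e b) c)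
    - (la a (la b g) + la a (ra f c) + ra e (plmul b c)) =
  (la (plmul a b) g - la a (la b g)) + (ra (la a f) c - la a (ra f c))
    + (ra (ra e b) c - ra e (plmul b c)).
  by rewrite !opprD [LHS](AC ((1*2)*3) ((1*4)*(2*5)*(3*6))).
have -> : la (plmul a c) f + (ra (la a g) b + ra (ra e c) b)
    - (la a (la c f) + la a (ra g b) + ra e (plmul c b)) =
  (la (plmul a c) f - la a (la c f)) + (ra (la a g) b - la a (ra g b))
    + (ra (ra e c) b - ra e (plmul c b)).
  by rewrite !opprD [LHS](AC ((1*2)*3) ((1*4)*(2*5)*(3*6))).
by rewrite raA -!laA [ra (la a f) c - _ + _]addrC.
Qed.
End ModuleBuilder.

(** * Unsigned extraction sums *)

Section UnorderedSums.
Variables (V : choiceType) (W : zmodType).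
Implicit Types (s t r : seq V) (F : V -> seq V -> W).

Definition ssum s F := \sum_(v <- s) F v (rem v s).
Definition perm_inv F := forall v r r', perm_eq r r' -> F v r = F v r'.

(** When [v] equals [w], [rem] deletes the leading copy instead of the one in [s]. The two
    remainders differ by a permutation, hence the hypothesis on [F]. *)
Lemma ssum_cons F w s : perm_inv F ->
  ssum (w :: s) F = F w s + ssum s (fun v r => F v (w :: r)).
Proof.
move=> Fp; rewrite /ssum big_cons /= eqxx; congr (_ + _).
apply: eq_big_seq => v vs; apply: Fp; case: eqP => [->|_] //.
exact: perm_to_rem.
Qed.

Lemma ssum_perm F s t : perm_inv F -> perm_eq s t -> ssum s F = ssum t F.
Proof.
move=> Fp st; rewrite /ssum (perm_big t st) /=; apply: eq_big_seq => v vt.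
apply: Fp; rewrite -(perm_cons v) -(permPl (perm_to_rem _)) ?(perm_mem st) //.
exact/(perm_trans st)/perm_to_rem.
Qed.

Lemma ssum_ext s F G : (forall v r, size s = (size r).+1 -> F v r = G v r) ->
  ssum s F = ssum s G.
Proof.
move=> FG; apply: eq_big_seq => v vs; apply: FG.
by rewrite size_rem // prednK //; case: s vs.
Qed.

Lemma ssumD s F G : ssum s (fun v r => F v r + G v r) = ssum s F + ssum s G.
Proof. exact: big_split. Qed.

Lemma ssum_eq0 s F : (forall v r, size s = (size r).+1 -> F v r = 0) -> ssum s F = 0.
Proof. by move=> F0; rewrite (@ssum_ext _ _ (fun _ _ => 0)) // /ssum big1. Qed.

Lemma ssum_xch s (G : V -> V -> seq V -> W) : (forall v, perm_inv (G v)) ->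
  ssum s (fun v r => ssum r (G v)) = ssum s (fun v r => ssum r (G^~ v)).
Proof.
have sG (H : V -> V -> seq V -> W) : (forall v, perm_inv (H v)) ->
    perm_inv (fun v r => ssum r (H v)).
  by move=> Hp v r r' rr; apply: ssum_perm.
elim: s G => [|x s IH] G Gp; first by rewrite /ssum !big_nil.
have Gp' v : perm_inv (G^~ v) by move=> w r r' rr; apply: Gp.
rewrite !ssum_cons; try exact: sG.
transitivity (ssum s (G x) + (ssum s (G^~ x)
    + ssum s (fun v r => ssum r (fun w q => G v w (x :: q))))).
  congr (_ + _); rewrite -ssumD; apply: ssum_ext => v r _.
  by rewrite ssum_cons.
rewrite addrCA IH; last by move=> v w r r' rr; apply: Gp; rewrite perm_cons.
congr (_ + _); rewrite -ssumD; apply: ssum_ext => v r _.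
by rewrite ssum_cons.
Qed.
End UnorderedSums.

Lemma ssumZ (k : pzRingType) (V : choiceType) (W : lmodType k) s c (F : V -> seq V -> W) :
  ssum s (fun v r => c *: F v r) = c *: ssum s F.
Proof. by rewrite /ssum scaler_sumr. Qed.

(** * The module of formal power series functions *)

Section FormalFunctions.
Variables (k : fieldType) (L : preLieAlg k) (E : preLieMod L).
Implicit Types (s t r : seq L) (a b u v w : L).

Definition symml (phi : seq L -> E) :=
  (forall s t, perm_eq s t -> phi s = phi t) /\
  (forall s, linear (fun u => phi (u :: s))).

Fact symml0 : symml 0.
Proof. by split=> // s c u v; rewrite -[RHS]/(c *: 0 + 0 : E) scaler0 addr0. Qed.
Fact symmlP c phi psi : symml phi -> symml psi -> symml (c *: phi + psi).
Proof.
move=> [ps pl] [qs ql]; split=> [s t st|s d u v].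
  by rewrite -[LHS]/(c *: phi s + psi s) (ps s t) // (qs s t).
rewrite -[LHS]/(c *: phi _ + psi _) pl ql.
rewrite -[RHS]/(d *: (c *: phi _ + psi _) + (c *: phi _ + psi _)).
by rewrite !scalerDr !scalerA addrACA mulrC.
Qed.

(* Formal power series functions on L with values in E, given by their
   symmetric Taylor coefficients at the origin. *)
Definition ffun_carrier : lmodType k := submod_type (Submod symml0 symmlP).
Local Notation J := ffun_carrier.
Implicit Types phi psi : J.

Definition jmk (phi : seq L -> E) (p : symml phi) : J :=
  @SubmodElt _ _ (Submod symml0 symmlP) phi (asboolT p).
Definition jval phi : seq L -> E := smval phi.

Lemma jvalP phi : symml (jval phi).
Proof. by apply/asboolP; exact: (smvalP phi). Qed.
Lemma jext phi psi : (forall s, jval phi s = jval psi s) -> phi = psi.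
Proof. by move=> pp; apply/val_inj/funext. Qed.
Lemma jval_perm phi s t : perm_eq s t -> jval phi s = jval phi t.
Proof. exact: (jvalP phi).1. Qed.
Lemma jval_linear phi s : linear (fun u => jval phi (u :: s)).
Proof. exact: (jvalP phi).2. Qed.
Lemma jval_swap phi u v s : jval phi [:: u, v & s] = jval phi [:: v, u & s].
Proof. by apply: jval_perm; rewrite -!(cat1s _ (_ :: _)) -!(cat1s _ s) perm_catCA. Qed.
Lemma jval_linear2 phi w s : linear (fun u => jval phi [:: w, u & s]).
Proof. by move=> c u v; rewrite !(jval_swap _ w) jval_linear. Qed.

(* Transpose of the multiplication of the symmetric algebra by b corrected by
   the derivation extending v |-> v <| b. *)
Definition jshift b (phi : seq L -> E) s : E :=
  phi (b :: s) + ssum s (fun v r => phi (plmul v b :: r)).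

Lemma perm_inv_shift b phi : perm_inv (fun v r => jval phi (plmul v b :: r)).
Proof. by move=> v r r' rr; apply: jval_perm; rewrite perm_cons. Qed.

Lemma jshift_symml b phi : symml (jshift b (jval phi)).
Proof.
split=> [s t st|s c u v]; rewrite /jshift.
  congr (_ + _); first by apply: jval_perm; rewrite perm_cons.
  by apply: ssum_perm => //; apply: perm_inv_shift.
rewrite !ssum_cons; try exact: perm_inv_shift.
rewrite jval_linear2 plmulPl jval_linear.
have -> : ssum s (fun w r => jval phi [:: plmul w b, c *: u + v & r]) =
    c *: ssum s (fun w r => jval phi [:: plmul w b, u & r]) +
    ssum s (fun w r => jval phi [:: plmul w b, v & r]).
  by rewrite -ssumZ -ssumD; apply: ssum_ext => w r _; rewrite jval_linear2.
by rewrite !scalerDr [LHS](AC (2*(2*2)) ((1*3*5)*(2*4*6))) /= !addrA.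
Qed.
Definition jsh b phi : J := jmk (jshift_symml b phi).

Lemma jpost_symml (h : E -> E) phi : linear h -> symml (fun s => h (jval phi s)).
Proof.
move=> hl; split=> [s t st|s c u v] /=; first by rewrite (jval_perm _ st).
by rewrite jval_linear hl.
Qed.
Definition jl a phi : J := jmk (jpost_symml phi (@lactP _ _ E a)).
Definition jr phi b : J := jmk (jpost_symml phi (@ractPl _ _ E b)) - jsh b phi.

Lemma jlE a phi s : jval (jl a phi) s = lact a (jval phi s). Proof. by []. Qed.
Lemma jrE phi b s : jval (jr phi b) s =
  ract (jval phi s) b - (jval phi (b :: s) + ssum s (fun v r => jval phi (plmul v b :: r))).
Proof. by []. Qed.

Lemma jevB s phi psi : jval (phi - psi) s = jval phi s - jval psi s.
Proof. by []. Qed.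
Lemma jevP c s phi psi : jval (c *: phi + psi) s = c *: jval phi s + jval psi s.
Proof. by []. Qed.

Lemma jshP b c phi psi : jsh b (c *: phi + psi) = c *: jsh b phi + jsh b psi.
Proof.
apply: jext => s; rewrite jevP -![jval (jsh _ _) _]/(_ + ssum s _) jevP.
rewrite scalerDr addrACA -ssumZ -ssumD; congr (_ + _).
Qed.

Lemma jsh_linear phi : linear (jsh^~ phi).
Proof.
move=> c b b'; apply: jext => s; rewrite jevP -![jval (jsh _ _) _]/(_ + ssum s _).
rewrite jval_linear scalerDr addrACA -ssumZ -ssumD; congr (_ + _).
by apply: ssum_ext => v r _; rewrite plmulP jval_linear.
Qed.

Fact jl_bilinear : bilinear_map jl.
Proof.
split=> [a|phi] c x y; apply: jext => s; rewrite jevP !jlE.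
  by rewrite jevP lactP.
by rewrite lactPl.
Qed.
Fact jr_bilinear : bilinear_map jr.
Proof.
split=> [phi|b] c x y.
  rewrite /jr jsh_linear scalerBr opprD addrACA; congr (_ + _).
  by apply: jext => s; apply: ractP.
rewrite /jr jshP scalerBr opprD addrACA; congr (_ + _).
by apply: jext => s; apply: ractPl.
Qed.

Lemma ract_ssum (s : seq L) b (F : L -> seq L -> E) :
  ract (ssum s F) b = ssum s (fun v r => ract (F v r) b).
Proof.
have rD : {morph (fun e : E => ract e b) : x y / x + y}.
  by move=> x y; have := ractPl b 1 x y; rewrite !scale1r.
exact: (big_morph (fun e : E => ract e b) rD (ract0 E b)).
Qed.

(** In the expansion [E1] every term is symmetric in the two letters up to reordering, except the
    sum with two products inside one letter; that one is symmetric by right symmetry of [L]. *)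
Lemma jsh_jsh phi a b : jsh b (jsh a phi) + jsh (plmul a b) phi
  = jsh a (jsh b phi) + jsh (plmul b a) phi.
Proof.
apply: jext => s.
have E1 x y : jval (jsh x (jsh y phi) + jsh (plmul y x) phi) s =
   jval phi [:: y, x & s] + (jval phi (plmul x y :: s) + jval phi (plmul y x :: s))
   + (ssum s (fun v r => jval phi [:: plmul v y, x & r])
      + ssum s (fun v r => jval phi [:: plmul v x, y & r]))
   + ssum s (fun v r => jval phi (plmul (plmul v x) y :: r)
                        + jval phi (plmul v (plmul y x) :: r))
   + ssum s (fun v r => ssum r (fun w q => jval phi [:: plmul w y, plmul v x & q])).
  rewrite -[LHS]/(jshift x (jshift y (jval phi)) s + jshift (plmul y x) (jval phi) s).
  rewrite /jshift ssum_cons; last exact: perm_inv_shift.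
  have -> : ssum s (fun v r => jval phi [:: y, plmul v x & r] +
     ssum (plmul v x :: r) (fun w q => jval phi (plmul w y :: q))) =
     ssum s (fun v r => jval phi [:: plmul v x, y & r]) +
     (ssum s (fun v r => jval phi (plmul (plmul v x) y :: r)) +
     ssum s (fun v r => ssum r (fun w q => jval phi [:: plmul w y, plmul v x & q]))).
    rewrite -!ssumD; apply: ssum_ext => v r _.
    by rewrite ssum_cons ?(jval_swap _ y) //; apply: perm_inv_shift.
  rewrite ssumD.
  by rewrite [LHS](AC ((1*2*(1*2))*2) (1*(2*7)*(3*4)*(5*8)*6)) /=.
rewrite !E1 jval_swap; congr (_ + _ + _ + _ + _).
- by rewrite addrC.
- by rewrite addrC.
- apply: ssum_ext => v r _.
  have jD x y : jval phi (x :: r) + jval phi (y :: r) = jval phi ((x + y) :: r).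
    by have := jval_linear phi r 1 x y; rewrite !scale1r.
  rewrite !jD; congr (jval phi (_ :: r)).
  have := plmul_rsym v a b.
  by move/eqP; rewrite subr_eq addrAC eq_sym subr_eq => /eqP.
- rewrite ssum_xch; last by move=> v w r r' rr; apply: jval_perm; rewrite !perm_cons.
  by apply: ssum_ext => v r _; apply: ssum_ext => w q _; rewrite jval_swap.
Qed.

(** [E1] separates the action on values, governed by [ract_ract] in [E], the mixed terms, symmetric
    in the two letters, and the shifts, governed by [jsh_jsh]. *)
Lemma jrr phi a b :
  jr (jr phi a) b - jr phi (plmul a b) = jr (jr phi b) a - jr phi (plmul b a).
Proof.
have E1 x y : jr (jr phi x) y - jr phi (plmul x y) =
    jmk (jpost_symml (jmk (jpost_symml phi (@ractPl _ _ E x))) (@ractPl _ _ E y))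
    - jmk (jpost_symml phi (@ractPl _ _ E (plmul x y)))
    - (jmk (jpost_symml (jsh x phi) (@ractPl _ _ E y))
       + jmk (jpost_symml (jsh y phi) (@ractPl _ _ E x)))
    + (jsh y (jsh x phi) + jsh (plmul x y) phi).
  rewrite {1}/jr.
  have -> : jmk (jpost_symml (jr phi x) (@ractPl _ _ E y)) =
     jmk (jpost_symml (jmk (jpost_symml phi (@ractPl _ _ E x))) (@ractPl _ _ E y))
     - jmk (jpost_symml (jsh x phi) (@ractPl _ _ E y)).
    apply: jext => s; rewrite jevB -!/(jval (jmk _) s).
    have := ractPl y (-1) (jval (jsh x phi) s) (ract (jval phi s) x).
    by rewrite !scaleN1r ![- _ + _]addrC.
  have -> : jsh y (jr phi x) = jmk (jpost_symml (jsh y phi) (@ractPl _ _ E x))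
      - jsh y (jsh x phi).
    rewrite /jr addrC -[- jsh x phi]scaleN1r jshP scaleN1r addrC; congr (_ - _).
    apply: jext => s.
    rewrite -[LHS]/(_ + ssum s _) -[RHS]/(ract (_ + ssum s _) x).
    have := ractPl x 1 (jval phi (y :: s)) (ssum s (fun v r => jval phi (plmul v y :: r))).
    by rewrite !scale1r => ->; rewrite ract_ssum.
  rewrite /jr !opprD !opprK.
  by rewrite [LHS](AC (2*2*2) (1*5*(2*3)*(4*6))) /=.
rewrite !E1 jsh_jsh; congr (_ - _ + _); last by rewrite addrC.
by apply: jext => s; apply: (@ract_ract _ _ E).
Qed.

(** [jl] acts on values alone and so commutes with the shift; what remains is [ract_lact] in [E]. *)
Lemma jrl phi a b :
  jr (jl a phi) b - jl a (jr phi b) = jl (plmul a b) phi - jl a (jl b phi).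
Proof.
apply: jext => s; rewrite !jevB !jlE !jrE -(@ract_lact _ _ E).
have lD e f : lact a (e - f) = lact a e - lact a f :> E.
  by have := @lactP _ _ E a (-1) f e; rewrite !scaleN1r ![- _ + _]addrC.
have lS x F : lact a (x + ssum s F) = lact a x + ssum s (fun v r => lact a (F v r)) :> E.
  have lA : {morph (fun e : E => lact a e) : x y / x + y}.
    by move=> y z; have := @lactP _ _ E a 1 y z; rewrite !scale1r.
  rewrite lA; congr (_ + _).
  exact: (big_morph (fun e : E => lact a e) lA (lact0 E a)).
rewrite lD lS opprB; exact: subrKA.
Qed.

Definition formal_functions : preLieMod L :=
  @PreLieMod k L J jl jr jl_bilinear jr_bilinear
    (sqzero_rsym_of_actions jl_bilinear jr_bilinear jrr jrl).

Definition jev s (phi : formal_functions) : E := jval phi s.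
Fact jev_linear s : linear (jev s). Proof. by []. Qed.
HB.instance Definition _ s :=
  GRing.isLinear.Build k formal_functions E *:%R (jev s) (jev_linear s).

Lemma jval_lact a (phi : formal_functions) s :
  jval (lact a phi : formal_functions) s = lact a (jval phi s).
Proof. by []. Qed.
Lemma jval_ract b (phi : formal_functions) s :
  jval (ract phi b : formal_functions) s = ract (jval phi s) b
    - (jval phi (b :: s) + ssum s (fun v r => jval phi (plmul v b :: r))).
Proof. by []. Qed.

Fact jconst_symml (e : E) : symml (fun s => if s is [::] then e else 0).
Proof.
split=> [s t /perm_size|s c u v]; first by case: s t => [|u s] [|v t].
by rewrite scaler0 addr0.
Qed.
Definition jconst (e : E) : formal_functions := jmk (jconst_symml e).

Lemma jconstE e s : jval (jconst e) s = if s is [::] then e else 0. Proof. by []. Qed.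

Fact jconst_linear : linear jconst.
Proof.
by move=> c e f; apply: jext => s; rewrite jevP !jconstE; case: s; rewrite ?scaler0 ?addr0.
Qed.
HB.instance Definition _ :=
  GRing.isLinear.Build k E formal_functions *:%R jconst jconst_linear.
Lemma jconst_inj : injective jconst.
Proof. by move=> e f /(congr1 (jev [::])). Qed.
Lemma jconst_lact a e : jconst (lact a e) = lact a (jconst e).
Proof.
apply: jext => s; rewrite -[RHS]/(lact a (jval (jconst e) s)) !jconstE.
by case: s => [|v s]; rewrite ?lact0.
Qed.
(** The shift evaluates a constant function only on nonempty sequences, so it kills constants. *)
Lemma jconst_ract a e : jconst (ract e a) = ract (jconst e) a.
Proof.
apply: jext => s; rewrite [RHS]jrE !jconstE.
have -> : ssum s (fun v r => jval (jconst e) (plmul v a :: r)) = 0 by apply: ssum_eq0.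
by case: s => [|v s]; rewrite ?ract0 addr0 subr0.
Qed.
End FormalFunctions.

Lemma psum_sum (k : fieldType) (V W : lmodType k) (I : Type) (t : seq V) (s : seq I)
    (G : V -> seq V -> I -> W) :
  psum t (fun b r => \sum_(v <- s) G b r v) = \sum_(v <- s) psum t (fun b r => G b r v).
Proof.
elim: s => [|v s IH].
  by under psum_ext do rewrite big_nil; rewrite big_nil psum0.
by under psum_ext do rewrite big_cons; rewrite big_cons psumD IH.
Qed.

(** * Cocycles become coboundaries in formal functions *)

Section Effacement.
Variables (k : fieldType) (L : preLieAlg k) (E : preLieMod L).
Hypothesis pchar0 : [pchar k] =i pred0.
Local Notation J := (formal_functions E).
Implicit Types (h e : {linear PLco L -> J}) (s t r : seq L) (a b u v w : L).

(** Vanishing at the origin to order [p]: the filtration along which the iteration converges. *)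
Definition vanish p h := forall x s, (size s < p)%N -> jval (h x) s = 0.

(** Apart from the derivative in the direction [b], all terms read coefficients of [h] of degree
    [size s], which vanish. What is left is minus the formal de Rham differential. *)
Lemma dcochain_symbol p h a t s : vanish p.+1 h -> (size s <= p)%N ->
  jval (dcochain h (cg a t)) s = - psum t (fun b r => jval (h (cg a r)) (b :: s)).
Proof.
move=> h0 sp; rewrite dcochainE jevB h0 // subr0.
rewrite -[LHS]/(jev s _) psum_lin -scaleN1r -psumZ; apply: psum_ext => b r _.
rewrite linearD [X in X + _](jval_ract b (h (cg a r)) s) [X in _ + X](jval_lact a (h (cg b r)) s).
rewrite !(h0 _ s) // ract0 lact0 addr0 sub0r scaleN1r.
rewrite ssum_eq0 ?addr0 // => v q sq; apply: h0.
by rewrite /= -sq ltnS.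
Qed.

(** The Poincare homotopy: contraction with the Euler vector field, divided by the sum of form
    degree and polynomial degree. In total degree zero the sum is empty and the value is 0. The sign
    matches [dcochain_symbol]. *)
Definition kval h a r s : E :=
  - ((size r + size s)%:R^-1 *: ssum s (fun v q => jval (h (cg a (v :: r))) q)).

Lemma perm_inv_kval h a r : perm_inv (fun v q => jval (h (cg a (v :: r))) q).
Proof. by move=> v q q' qq; apply: jval_perm. Qed.

Lemma kval_symml h a r : symml (kval h a r).
Proof.
split=> [s t st|s c u v]; rewrite /kval.
  rewrite (perm_size st); congr (- (_ *: _)).
  exact/(ssum_perm _ st)/perm_inv_kval.
rewrite !ssum_cons; try exact: perm_inv_kval.
rewrite ((cg_malt a).1 [::]) linearP jevP /=.
have -> : ssum s (fun w q => jval (h (cg a (w :: r))) (c *: u + v :: q)) =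
    c *: ssum s (fun w q => jval (h (cg a (w :: r))) (u :: q)) +
    ssum s (fun w q => jval (h (cg a (w :: r))) (v :: q)).
  by rewrite -ssumZ -ssumD; apply: ssum_ext => w q _; rewrite jval_linear.
rewrite addrACA -scalerDr [_^-1 *: (_ + _)]scalerDr opprD scalerN; congr (- _ + _).
by rewrite !scalerA mulrC.
Qed.

Fact khom_malt2 h : malt2 (fun a r => jmk (kval_symml h a r) : J).
Proof.
have kE a r s : jval (jmk (kval_symml h a r)) s = kval h a r s by [].
split=> [r c a b|a]; [|split=> [x c u v y|x u y]]; apply: jext => s.
- rewrite jevP !kE /kval.
  have -> : ssum s (fun w q => jval (h (cg (c *: a + b) (w :: r))) q) =
    c *: ssum s (fun w q => jval (h (cg a (w :: r))) q) +
    ssum s (fun w q => jval (h (cg b (w :: r))) q).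
    by rewrite -ssumZ -ssumD; apply: ssum_ext => w q _; rewrite cg_linear linearP.
  by rewrite scalerDr opprD scalerN !scalerA mulrC.
- rewrite jevP !kE /kval !size_cat /=.
  have -> : ssum s (fun w q => jval (h (cg a (w :: x ++ c *: u + v :: y))) q) =
    c *: ssum s (fun w q => jval (h (cg a (w :: x ++ u :: y))) q) +
    ssum s (fun w q => jval (h (cg a (w :: x ++ v :: y))) q).
    rewrite -ssumZ -ssumD; apply: ssum_ext => w q _.
    by rewrite -!cat_cons (cg_malt a).1 linearP.
  by rewrite scalerDr opprD scalerN !scalerA mulrC.
- rewrite kE /kval ssum_eq0 ?scaler0 ?oppr0 // => w q _.
  by rewrite -cat_cons (cg_malt a).2 linear0.
Qed.
Definition khom h : PLco L -> J := clift (khom_malt2 h).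
HB.instance Definition _ h := GRing.Linear.copy (khom h) (clift (khom_malt2 h)).

Lemma khomE h a r s : jval (khom h (cg a r)) s = kval h a r s.
Proof. by rewrite /khom cliftE. Qed.

(** The contraction moves one letter of [s] into the form, so it reads coefficients one degree
    lower. *)
Lemma vanish_khom p h : vanish p h -> vanish p.+1 (khom h).
Proof.
move=> h0 x s sp; apply: (PLco_linP (f := jev s \o khom h) (g := \0)) x => a r.
rewrite /= -[LHS]/(jval _ _) khomE /kval ssum_eq0 ?scaler0 ?oppr0 // => w q sq.
by apply: h0; rewrite sq ltnS in sp.
Qed.

(* Poincare lemma for the de Rham differential, which is the leading part of
   the differential with respect to the degree of Taylor coefficients. *)
Lemma khom_contraction p h a t s : vanish p h -> (forall x, dcochain h x = 0) ->
  (forall a, h (cg a [::]) = 0) -> (size s <= p)%N ->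
  jval (dcochain (khom h) (cg a t)) s = jval (h (cg a t)) s.
Proof.
move=> h0 hd hn sp; rewrite (dcochain_symbol _ _ (vanish_khom h0)) //.
case: t => [|u t']; first by rewrite hn /= oppr0.
move: (u :: t') (isT : 0 < size (u :: t'))%N => {t' u} t t0.
have [sp'|] := ltnP (size s) p.
  rewrite h0 // -[RHS]oppr0; congr (- _); rewrite -[RHS](psum0 _ t).
  apply: psum_ext => b r _; rewrite khomE /kval ssum_eq0 ?scaler0 ?oppr0 // => v q /= [sq].
  by apply: h0; rewrite -sq.
move=> ps; have {sp ps} sp : size s = p by apply/eqP; rewrite eqn_leq sp.
have nz : (size t + size s)%:R != 0 :> k.
  by have /pcharf0P-> := pchar0; rewrite addn_eq0 negb_and -lt0n t0.
apply: (scalerI nz).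
(* After multiplication by the total degree, the first summand will give [size t] copies of the
   right side and the second [size s] copies. *)
transitivity (psum t (fun b r => jval (h (cg a (b :: r))) s
    + ssum s (fun v q => jval (h (cg a (v :: r))) (b :: q)))).
  rewrite -[- psum _ _]scaleN1r scalerA -psumZ; apply: psum_ext => b r tr.
  rewrite khomE /kval /= ssum_cons; last exact: perm_inv_kval.
  by rewrite addnS -addSn -tr mulrN1 scaleNr scalerN opprK scalerA divff ?scale1r.
rewrite psumD natrD scalerDl; congr (_ + _).
  rewrite (psum_malt (G := fun r => jval (h (cg a r)) s)) //.
  exact/(malt_comp (jev s \o h))/cg_malt.
rewrite psum_sum scaler_nat.
transitivity (\sum_(v <- s) jval (h (cg a t)) s); last first.
  by rewrite big_const_seq count_predT iter_addr addr0.
apply: eq_big_seq => v vs; rewrite (jval_perm (h (cg a t)) (perm_to_rem vs)).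
have qs : size s = (size (rem v s)).+1.
  by rewrite size_rem // prednK // -has_predT; apply/hasP; exists v.
(* Closedness of [h] on [v :: t], one degree lower, turns the sum over [t] into the coefficient of
   [h (cg a t)] at [v :: rem v s]. *)
have hp : vanish (size (rem v s)).+1 h by rewrite -qs sp.
have /eqP : jval (dcochain h (cg a (v :: t))) (rem v s) = 0 by rewrite hd.
by rewrite (dcochain_symbol _ _ hp) //= oppr_eq0 subr_eq0 => /eqP->.
Qed.

Variable c : {linear PLco L -> E}.
Hypotheses (c_nil : forall a, c (cg a [::]) = 0) (c_cocycle : forall x, dcochain c x = 0).

Lemma dcochain_jconst x :
  dcochain (@jconst k L E \o c : {linear PLco L -> J}) x = jconst (dcochain c x).
Proof.
apply: (PLco_linP (f := dcochain (@jconst k L E \o c)) (g := @jconst k L E \o dcochain c)) => a s.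
rewrite /= !dcochainE linearB psum_lin; congr (_ - _).
apply: psum_ext => b r _; rewrite linearD.
by congr (_ + _); apply/esym; [exact: jconst_ract|exact: jconst_lact].
Qed.

(** Each stage adds the contraction of the current error, as in the Poincare lemma. *)
Fixpoint approx p : {linear PLco L -> J} :=
  if p is p'.+1 then
    approx p' \+ khom ((@jconst k L E \o c) \- dcochain (approx p'))
  else \0.

Definition resid p : {linear PLco L -> J} := (@jconst k L E \o c) \- dcochain (approx p).

Lemma resid_cocycle p x : dcochain (resid p) x = 0.
Proof.
rewrite (@dcochainP _ _ _ (-1) (dcochain (approx p)) (@jconst k L E \o c)) => [|y].
  by rewrite dcochain_square // dcochain_jconst c_cocycle scaler0 add0r linear0.
by rewrite /= scaleN1r addrC.
Qed.

Lemma resid_nil p a : resid p (cg a [::]) = 0.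
Proof. by rewrite /= c_nil dcochain_nil linear0 subr0. Qed.

Lemma residS p x : resid p.+1 x = resid p x - dcochain (khom (resid p)) x.
Proof.
rewrite /= (@dcochainP _ _ _ 1 (approx p) (khom (resid p))) => [|y] /=.
  by rewrite scale1r opprD addrA.
by rewrite scale1r.
Qed.

(** By the Poincare lemma, subtracting the differential of the contracted error clears its
    coefficients of degree [p]. The error stays closed and zero in weight 0, so the lemma applies
    again. *)
Lemma vanish_resid p : vanish p (resid p).
Proof.
elim: p => [|p IH] x s //; rewrite ltnS => sp.
apply: (PLco_linP (f := jev s \o resid p.+1) (g := \0)) x => a t.
rewrite -[LHS]/(jval (resid p.+1 (cg a t)) s) residS jevB (khom_contraction _ _ IH) ?subrr //.
- exact: resid_cocycle.
- exact: resid_nil.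
Qed.

(** The correction added to stage [q] vanishes to order q + 1, so coefficients of degree at most [p]
    are final from stage [p] on. *)
Lemma approx_stable p q x s : (size s <= p)%N -> (p <= q)%N ->
  jval (approx q x) s = jval (approx p x) s.
Proof.
move=> sp; elim: q => [|q IH]; first by rewrite leqn0 => /eqP->.
rewrite leq_eqVlt => /orP[/eqP->//|]; rewrite ltnS => pq.
rewrite -IH // -[LHS]/(jval (approx q x) s + jval (khom (resid q) x) s).
by rewrite (vanish_khom (@vanish_resid q)) ?addr0 // ltnS (leq_trans sp).
Qed.

Fact limit_symml x : symml (fun s => jval (approx (size s) x) s).
Proof.
split=> [s t st|s d u v]; first by rewrite (perm_size st) (jval_perm _ st).
exact: jval_linear.
Qed.
(** The limit of the stages: the coefficient at [s] is read at stage [size s], where it is already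
    final. *)
Definition climit x : J := jmk (limit_symml x).
Fact climit_linear : linear climit.
Proof.
by move=> d x y; apply: jext => s; rewrite jevP -![jval (climit _) s]/(jval (approx _ _) _) linearP.
Qed.
HB.instance Definition _ := GRing.isLinear.Build k (PLco L) J *:%R climit climit_linear.

Lemma dcochain_climit x : dcochain climit x = jconst (c x).
Proof.
apply: jext => s; move: x; suff H a t :
    jval (dcochain climit (cg a t)) s = jval (jconst (c (cg a t))) s.
  exact: (PLco_linP (f := jev s \o dcochain climit) (g := jev s \o (@jconst k L E \o c))).
set p := size s.
have := vanish_resid (p := p.+1) (cg a t) (ltnSn p).
rewrite -[jval (resid _ _) _]/(jval (jconst (c (cg a t))) s
  - jval (dcochain (approx p.+1) (cg a t)) s).
move/eqP; rewrite subr_eq0 => /eqP->; apply/eqP; rewrite -subr_eq0; apply/eqP.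
pose h : {linear PLco L -> J} := climit \- approx p.+1.
(* Order p + 2 is required because the derivative term reads coefficients at [b :: s], of degree p +
   1. *)
have h0 : vanish p.+2 h.
  move=> y q qp; rewrite -[LHS]/(jval (approx (size q) y) q - jval (approx p.+1 y) q).
  by rewrite (@approx_stable (size q) p.+1) ?subrr.
have := dcochain_symbol a t h0 (leqnSn p).
have -> : psum t (fun b r => jval (h (cg a r)) (b :: s)) = 0.
  by rewrite -[RHS](psum0 _ t); apply: psum_ext => b r _; rewrite h0 //= ltnS.
rewrite oppr0 => <-.
rewrite (@dcochainP _ _ _ (-1) (approx p.+1) climit h) => [|y]; last first.
  by rewrite -[LHS]/(climit y - approx p.+1 y) scaleN1r addrC.
by rewrite scaleN1r addrC.
Qed.

End Effacement.

Lemma cochain_effaceable (k : fieldType) (L : preLieAlg k) (E : preLieMod L)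
    (c : {linear PLco L -> E}) : [pchar k] =i pred0 ->
  (forall a, c (cg a [::]) = 0) -> (forall x, dcochain c x = 0) ->
  exists h : {linear PLco L -> formal_functions E}, forall x, dcochain h x = jconst (c x).
Proof. by move=> pchar0 cn cd; exists (climit c); apply: dcochain_climit. Qed.

(** * Modules over the enveloping algebra and the complex of free modules *)

Section EnvelopeModules.
Variables (k : fieldType) (L : preLieAlg k).
Local Notation U := (UPreLie L).

Lemma alg_comm (A : algType k) c (x : A) : x * c%:A = c%:A * x.
Proof. by rewrite -scalerAr mulr1 -scalerAl mul1r. Qed.

Lemma alg_mul (A : algType k) c (x : A) : c%:A * x = c *: x.
Proof. by rewrite -scalerAl mul1r. Qed.

(** The scalars and the symbols [ul a], [ur a] generate the enveloping algebra, so induction on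
    terms suffices. *)
Lemma envelope_linear (N N' : lmodType U) (f : N -> N') :
  {morph f : x y / x + y} -> (forall c x, f (c%:A *: x) = c%:A *: f x) ->
  (forall a x, f (ul a *: x) = ul a *: f x) ->
  (forall a x, f (ur a *: x) = ur a *: f x) -> linear f.
Proof.
move=> fD fZ fl fr.
suff fU u x : f (u *: x) = u *: f x by move=> u x y; rewrite fD fU.
elim/upi_ind: u => t; elim: t x => [a|a|c|s IHs t IHt|s IHs t IHt] x.
- exact: fl.
- exact: fr.
- by rewrite upi_cst fZ.
- by rewrite upiD !scalerDl fD IHs IHt.
- by rewrite upiM -!scalerA IHs IHt.
Qed.

Section Restriction.
Variable N : lmodType U.
Definition res_l (a : L) (e : res_scalars N) : res_scalars N := ul a *: (e : N).
Definition res_r (e : res_scalars N) (a : L) : res_scalars N := ur a *: (e : N).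

Fact res_l_bilinear : bilinear_map res_l.
Proof.
split=> [a|e] c x y; rewrite /res_l.
  by rewrite -[LHS]/(ul a *: (c%:A *: (x : N) + (y : N))) scalerDr scalerA alg_comm -scalerA.
by rewrite ul_linear scalerDl -alg_mul -scalerA.
Qed.
Fact res_r_bilinear : bilinear_map res_r.
Proof.
split=> [e|a] c x y; rewrite /res_r.
  by rewrite ur_linear scalerDl -alg_mul -scalerA.
by rewrite -[LHS]/(ur a *: (c%:A *: (x : N) + (y : N))) scalerDr scalerA alg_comm -scalerA.
Qed.
Fact res_r_r e a b :
  res_r (res_r e a) b - res_r e (plmul a b) = res_r (res_r e b) a - res_r e (plmul b a).
Proof. by rewrite /res_r !scalerA -[LHS]scalerBl ur_ur scalerBl. Qed.
Fact res_r_l e a b :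
  res_r (res_l a e) b - res_l a (res_r e b) = res_l (plmul a b) e - res_l a (res_l b e).
Proof. by rewrite /res_r /res_l !scalerA -[LHS]scalerBl ur_ul scalerBl. Qed.

(** The passage opposite to [umod]: the defining relations [ur_ur] and [ur_ul] become the module
    axioms. *)
Definition ures : preLieMod L := @PreLieMod k L (res_scalars N) res_l res_r
  res_l_bilinear res_r_bilinear
  (sqzero_rsym_of_actions res_l_bilinear res_r_bilinear res_r_r res_r_l).
End Restriction.

Section RestrictMaps.
Variables (N N' : lmodType U) (E : preLieMod L).
Definition kres (f : {linear N -> umod E}) : ures N -> E := f.
Fact kres_linear f : linear (kres f).
Proof.
move=> c x y; rewrite /kres -[LHS]/(f (c%:A *: (x : N) + (y : N))) linearP.
by rewrite ucst_act.
Qed.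
HB.instance Definition _ f := GRing.isLinear.Build k (ures N) E *:%R (kres f) (kres_linear f).

Definition kresr (f : {linear N -> N'}) : ures N -> ures N' := f.
Fact kresr_linear f : linear (kresr f).
Proof. by move=> c x y; rewrite /kresr -[LHS]/(f (c%:A *: (x : N) + (y : N))) linearP. Qed.
HB.instance Definition _ f :=
  GRing.isLinear.Build k (ures N) (ures N') *:%R (kresr f) (kresr_linear f).
End RestrictMaps.

Lemma dcochain_nat (M M' : preLieMod L) (F : {linear M -> M'})
    (f : {linear PLco L -> M}) (g : {linear PLco L -> M'}) :
  (forall a e, F (lact a e) = lact a (F e)) ->
  (forall a e, F (ract e a) = ract (F e) a) ->
  (forall x, F (f x) = g x) -> forall x, F (dcochain f x) = dcochain g x.
Proof.
move=> Fl Fr Ff; apply: (PLco_linP (f := F \o dcochain f) (g := dcochain g)) => a s.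
rewrite /= !dcochainE linearB psum_lin Ff; congr (_ - _).
by apply: psum_ext => b r _; rewrite linearD Fl Fr !Ff.
Qed.

(** The generators range over all of [PLco L]; [q_proj] cuts them down to the weight n summand. *)
Inductive qrel (n : nat) : mterm U (PLco L) -> mterm U (PLco L) -> Prop :=
| q_lin c x y : qrel n (MGen U (c *: x + y)) (MAdd (MScale c%:A (MGen U x)) (MGen U y))
| q_proj x : qrel n (MGen U x) (MGen U (cproj n x)).

(* The free U-module on the space of alternating tensors L (x) Lambda^n L. *)
Definition Qmod n : lmodType U := presmod (qrel n).
Definition qgen n (x : PLco L) : Qmod n := pmgen (qrel n) x.

Lemma qgenP n c x y : qgen n (c *: x + y) = c%:A *: qgen n x + qgen n y.
Proof. by rewrite -pmpiZ -pmpiD; apply/presmod_rel/q_lin. Qed.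
Lemma qgen_proj n x : qgen n (cproj n x) = qgen n x.
Proof. by apply/esym/presmod_rel/q_proj. Qed.

Definition qun n (x : PLco L) : ures (Qmod n) := qgen n x.
Fact qun_linear n : linear (qun n). Proof. exact: qgenP. Qed.
HB.instance Definition _ n :=
  GRing.isLinear.Build k (PLco L) (ures (Qmod n)) *:%R (qun n) (qun_linear n).

Section Extension.
Variables (n : nat) (N : lmodType U) (g : PLco L -> N).
Hypothesis gP : forall c x y, g (c *: x + y) = c%:A *: g x + g y.
Hypothesis gn : forall x, g (cproj n x) = g x.
Fact qlift_respect : mrespect (qrel n) g.
Proof. by move=> s t [c x y|x] /=; [exact: gP|rewrite gn]. Qed.
Definition qlift : {linear Qmod n -> N} := mlift qlift_respect.
Lemma qliftE x : qlift (qgen n x) = g x. Proof. exact: mliftE. Qed.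
End Extension.

Lemma qun_homog n : homog_cochain n (qun n).
Proof. exact: qgen_proj. Qed.

(** The differential of the tautological cochain [qun n], extended to a map of [U]-modules. *)
Definition qd n : {linear Qmod n.+1 -> Qmod n} :=
  qlift (dcochain_linear (qun n)) (homog_dcochain (@qun_homog n)).
Lemma qdE n x : qd n (qgen n.+1 x) = dcochain (qun n) x. Proof. exact: qliftE. Qed.

(** Every homogeneous cochain is the image of the tautological one under a [U]-linear map, so
    precomposition with [qd] is the cochain differential. *)
Lemma qd_nat n (E : preLieMod L) (f : {linear Qmod n -> umod E}) (g : {linear PLco L -> E}) :
  (forall x, f (qgen n x) = g x) -> forall x, f (qd n (qgen n.+1 x)) = dcochain g x.
Proof.
move=> fg x; rewrite qdE.
apply: (dcochain_nat (F := kres f) (f := qun n) (g := g)) => //.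
  by move=> a e; rewrite /= -[LHS]/(f (ul a *: (e : Qmod n))) linearZ; apply: ul_act.
by move=> a e; rewrite /= -[LHS]/(f (ur a *: (e : Qmod n))) linearZ; apply: ur_act.
Qed.

Lemma qd_natr n (N : lmodType U) (f : {linear Qmod n -> N}) (g : {linear PLco L -> ures N}) :
  (forall x, f (qgen n x) = g x) -> forall x, f (qd n (qgen n.+1 x)) = dcochain g x.
Proof.
move=> fg x; rewrite qdE.
apply: (dcochain_nat (F := kresr f) (f := qun n) (g := g)) => // a e /=.
  by rewrite -[LHS]/(f (ul a *: (e : Qmod n))) linearZ.
by rewrite -[LHS]/(f (ur a *: (e : Qmod n))) linearZ.
Qed.

Fact aug_linear c (x y : PLco L) :
  omega_d (ccog (c *: x + y)) = c%:A *: omega_d (ccog x) + omega_d (ccog y).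
Proof. by rewrite linearP omega_d_linear. Qed.
Fact aug_proj (x : PLco L) : omega_d (ccog (cproj 0 x)) = omega_d (ccog x).
Proof. by rewrite ccog_proj. Qed.
Definition qaug : {linear Qmod 0 -> Omega L} := qlift aug_linear aug_proj.
Lemma qaugE x : qaug (qgen 0 x) = omega_d (ccog x). Proof. exact: qliftE. Qed.
End EnvelopeModules.

Section ImageSubmodule.
Variables (R : pzRingType) (M N : lmodType R) (f : {linear M -> N}).
Let P y := exists x, y = f x.
Fact immod0 : P 0. Proof. by exists 0; rewrite linear0. Qed.
Fact immodP c x y : P x -> P y -> P (c *: x + y).
Proof. by move=> [x' ->] [y' ->]; exists (c *: x' + y'); rewrite linearP. Qed.
Definition immod : submod N := Submod immod0 immodP.

Lemma immod_pi y : qmpi immod y = 0 <-> P y.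
Proof. by rewrite -(linear0 (qmpi immod)) qmpiP subr0. Qed.
End ImageSubmodule.

(** * Exactness of the augmented complex *)

Section Exactness.
Variables (k : fieldType) (L : preLieAlg k).
Hypothesis pchar0 : [pchar k] =i pred0.
Local Notation U := (UPreLie L).

Lemma qmod_linP n (N : lmodType U) (f g : {linear Qmod L n -> N}) :
  (forall x, f (qgen n x) = g (qgen n x)) -> f =1 g.
Proof. exact: presmod_linP. Qed.

Lemma qd_square n y : qd L n (qd L n.+1 y) = 0.
Proof.
apply: (qmod_linP (f := qd L n \o qd L n.+1) (g := \0)) y => x.
rewrite [LHS](qd_natr (g := dcochain (qun n))) ?dcochain_square // => z.
exact: qdE.
Qed.

Definition daug (x : PLco L) : ures (Omega L) := omega_d (ccog x).
Fact daug_linear : linear daug. Proof. exact: aug_linear. Qed.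
HB.instance Definition _ :=
  GRing.isLinear.Build k (PLco L) (ures (Omega L)) *:%R daug daug_linear.

Lemma omega_d0 : omega_d (0 : L) = 0.
Proof.
have /eqP := omega_d_linear 1 0 (0 : L).
by rewrite !scale1r addr0 eq_sym -subr_eq0 addrK => /eqP.
Qed.
Lemma daug_cg a s : daug (cg a s) = if s is [::] then omega_d a else 0.
Proof. by rewrite /daug ccogE; case: s => //; rewrite omega_d0. Qed.
Lemma daug_plcoder x : daug (plcoder x) = omega_d (plcor x).
Proof. by rewrite /daug ccog_plcoder. Qed.

(** By naturality the composite is the differential of [daug]. It vanishes in weight 1 by the
    Leibniz rule, and in other weights because [daug] and [plcor] live in weights 0 and 1. *)
Lemma qaug_d y : qaug L (qd L 0 y) = 0.
Proof.
apply: (qmod_linP (f := qaug L \o qd L 0) (g := \0)) y => x.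
rewrite [LHS](qd_natr (g := daug)) => [|z]; last exact: qaugE.
apply: (PLco_linP (f := dcochain daug) (g := \0)) x => a s.
rewrite [LHS]dcochainE /= daug_plcoder plcorE.
case: s => [|b [|b' s]].
- by rewrite omega_d0 subr0.
- rewrite omega_d_leibniz -[RHS](subrr (ur b *: omega_d a + ul a *: omega_d b)) /=.
  by rewrite subr0 -![daug _]/(daug _) !daug_cg.
rewrite omega_d0 subr0; transitivity (@psum k L (ures (Omega L)) [:: b, b' & s] (fun _ _ => 0)).
  apply: (@psum_ext k L (ures (Omega L))) => c [|d r] // _.
  by rewrite !daug_cg [res_r _ _](ract0 (ures (Omega L))) [res_l _ _](lact0 (ures (Omega L))) addr0.
by rewrite psum0.
Qed.

Lemma qaug_surj (w : Omega L) : exists y, qaug L y = w.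
Proof.
elim/presmod_ind: w => [a||x y [x' <-] [y' <-]|u x [x' <-]].
- by exists (qgen 0 (cg a [::])); rewrite qaugE ccogE.
- by exists 0; rewrite linear0.
- by exists (x' + y'); rewrite linearD.
- by exists (u *: x'); rewrite linearZ.
Qed.

(** Sending [omega_d a] to the class of [cg a [::]] defines a map from [Omega L] to the cokernel of
    [qd L 0]. Its composite with [qaug L] is the projection, so kernel elements have zero class. *)
Lemma qaug_exact y : qaug L y = 0 -> exists z, y = qd L 0 z.
Proof.
pose W := immod (qd L 0).
have gr : mrespect (@omega_rel k L) (fun a => qmpi W (qgen 0 (cg a [::]))).
  move=> s t [c a b|a b] /=.
    by rewrite cg_linear qgenP linearP.
  rewrite -!linearZ -linearD; apply/qmpiP.
  (* The Leibniz relation holds modulo the boundary of the generator on [cg a [:: b]]. *)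
  exists (- qgen 1 (cg a [:: b])); rewrite linearN qdE dcochainE /= subr0 opprB.
  by rewrite plcoder_single.
move=> y0; apply/immod_pi.
have : mlift gr (qaug L y) = qmpi W y.
  apply: (qmod_linP (f := mlift gr \o qaug L) (g := qmpi W)) => x /=.
  rewrite qaugE [LHS](mliftE gr) -cproj_ccog qgen_proj.
  by [].
by rewrite y0 linear0 => <-.
Qed.

Lemma jconst_envelope (N : lmodType U) :
  linear (fun e : N => jconst (e : ures N) : umod (formal_functions (ures N))).
Proof.
apply: envelope_linear.
- by move=> x y; apply: (linearD (@jconst k L (ures N))).
- move=> c x; rewrite ucst_act; exact: (linearZ_LR (@jconst k L (ures N)) c x).
- by move=> a x; rewrite ul_act -jconst_lact.
- by move=> a x; rewrite ur_act -jconst_ract.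
Qed.

Lemma qd_exact n y : qd L n y = 0 -> exists z, y = qd L n.+1 z.
Proof.
pose W := immod (qd L n.+1); pose N : lmodType U := quomod W.
(* The tautological cochain with values in the cokernel; it is a cocycle because its differential is
   the class of a boundary. *)
pose c : {linear PLco L -> ures N} := kresr (qmpi W) \o qun n.+1.
have cE x : c x = qmpi W (qgen n.+1 x) by [].
have c_nil a : c (cg a [::]) = 0.
  rewrite cE -qgen_proj cprojE /= scale0r -[qgen _ _]/(qun _ _).
  by rewrite linear0 linear0.
have c_cocycle x : dcochain c x = 0.
  rewrite -(qd_natr (f := qmpi W)) //; apply/immod_pi.
  by exists (qgen n.+2 x).
have [h hc] := cochain_effaceable pchar0 c_nil c_cocycle.
(* Only the weight n part of [h] enters its differential in weight n + 1, and truncating lets [h]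
   extend to a [U]-linear map on [Qmod L n]. *)
pose h' : {linear PLco L -> formal_functions (ures N)} := h \o cproj n.
have h'P d x z : h' (d *: x + z) = d%:A *: (h' x : umod _) + (h' z : umod _) :> umod _.
  by rewrite linearP ucst_act.
have h'n x : h' (cproj n x) = h' x by rewrite /= cprojK.
move=> y0; apply/immod_pi; apply: (@jconst_inj _ _ (ures N)).
pose J := umod (formal_functions (ures N)).
pose i : {linear N -> J} := HB.pack (fun e : N => jconst (e : ures N) : J)
  (GRing.isLinear.Build U N J *:%R _ (@jconst_envelope N)).
(* The embedded class of [y] factors through [qd L n y], so it vanishes for a cycle [y]. *)
have : qlift (N := J) h'P h'n (qd L n y) = i (qmpi W y).
  apply: (qmod_linP (f := qlift (N := J) h'P h'n \o qd L n) (g := i \o qmpi W)) => x /=.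
  rewrite (qd_nat (g := h')) => [|z]; last exact: qliftE.
  rewrite (@dcochain_proj _ _ _ n h) // hc cE qgen_proj.
  by [].
rewrite y0 linear0 => <-.
by rewrite linear0.
Qed.
End Exactness.

(** * Lifting linear maps over a field *)

Section LinearLift.
Variables (k : fieldType) (V M N : lmodType k).
Variables (p : {linear M -> N}) (q : {linear V -> N}).
Hypothesis pq : forall v, exists m, p m = q v.

Let partial_lift : set (set (V * M)) := fun G =>
  [/\ forall c x y, G x -> G y -> G (c *: x + y),
      forall x, G x -> p x.2 = q x.1 & forall m, G (0, m) -> m = 0].

(** Zorn's lemma on graphs of partial lifts: a vector outside the domain of a maximal graph could be
    adjoined together with any preimage of its image. *)
Lemma linear_lift : exists f : {linear V -> M}, forall v, p (f v) = q v.
Proof.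
have [F FP Ftot|A [[AP Ap A0] Amax]] := @Zorn_bigcup _ partial_lift.
  split=> [c x y [X FX Xx] [Y FY Yy]|x [X FX Xx]|m [X FX Xm]].
  - have [XY|YX] := Ftot _ _ FX FY.
      by exists Y => //; have [YP _ _] := FP _ FY; apply: YP => //; apply: XY.
    by exists X => //; have [XP _ _] := FP _ FX; apply: XP => //; apply: YX.
  - by have [_ Xp _] := FP _ FX; apply: Xp.
  - by have [_ _ X0] := FP _ FX; apply: X0.
(* The empty set satisfies the conditions on a graph, so a maximal graph must be shown to be
   nonempty. *)
have A00 : A (0, 0).
  apply: contrapT => nA; have nA' x : ~ A x.
    by move=> Ax; apply: nA; have := AP (-1) _ _ Ax Ax; rewrite scaleN1r addNr.
  have sB : (A `<` [set (0, 0)])%classic.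
    by split=> [x /nA'//|sA]; apply: nA; apply: sA.
  apply: (Amax _ sB); split=> [c x y -> ->|x ->|m [//]].
    by rewrite scaler0 addr0.
  by rewrite !linear0.
have Atot v : exists m, A (v, m).
  apply: contrapT => nv; have [m pm] := pq v.
  pose B : set (V * M) := fun x => exists2 a, A a & exists c, x = a + c *: (v, m).
  have sB : (A `<` B)%classic.
    split=> [x Ax|sA]; first by exists x => //; exists 0; rewrite scale0r addr0.
    apply: nv; exists m; apply: sA; exists (0, 0) => //.
    by exists 1; rewrite scale1r add0r.
  apply: (Amax _ sB); split.
  - move=> c x y [a Aa [d ->]] [b Ab [e ->]]; exists (c *: a + b); first exact: AP.
    by exists (c * d + e); rewrite scalerDr scalerDl !scalerA addrACA.
  - move=> x [a Aa [c ->]] /=; rewrite linearD linearZ /= pm (Ap _ Aa).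
    by rewrite linearD linearZ.
  - move=> m' [[a1 a2] Aa [c]]; have [->|c0] := eqVneq c 0.
      by rewrite scale0r addr0 => e; apply: A0; rewrite e.
    (* A nonzero coefficient [c] would put [v] in the domain of [A] already. *)
    move=> [e1 _]; case: nv; exists (- c^-1 *: a2).
    have := AP (- c^-1) _ _ Aa A00; rewrite addr0.
    suff -> : - c^-1 *: (a1, a2) = (v, - c^-1 *: a2) by [].
    congr pair; apply: (scalerI c0); rewrite /= scalerA mulrN divff // scaleN1r.
    by apply/eqP; rewrite eq_sym -addr_eq0 addrC -e1.
have Auniq v m m' : A (v, m) -> A (v, m') -> m = m'.
  move=> Am Am'; apply: subr0_eq; apply: A0.
  have := AP (-1) _ _ Am' Am; suff -> : -1 *: (v, m') + (v, m) = (0, m - m') by [].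
  by rewrite scaleN1r addrC; congr pair; rewrite /= ?subrr.
have [f fA] := choice Atot.
have fl : linear f.
  by move=> c x y; apply: (Auniq (c *: x + y)) => //; apply: (AP c (x, f x) (y, f y)).
pose F : {linear V -> M} := HB.pack f (GRing.isLinear.Build k V M *:%R f fl).
by exists F => v; apply: (Ap _ (fA v)).
Qed.
End LinearLift.

(** * Projective modules and dependent choice *)

Definition projective (R : pzRingType) (P : lmodType R) :=
  forall (M N : lmodType R) (p : {linear M -> N}) (h : {linear P -> N}),
    (forall x, exists y, p y = h x) -> exists h' : {linear P -> M}, forall x, p (h' x) = h x.

Lemma freemod_projective (R : pzRingType) (X : Type) : projective (freemod R X).
Proof.
move=> M N p h /(fun H x => H (pmgen _ x)) /choice[f pf].
have fr : @mrespect R X (fun _ _ => False) M f by [].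
exists (mlift fr) => x; apply: (presmod_linP (f := p \o mlift fr) (g := h)) => y.
by rewrite /= (mliftE fr) pf.
Qed.

(** [Qmod L n] is free on a vector space, so a lift over [k] on generators suffices; composing it
    with [cproj n] makes it respect [qrel]. *)
Lemma Qmod_projective (k : fieldType) (L : preLieAlg k) n : projective (Qmod L n).
Proof.
move=> M N p h ph.
have [v|f pf] := @linear_lift k (PLco L) (ures M) (ures N) (kresr p) (kresr h \o qun n).
  exact: ph.
pose g (x : PLco L) : M := f (cproj n x).
have gP c x y : g (c *: x + y) = c%:A *: g x + g y by rewrite /g !linearP.
have gn x : g (cproj n x) = g x by rewrite /g cprojK.
exists (qlift gP gn) => y; apply: (qmod_linP (f := p \o qlift gP gn) (g := h)) => x.
rewrite -[LHS]/(p (qlift gP gn (qgen n x))) qliftE -(qgen_proj n x).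
exact: (pf (cproj n x)).
Qed.

Lemma dependent_choice (T : nat -> Type) (good : forall n, T n -> Prop)
    (R : forall n, T n -> T n.+1 -> Prop) (x0 : T 0) : good 0 x0 ->
  (forall n x, good n x -> exists2 y, good n.+1 y & R n x y) ->
  exists2 f : forall n, T n, f 0 = x0 & forall n, R n (f n) (f n.+1).
Proof.
move=> g0 step.
pose next n (x : {x : T n | good n x}) : {y : T n.+1 | good n.+1 y} :=
  let: exist2 y gy _ := cid2 (step n (sval x) (svalP x)) in exist _ y gy.
pose F := fix F n : {x : T n | good n x} := if n is m.+1 then next m (F m) else exist _ x0 g0.
exists (fun n => sval (F n)) => // n.
by rewrite /= /next; case: cid2.
Qed.

(** * Comparison of projective resolutions *)

Section Comparison.
Variable R : pzRingType.

(** The indexing is shifted: [P 0] is the resolved module, [d 0] the augmentation, and [P n.+1] the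
    projective term of degree n. *)
Record resolution (P : nat -> lmodType R) (d : forall n, {linear P n.+1 -> P n}) : Prop := {
  res_proj : forall n, projective (P n.+1);
  res_square : forall n x, d n (d n.+1 x) = 0;
  res_cycle : forall n y, d n y = 0 -> exists z, d n.+1 z = y;
  res_surj : forall y, exists z, d 0 z = y }.

Variables (P Q : nat -> lmodType R).
Variables (dP : forall n, {linear P n.+1 -> P n}) (dQ : forall n, {linear Q n.+1 -> Q n}).
Hypotheses (Pres : resolution dP) (Qres : resolution dQ).

(** The invariant is that the map built so far sends boundaries into the image of [dQ]. Projectivity
    then gives the next map, and exactness restores the invariant. *)
Lemma chain_map_exists (f0 : {linear P 0 -> Q 0}) :
  exists2 f : forall n, {linear P n -> Q n}, f 0 = f0 &
    forall n x, dQ n (f n.+1 x) = f n (dP n x).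
Proof.
apply: (@dependent_choice _ (fun n (f : {linear P n -> Q n}) =>
    forall y, exists z, dQ n z = f (dP n y))
  (fun n (f : {linear P n -> Q n}) (g : {linear P n.+1 -> Q n.+1}) =>
    forall x, dQ n (g x) = f (dP n x)) f0) => [y|n f fgood].
  exact: (res_surj Qres).
have [g gE] := @res_proj _ _ Pres n _ _ (dQ n) (f \o dP n) fgood.
exists g => // y; apply: (res_cycle Qres).
by rewrite gE /= (res_square Pres) linear0.
Qed.

(** The same scheme lifts [f - s d] through [dQ]. It can start from zero because [f] vanishes on the
    resolved module. *)
Lemma chain_homotopy (f : forall n, {linear P n -> Q n}) :
  (forall n x, dQ n (f n.+1 x) = f n (dP n x)) -> (forall x, f 0 x = 0) ->
  exists2 s : forall n, {linear P n -> Q n.+1}, s 0 = \0 &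
    forall n x, f n.+1 x = dQ n.+1 (s n.+1 x) + s n (dP n x).
Proof.
move=> fd f0.
apply: (@dependent_choice _ (fun n (s : {linear P n -> Q n.+1}) =>
    forall y, exists z, dQ n.+1 z = f n.+1 y - s (dP n y))
  (fun n (s : {linear P n -> Q n.+1}) (t : {linear P n.+1 -> Q n.+2}) =>
    forall x, f n.+1 x = dQ n.+1 (t x) + s (dP n x)) \0) => [y|n s sgood].
  by apply: (res_cycle Qres); rewrite /= subr0 fd f0.
have [t tE] := @res_proj _ _ Pres n _ _ (dQ n.+1) (f n.+1 \- (s \o dP n)) sgood.
exists t => [y|x]; last by rewrite tE /= subrK.
apply: (res_cycle Qres); rewrite linearB /= fd tE /= (res_square Pres) linear0 subr0.
by rewrite subrr.
Qed.
End Comparison.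

(** * Comparison of cohomology with coefficients *)

Section CohomologyComparison.
Variables (R : pzRingType) (N : lmodType R).

Section Cochains.
Variables (P : nat -> lmodType R) (d : forall n, {linear P n.+1 -> P n}).
Definition hom_cocycle n (c : {linear P n.+1 -> N}) := forall x, c (d n.+1 x) = 0.
(** In degree 0 only zero is a coboundary: maps out of the resolved module [P 0] are not
    cochains. *)
Definition hom_coboundary n : {linear P n.+1 -> N} -> Prop :=
  match n with
  | 0 => fun c => forall x, c x = 0
  | m.+1 => fun c => exists b : {linear P m.+1 -> N}, forall x, c x = b (d m.+1 x)
  end.
End Cochains.

Variables (P Q : nat -> lmodType R).
Variables (dP : forall n, {linear P n.+1 -> P n}) (dQ : forall n, {linear Q n.+1 -> Q n}).
Hypothesis Qres : resolution dQ.
Variables (f : forall n, {linear P n -> Q n}) (g : forall n, {linear Q n -> P n}).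
Hypothesis fd : forall n x, dQ n (f n.+1 x) = f n (dP n x).
Hypothesis gd : forall n x, dP n (g n.+1 x) = g n (dQ n x).
Hypothesis fg : forall x, f 0 (g 0 x) = x.

Lemma comp_homotopy_id : exists2 t : forall n, {linear Q n -> Q n.+1}, t 0 = \0 &
  forall n x, f n.+1 (g n.+1 x) - x = dQ n.+1 (t n.+1 x) + t n (dQ n x).
Proof.
have [n x|x|t t0 tE] := @chain_homotopy _ _ _ _ _ Qres Qres (fun n => (f n \o g n) \- idfun).
- by rewrite /= linearB /= fd gd.
- by rewrite /= fg subrr.
- by exists t.
Qed.

Lemma pullback_cocycle n (c : {linear Q n.+1 -> N}) :
  hom_cocycle dQ c -> hom_cocycle dP (c \o f n.+1).
Proof. by move=> c0 x; rewrite /= -fd c0. Qed.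

Lemma pullback_coboundary n (c : {linear Q n.+1 -> N}) :
  hom_coboundary dQ c -> hom_coboundary dP (c \o f n.+1).
Proof.
case: n c => [|n] c /=; first by move=> c0 x; rewrite /= c0.
by move=> [b cb]; exists (b \o f n.+1) => x; rewrite /= cb fd.
Qed.

(** The homotopy from the identity to [f \o g] writes [c] as a coboundary plus the pullback of
    [c \o f] along [g]. *)
Lemma pullback_inj n (c : {linear Q n.+1 -> N}) : hom_cocycle dQ c ->
  hom_coboundary dP (c \o f n.+1) -> hom_coboundary dQ c.
Proof.
move=> c0; have [t t0 tE] := comp_homotopy_id.
have cE x : c x = c (f n.+1 (g n.+1 x)) - c (t n (dQ n x)).
  have /(congr1 c) := tE n x; rewrite linearB linearD c0 add0r => <-.
  by rewrite opprB addrC subrK.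
case: n c c0 cE => [|n] c c0 cE /=.
  (* In degree 0 the homotopy term factors through the augmentation, and [t 0 = 0] removes it. *)
  by move=> cf x; rewrite cE cf t0 linear0 subr0.
move=> [b cb]; exists ((b \o g n.+1) \- (c \o t n.+1)) => x.
by rewrite cE cb gd.
Qed.
End CohomologyComparison.

Section ComparisonSurjective.
Variables (R : pzRingType) (N : lmodType R) (P Q : nat -> lmodType R).
Variables (dP : forall n, {linear P n.+1 -> P n}) (dQ : forall n, {linear Q n.+1 -> Q n}).
Hypothesis Pres : resolution dP.
Variables (f : forall n, {linear P n -> Q n}) (g : forall n, {linear Q n -> P n}).
Hypothesis fd : forall n x, dQ n (f n.+1 x) = f n (dP n x).
Hypothesis gd : forall n x, dP n (g n.+1 x) = g n (dQ n x).
Hypothesis gf : forall x, g 0 (f 0 x) = x.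

(** The preimage is [z \o g], and the homotopy for [g \o f] exhibits the difference as a
    coboundary. *)
Lemma pullback_surj n (z : {linear P n.+1 -> N}) : hom_cocycle dP z ->
  exists2 c : {linear Q n.+1 -> N}, hom_cocycle dQ c &
    hom_coboundary dP (z \- (c \o f n.+1)).
Proof.
move=> z0; exists (z \o g n.+1).
  exact: (pullback_cocycle (f := g) gd).
have [t t0 tE] := comp_homotopy_id Pres gd fd gf.
have zE x : z x - z (g n.+1 (f n.+1 x)) = - z (t n (dP n x)).
  have /(congr1 z) := tE n x; rewrite linearB linearD z0 add0r => <-.
  by rewrite opprB.
case: n z z0 zE => [|n] z z0 zE /=.
  by move=> x; rewrite zE t0 linear0 oppr0.
by exists (\- (z \o t n.+1)) => x; rewrite zE.
Qed.
End ComparisonSurjective.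

(** * Isomorphisms of subquotients from a linear relation *)

Section SubquotientIso.
Variables (R : pzRingType) (V V' : lmodType R) (Z B : submod V) (Z' B' : submod V').
Variable rel : V -> V' -> Prop.
Hypothesis relP : forall c x y x' y', rel x x' -> rel y y' -> rel (c *: x + y) (c *: x' + y').
Hypothesis rel_total : forall x, Z x -> exists2 x', Z' x' & rel x x'.
Hypothesis rel_bound : forall x x', Z x -> Z' x' -> rel x x' -> B x <-> B' x'.
Hypothesis rel_surj : forall x', Z' x' -> exists x y', [/\ Z x, Z' y', rel x y' & B' (x' - y')].

(** By [rel_bound] the class of a related element is independent of its choice and vanishes only for
    boundaries; so choosing any related representative gives a linear injection. *)
Lemma subquot_iso : exists phi : {linear subquot Z B -> subquot Z' B'}, bijective phi.
Proof.
have zP (z : submod_type Z) : Z (smval z) by have /asboolP := smvalP z.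
have zP' (z : submod_type Z') : Z' (smval z) by have /asboolP := smvalP z.
have tot (z : submod_type Z) : exists z' : submod_type Z', rel (smval z) (smval z').
  have [x' Zx' rx'] := rel_total (zP z).
  by exists (SubmodElt (asboolT Zx' : x' \in submod_pred Z')).
have [F FE] := choice tot.
pose phi (X : subquot Z B) : subquot Z' B' := qmpi _ (F (qmrepr X)).
have relB (x y : V) (x' y' : V') : rel x x' -> rel y y' -> rel (x - y) (x' - y').
  by move=> rx ry; rewrite addrC -scaleN1r [x' - y']addrC -(scaleN1r y'); apply: relP.
have phiE (z : submod_type Z) (z' : submod_type Z') :
    rel (smval z) (smval z') -> phi (qmpi _ z) = qmpi _ z'.
  move=> rz; apply/qmpiP.
  set z0 := qmrepr _; have Bz0 : B (smval (z0 - z)) := qmreprP (subquot_submod Z B) z.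
  exact: (proj1 (rel_bound (zP (z0 - z)) (zP' (F z0 - z')) (relB _ _ _ _ (FE z0) rz)) Bz0).
have phil : linear phi.
  move=> c; elim/qm_ind=> x; elim/qm_ind=> y; rewrite -linearP.
  rewrite (phiE x (F x)) // (phiE y (F y)) // -linearP; apply: phiE.
  exact: (relP c (FE x) (FE y)).
exists (HB.pack_for {linear subquot Z B -> subquot Z' B'} phi
  (GRing.isLinear.Build R (subquot Z B) (subquot Z' B') *:%R phi phil)) => /=.
have phi_inj : injective phi.
  elim/qm_ind=> x; elim/qm_ind=> y; rewrite (phiE x (F x)) // (phiE y (F y)) //.
  move/qmpiP => Bxy; apply/qmpiP.
  exact: (proj2 (rel_bound (zP (x - y)) (zP' (F x - F y)) (relB _ _ _ _ (FE x) (FE y))) Bxy).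
have phi_surj Y : exists X, phi X = Y.
  elim/qm_ind: Y => y; have [x [y' [Zx Zy' rxy By]]] := rel_surj (zP' y).
  exists (qmpi _ (SubmodElt (asboolT Zx : x \in submod_pred Z))).
  rewrite (phiE _ (SubmodElt (asboolT Zy' : y' \in submod_pred Z'))) //.
  by apply/esym/qmpiP.
have [psi psiE] := choice phi_surj.
by exists psi => X; [apply: phi_inj|]; rewrite psiE.
Qed.
End SubquotientIso.

(** * The two resolutions of the Kähler differentials *)

Section StandardResolution.
Variables (A : pzRingType) (M : lmodType A).
Definition std_mod n : lmodType A := if n is m.+1 then resP M m else M.
Definition std_d n : {linear std_mod n.+1 -> std_mod n} :=
  match n with 0 => freemod_eps M | m.+1 => @resd A M m end.

Lemma std_resolution : resolution std_d.
Proof.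
split.
- by move=> n; apply: freemod_projective.
- case=> [|n] x /=; first by apply/res_exact0; exists x.
  by apply/res_exact; exists x.
- case=> [|n] y /=; first by move/res_exact0=> [z ->]; exists z.
  by move/res_exact=> [z ->]; exists z.
- by move=> y; exists (pmgen _ y); apply: freemod_epsE.
Qed.
End StandardResolution.

Section KoszulResolution.
Variables (k : fieldType) (L : preLieAlg k).
Hypothesis pchar0 : [pchar k] =i pred0.
Definition koszul_mod n : lmodType (UPreLie L) := if n is m.+1 then Qmod L m else Omega L.
Definition koszul_d n : {linear koszul_mod n.+1 -> koszul_mod n} :=
  match n with 0 => qaug L | m.+1 => qd L m end.

Lemma koszul_resolution : resolution koszul_d.
Proof.
split.
- by move=> n; apply: Qmod_projective.
- by case=> [|n] x /=; [apply: qaug_d|apply: qd_square].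
- case=> [|n] y /=; first by move/qaug_exact=> [z ->]; exists z.
  by move/(qd_exact pchar0)=> [z ->]; exists z.
- exact: qaug_surj.
Qed.
End KoszulResolution.

(** * Coderivations and [U]-linear cochains *)

Section CentralCombination.
Variables (k : fieldType) (A : algType k) (M N : lmodType A) (a : k) (c d : {linear M -> N}).
(** The [k]-linear structure on [A]-linear maps: scalars from [k] are central in [A], so the
    combination is again [A]-linear. *)
Definition acomb (x : M) : N := a%:A *: c x + d x.
Fact acomb_linear : linear acomb.
Proof.
move=> u x y; rewrite /acomb !linearP !scalerDr !scalerA alg_comm.
by rewrite addrACA.
Qed.
HB.instance Definition _ := GRing.isLinear.Build A M N *:%R acomb acomb_linear.
End CentralCombination.

Section CochainCorrespondence.
Variables (k : fieldType) (L : preLieAlg k) (E : preLieMod L).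
Hypothesis pchar0 : [pchar k] =i pred0.
Local Notation C := (PLco (sqzero E)).

Definition qcoch n (c : {linear Qmod L n -> umod E}) : PLco L -> E := kres c \o qun n.
HB.instance Definition _ n c := GRing.Linear.copy (@qcoch n c) (kres c \o qun n).

Lemma qcoch_homog n (c : {linear Qmod L n -> umod E}) : homog_cochain n (qcoch c).
Proof. by move=> x; rewrite /= /qcoch /= [qun _ _]qgen_proj. Qed.

Lemma qcoch_d n (c : {linear Qmod L n -> umod E}) x :
  c (qd L n (qgen n.+1 x)) = dcochain (qcoch c) x.
Proof. exact: qd_nat. Qed.

Definition corresponds n (D : C -> C) (c : {linear Qmod L n -> umod E}) :=
  plcochain n D /\ forall x, c (qgen n x) = (ccog (D (cmap (@sqinl k L E) x))).2.

Lemma correspondsP n D (c : {linear Qmod L n -> umod E}) :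
  corresponds D c <-> D = colift n (sqcor (qcoch c)).
Proof.
split=> [[/(plcochainP_sqcor pchar0)[g [gn -> gE]] cE]|->].
  by apply/colift_sqcor_inj => x; rewrite gE -cE.
split; first exact/plcochain_sqcor/qcoch_homog.
by move=> x; rewrite ccog_colift /= /sqcor cmap_fst_inl.
Qed.

Lemma corresponds_exists n D : plcochain n D ->
  exists c : {linear Qmod L n -> umod E}, corresponds D c.
Proof.
move=> /[dup] Dn /(plcochainP_sqcor pchar0)[g [gn _ gE]].
have gP a x y : g (a *: x + y) = a%:A *: (g x : umod E) + g y by rewrite linearP ucst_act.
by exists (qlift (N := umod E) gP gn); split=> // x; rewrite qliftE.
Qed.

(** Up to the sign [(-1) ^+ n], both conditions say that the differential of the common underlying
    cochain is zero. *)
Lemma corresponds_cocycle n D (c : {linear Qmod L n -> umod E}) :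
  corresponds D c -> plcocycle n D <-> forall y, c (qd L n y) = 0.
Proof.
move=> Dc; have /correspondsP DE := Dc.
have dn : homog_cochain n.+1 ((-1) ^+ n \*: dcochain (qcoch c)).
  by move=> x /=; rewrite (homog_dcochain (qcoch_homog c)).
have key : pldiff n D = 0 <-> forall y, c (qd L n y) = 0.
  rewrite DE (pldiff_sqcor pchar0); last exact: qcoch_homog.
  split=> [/(colift_sqcor_eq0 pchar0 dn) d0 y|d0].
    apply: (qmod_linP (f := c \o qd L n) (g := \0)) y => x.
    rewrite [LHS]qcoch_d; have /eqP := d0 x.
    by rewrite /= scaler_eq0 expf_eq0 oppr_eq0 oner_eq0 andbF => /eqP.
  apply/(colift_sqcor_eq0 pchar0 dn) => x /=.
  by rewrite -qcoch_d d0 scaler0.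
by split=> [[_ /key]|/key]; last by split=> //; case: Dc.
Qed.

Lemma corresponds_coboundary n D (c : {linear Qmod L n -> umod E}) : corresponds D c ->
  plcoboundary n D <-> hom_coboundary (@koszul_d k L) (c : {linear koszul_mod L n.+1 -> umod E}).
Proof.
case: n D c => [|n] D c /= /[dup] Dc /correspondsP DE.
  have cn := qcoch_homog c.
  rewrite DE; split=> [/(colift_sqcor_eq0 pchar0 cn) d0 y|d0].
    by apply: (qmod_linP (f := c) (g := \0)) y => x; apply: d0.
  by apply/(colift_sqcor_eq0 pchar0 cn) => x; apply: d0.
have sgn2 : (-1) ^+ n * (-1) ^+ n = 1 :> k by apply: sgn_sq.
split.
  move=> [D' /corresponds_exists[b /correspondsP bE] DD'].
  (* The sign between [pldiff] and [dcochain] is absorbed into the primitive. *)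
  exists (acomb ((-1) ^+ n) b \0) => y.
  apply: (qmod_linP (f := c) (g := acomb ((-1) ^+ n) b \0 \o qd L n)) y => x.
  rewrite /= /acomb addr0 qcoch_d ucst_act.
  move: DD'; rewrite DE bE (pldiff_sqcor pchar0); last exact: qcoch_homog.
  by move/colift_sqcor_inj => /(_ x).
move=> [b cb].
pose g : {linear PLco L -> E} := (-1) ^+ n \*: qcoch b.
have gn : homog_cochain n g by move=> x; rewrite /= qcoch_homog.
exists (colift n (sqcor g)); first exact: plcochain_sqcor.
rewrite DE (pldiff_sqcor pchar0) //; apply/colift_sqcor_inj => x.
rewrite /= (dcochainZ (g := qcoch b) (c := (-1) ^+ n)) // scalerA sgn2 scale1r.
by rewrite -qcoch_d; apply: cb.
Qed.
End CochainCorrespondence.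

(** * Cochains computing Ext *)

Section ExtCochains.
Variables (k : fieldType) (A : algType k) (M N : lmodType A) (n : nat).
Variables (phi : resP M n -> res_scalars N) (z : {linear std_mod M n.+1 -> N}).
Hypothesis phiz : forall x, phi x = z x.

Lemma ext_cocycleE : ext_cocycle phi <-> hom_cocycle (@std_d A M) z.
Proof.
split=> [[_ p0] x|z0]; first by rewrite -phiz; apply: p0.
split=> [a x y|x]; first by rewrite !phiz linearP.
by rewrite phiz; apply: z0.
Qed.
End ExtCochains.

Lemma ext_coboundaryE (k : fieldType) (A : algType k) (M N : lmodType A) (n : nat)
    (phi : resP M n -> res_scalars N) (z : {linear std_mod M n.+1 -> N}) :
  (forall x, phi x = z x) -> ext_coboundary phi <-> hom_coboundary (@std_d A M) z.
Proof.
case: n phi z => [|n] phi z phiz /=.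
  split=> [p0 x|z0]; first by rewrite -phiz p0.
  by apply/funext => x; rewrite phiz z0.
split=> [[b bl pb]|[b zb]].
  pose b' : {linear resP M n -> N} := HB.pack (b : resP M n -> N)
    (GRing.isLinear.Build A (resP M n) N *:%R (b : resP M n -> N) bl).
  by exists b' => x; rewrite -phiz pb.
exists (b : resP M n -> res_scalars N); first by move=> a x y; apply: linearP.
by apply/funext => x; rewrite phiz zb.
Qed.

(** * The comparison isomorphism *)

Theorem corollary3 (k : fieldType) (L : preLieAlg k) (E : preLieMod L) :
  [pchar k]%R =i pred0 ->
  forall n : nat,
    exists phi : {linear HPreLie E n -> Ext (Omega L) (umod E) n}%R, bijective phi.
Proof.
move=> pchar0 n.
have rP := std_resolution (Omega L); have rQ := koszul_resolution L pchar0.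
(* The identity of [Omega L] lifts to chain maps between the two resolutions in both directions. *)
have [f f0 fd] := chain_map_exists rP rQ (idfun : {linear Omega L -> Omega L}).
have [g g0 gd] := chain_map_exists rQ rP (idfun : {linear Omega L -> Omega L}).
have fg x : f 0 (g 0 x) = x by rewrite f0 g0.
have gf x : g 0 (f 0 x) = x by rewrite f0 g0.
(* A coderivation is related to the pullback along [f] of the [U]-linear map with the same
   underlying cochain. *)
pose rel (D : PLco (sqzero E) -> PLco (sqzero E))
    (phi : resP (Omega L) n -> res_scalars (umod E)) :=
  exists2 c : {linear Qmod L n -> umod E}, corresponds D c & forall y, phi y = c (f n.+1 y).
apply: (@subquot_iso _ _ _ _ _ _ _ rel).
- move=> a D1 D2 phi1 phi2 [c1 [D1n D1c] p1] [c2 [D2n D2c] p2].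
  exists (acomb a c1 c2); last by move=> y; rewrite /= /acomb -p1 -p2.
  split; first exact: plcochainP.
  move=> x; rewrite /= /acomb D1c D2c ucst_act.
  by rewrite -[(a *: D1 + D2) _]/(a *: D1 _ + D2 _) linearP.
- move=> D /[dup] [[Dn _]] Dz; have [c Dc] := corresponds_exists pchar0 Dn.
  exists (c \o f n.+1 : resP (Omega L) n -> res_scalars (umod E)); last by exists c.
  apply/(@ext_cocycleE _ _ _ _ _ _ (c \o f n.+1)) => //.
  apply: (pullback_cocycle fd); exact/(corresponds_cocycle pchar0 Dc).
- move=> D phi Dz phiz [c Dc phic].
  have cz : hom_cocycle (@koszul_d k L) (c : {linear koszul_mod L n.+1 -> umod E}).
    exact/(corresponds_cocycle pchar0 Dc).
  rewrite -[X in X <-> _]/(plcoboundary n D) (corresponds_coboundary pchar0 Dc).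
  rewrite -[X in _ <-> X]/(ext_coboundary phi) (@ext_coboundaryE _ _ _ _ _ _ (c \o f n.+1)) //.
  split; first exact: (pullback_coboundary fd).
  exact: (pullback_inj rQ fd gd fg).
- move=> phi [phil phid].
  pose z : {linear std_mod (Omega L) n.+1 -> umod E} :=
    HB.pack (phi : resP (Omega L) n -> umod E)
      (GRing.isLinear.Build _ _ _ *:%R (phi : resP (Omega L) n -> umod E) phil).
  (* Surjectivity holds up to coboundaries: [phi] is cohomologous to the pullback of some cocycle
     [c], and [c] comes from the coderivation [D]. *)
  have [c cz cb] := pullback_surj rP fd gd gf (phid : hom_cocycle (@std_d _ (Omega L)) z).
  pose D := colift n (sqcor (qcoch (c : {linear Qmod L n -> umod E}))).
  have Dc : corresponds D (c : {linear Qmod L n -> umod E}) by apply/correspondsP.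
  exists D, (c \o f n.+1 : resP (Omega L) n -> res_scalars (umod E)); split.
  + exact/(corresponds_cocycle pchar0 Dc).
  + apply/(@ext_cocycleE _ _ _ _ _ _ (c \o f n.+1)) => //.
    exact: (pullback_cocycle fd).
  + by exists c.
  + exact/(@ext_coboundaryE _ _ _ _ _ _ (z \- (c \o f n.+1))).
Qed.
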